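(* Let $H\in(1/2,1)$, $\gamma\in(1/2,H)$, $\alpha>1$, let $W^H$ be a real-valued fractional Brownian motion with Hurst parameter $H$ on a probability space $(\Omega,\mathcal{F},\mathbb{P})$, and let $\xi$ be a time-independent smooth divergence-free vector field on $\mathbb{T}^2$. Let $t>0$ and let $\omega$ be a (weak) solution on $[0,t]$ of the vorticity equation $d\omega_s+u_s\cdot\nabla\omega_s\,ds+\xi\cdot\nabla\omega_s\,dW^H_s=\Delta\omega_s\,ds$ with paths in $C([0,t],\mathcal{B}_\alpha)\cap C^\gamma([0,t],\mathcal{B}_{\alpha-\gamma})$. Let $\varphi$ be a smooth test function on $\mathbb{T}^2$ (for example $\varphi(x)=\exp(ik\cdot x)$). Then for the dyadic partitions $t_j=j2^{-k}$, $j\ge0$, one has $\mathbb{P}$-almost surely $$\lim_{k\to\infty}\Big(\frac1{2^k}\Big)^{1-2H}\sum_{j\in\mathcal{A}_t^{2^k}}\big((\omega_{t_{j+1}},\varphi)-(\omega_{t_j},\varphi)\big)^2=\int_0^t(\omega_s,\xi\cdot\nabla\varphi)^2\,ds.$$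
   Context: For $\beta\in\mathbb{R}$, $\mathcal{B}_\beta=H^{2\beta}(\mathbb{T}^2)$ is the $L^2$-based Sobolev space on the two-dimensional torus; $C^\gamma([0,t],\mathcal{B}_\beta)$ denotes $\gamma$-Hölder continuous functions. $(f,g)=\int_{\mathbb{T}^2}f g\,dx$. $\mathcal{A}_t^{2^k}=\{j\ge0:\ [t_j,t_{j+1}]\subset[0,t]\}$ with $t_j=j2^{-k}$. $u_s$ is the divergence-free zero-mean velocity field with $\mathrm{curl}\,u_s=\omega_s$ (Biot–Savart law on the torus). That $\omega$ is a weak solution means that, almost surely, for every $\psi\in C^\infty(\mathbb{T}^2)$ and every $r\in[0,t]$, $(\omega_r,\psi)=(\omega_0,\psi)+\int_0^r(\omega_s,u_s\cdot\nabla\psi+\Delta\psi)\,ds+\int_0^r(\omega_s,\xi\cdot\nabla\psi)\,dW^H_s$, the last integral being a pathwise Young integral. *)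

(* Defs.v *)
From HB Require Import structures.
From mathcomp Require Import all_boot all_order all_algebra.
From mathcomp Require Import all_classical all_reals all_analysis.
From mathcomp Require Import complex.

Set Implicit Arguments.
Unset Strict Implicit.
Unset Printing Implicit Defensive.

Import Order.TTheory GRing.Theory Num.Theory.
Import numFieldNormedType.Exports.

Local Open Scope classical_set_scope.
Local Open Scope ring_scope.
Local Open Scope complex_scope.

(* The torus is T^2 = R^2 / (2 pi Z)^2, so that x |-> exp (i k.x) is a function
   on T^2 for every k in Z^2. A function on T^2 is a 2 pi-periodic function on
   R * R, and integrals over T^2 are Lebesgue integrals over the fundamental
   square [0, 2 pi]^2. Elements of L^2(T^2) are represented by functions; every
   notion applied to them below is invariant under a.e. equality. *)

Section torus.
Context {R : realType}.
Implicit Types (f g psi : R * R -> R) (v : R * R -> R * R) (phi : R * R -> R[i]).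

Definition periodic2 {V : Type} (f : R * R -> V) : Prop :=
  forall x1 x2, f (x1 + 2 * pi, x2) = f (x1, x2) /\
                f (x1, x2 + 2 * pi) = f (x1, x2).

Definition torus : set (R * R) := `[0, 2 * pi] `*` `[0, 2 * pi].

Definition lebesgue2 : set (measurableTypeR R * measurableTypeR R) -> \bar R :=
  (@lebesgue_measure R \x @lebesgue_measure R)%E.

Definition torus_int f : R := Rintegral lebesgue2 torus f.

Definition pairing f g : R := torus_int (fun x => f x * g x).

(* No complex conjugate is taken: (f, phi) is bilinear. *)
Definition pairingC f phi : R[i] :=
  pairing f (fun x => complex.Re (phi x)) +i*
  pairing f (fun x => complex.Im (phi x)).

Definition torusL2 f : Prop :=
  [/\ periodic2 f,
      measurable_fun (torus : set (measurableTypeR R * measurableTypeR R)) f &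
      ((\int[lebesgue2]_(x in torus) (f x ^+ 2)%R%:E) < +oo)%E].

Definition basis_dir (i : bool) : R * R := if i then (0, 1) else (1, 0).

Definition partial (i : bool) f : R * R -> R := fun x => 'D_(basis_dir i) f x.

Definition d1 := partial false.
Definition d2 := partial true.

(* C^infinity: the iterated partial derivatives of all orders exist everywhere
   and are continuous *)
Definition smooth f : Prop :=
  forall l : seq bool,
    let g := foldr partial f l in
    continuous g /\ forall (i : bool) x, derivable g x (basis_dir i).

Definition test_fun psi : Prop := periodic2 psi /\ smooth psi.

Definition test_funC phi : Prop :=
  test_fun (fun x => complex.Re (phi x)) /\
  test_fun (fun x => complex.Im (phi x)).

Definition advect v psi : R * R -> R :=
  fun x => (v x).1 * d1 psi x + (v x).2 * d2 psi x.

Definition advectC v phi : R * R -> R[i] :=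
  fun x => advect v (fun y => complex.Re (phi y)) x +i*
           advect v (fun y => complex.Im (phi y)) x.

Definition laplacian psi : R * R -> R :=
  fun x => d1 (d1 psi) x + d2 (d2 psi) x.

Definition smooth_divfree v : Prop :=
  [/\ test_fun (fun x => (v x).1), test_fun (fun x => (v x).2) &
      forall x, d1 (fun y => (v y).1) x + d2 (fun y => (v y).2) x = 0].

(* v has zero mean, div v = 0 and curl v = d1 v2 - d2 v1 = w in the sense of
   distributions. For w in L^2 this determines v in L^2 up to a.e. equality. *)
Definition biot_savart w v : Prop :=
  [/\ torusL2 (fun x => (v x).1) /\ torusL2 (fun x => (v x).2),
      torus_int (fun x => (v x).1) = 0 /\ torus_int (fun x => (v x).2) = 0,
      forall psi, test_fun psi ->
        torus_int (fun x => (v x).1 * d1 psi x + (v x).2 * d2 psi x) = 0 &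
      forall psi, test_fun psi ->
        torus_int (fun x => (v x).1 * d2 psi x - (v x).2 * d1 psi x) =
        pairing w psi].

Definition fourier_coef f (k : int * int) : R[i] :=
  ((2 * pi) ^- 2)%:C *
  pairingC f (fun x => let a := k.1%:~R * x.1 + k.2%:~R * x.2 in
                       cos a -i* sin a).

Definition sobolev_norm (s : R) f : \bar R :=
  ((\esum_(k in [set: int * int])
      ((1 + k.1%:~R ^+ 2 + k.2%:~R ^+ 2) `^ s *
       (complex.Re (fourier_coef f k) ^+ 2 +
        complex.Im (fourier_coef f k) ^+ 2))%R%:E) `^ 2^-1)%E.

(* B_b = H^(2b)(T^2). This representation by L^2 functions is the whole space
   for b >= 0, the only range in which it is used. *)
Definition Bnorm (b : R) f : \bar R := sobolev_norm (2 * b) f.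

Definition inB (b : R) f : Prop := torusL2 f /\ (Bnorm b f < +oo)%E.

Definition continuous_path (b t : R) (w : R -> R * R -> R) : Prop :=
  (forall s, s \in `[0, t] -> inB b (w s)) /\
  forall s, s \in `[0, t] ->
    Bnorm b (w r \- w s) @[r --> within `[0, t] (nbhs s)] --> 0%E.

Definition holder_path (g b t : R) (w : R -> R * R -> R) : Prop :=
  (forall s, s \in `[0, t] -> inB b (w s)) /\
  exists C : R, forall r s, r \in `[0, t] -> s \in `[0, t] ->
    (Bnorm b (w r \- w s)%R <= (C * `|r - s| `^ g)%R%:E)%E.

End torus.

Section time_integrals.
Context {R : realType}.

(* Limit of the left-point sums of Y dX over the partitions of [a, b], as the
   mesh tends to 0. The partition is a = t_0 < t_1 < ... < t_n = b with
   t_i = nth b (a :: s) i and n = size s. *)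
Definition is_young_integral (Y X : R -> R) (a b I : R) : Prop :=
  forall e : R, 0 < e -> exists2 d : R, 0 < d &
    forall s : seq R, itv_partition a b s ->
      let p i := nth b (a :: s) i in
      (forall i, (i < size s)%N -> p i.+1 - p i < d) ->
      `| \sum_(i < size s) Y (p i) * (X (p i.+1) - X (p i)) - I | < e.

Definition time_int (a b : R) (f : R -> R) : R :=
  Rintegral (@lebesgue_measure R) `[a, b] f.

Definition time_intC (a b : R) (f : R -> R[i]) : R[i] :=
  time_int a b (fun s => complex.Re (f s)) +i*
  time_int a b (fun s => complex.Im (f s)).

Definition dyadic (k j : nat) : R := j%:R / 2 ^+ k.

(* Only the dyadic intervals contained in [0, t] count: when t is not dyadic the
   interval straddling t is dropped. *)
Definition dyadic_index (t : R) (k : nat) : set nat :=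
  [set j | `[dyadic k j, dyadic k j.+1] `<=` `[0, t]].

End time_integrals.

Section fractional_brownian_motion.
Context {R : realType} {d : measure_display} {T : measurableType d}.
Variable P : probability T R.

(* Point masses count as Gaussian; normal_prob m 0 is not a point mass in the
   library, hence the separate case. *)
Definition gaussian_law (X : T -> R) : Prop :=
  (exists m : R, forall A : set (measurableTypeR R), measurable A ->
     pushforward P X A = \d_m A) \/
  (exists m sigma : R, 0 < sigma /\
     forall A : set (measurableTypeR R), measurable A ->
       pushforward P X A = normal_prob m sigma A).

Definition gaussian_process (W : R -> {RV P >-> R}) : Prop :=
  forall (n : nat) (c s : 'I_n -> R), (forall i, 0 <= s i) ->
    gaussian_law (fun x => \sum_(i < n) c i * W (s i) x).

(* Fractional Brownian motion (W_s) for s >= 0; the values at s < 0 are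
   irrelevant. W_0 = 0 a.s. follows from the covariance. *)
Definition fBm (H : R) (W : R -> {RV P >-> R}) : Prop :=
  [/\ gaussian_process W,
      forall s, 0 <= s -> ('E_P[W s] = 0)%E,
      forall r s, 0 <= r -> 0 <= s ->
        covariance P (W r) (W s) =
        (2^-1 * (r `^ (2 * H) + s `^ (2 * H) - `|r - s| `^ (2 * H)))%:E &
      {ae P, forall x, {within `[0, +oo[, continuous (fun s => W s x)}}].

End fractional_brownian_motion.

Section vorticity.
Context {R : realType} {d : measure_display} {T : measurableType d}.
Variable P : probability T R.

Definition B_process (b t : R) (omega : R -> T -> R * R -> R) : Prop :=
  forall s, s \in `[0, t] ->
    (forall x, inB b (omega s x)) /\
    (* weak measurability, equivalent to Borel measurability in the separable
       Hilbert space B_b *)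
    forall psi, test_fun psi ->
      measurable_fun setT (fun x => pairing (omega s x) psi).

(* The weak equation along one path: w is the vorticity, u the velocity and W
   the driving signal. *)
Definition weak_equation (t : R) (xi : R * R -> R * R) (W : R -> R)
    (w : R -> R * R -> R) (u : R -> R * R -> R * R) : Prop :=
  forall psi, test_fun psi -> forall r, r \in `[0, t] ->
    exists2 I : R,
      is_young_integral (fun s => pairing (w s) (advect xi psi)) W 0 r I &
      pairing (w r) psi =
        pairing (w 0) psi
        + time_int 0 r (fun s =>
            pairing (w s) (advect (u s) psi \+ laplacian psi))
        + I.

Definition weak_solution (t alpha gamma : R) (xi : R * R -> R * R)
    (W : R -> {RV P >-> R}) (omega : R -> T -> R * R -> R) : Prop :=
  B_process alpha t omega /\
  {ae P, forall x,
    [/\ continuous_path alpha t (fun s => omega s x),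
        holder_path gamma (alpha - gamma) t (fun s => omega s x) &
        exists2 u : R -> R * R -> R * R,
          forall s, s \in `[0, t] -> biot_savart (omega s x) (u s) &
          weak_equation t xi (fun s => W s x) (fun s => omega s x) u]}.

End vorticity.

(* Main.v *)
Require Import Defs.
From HB Require Import structures.
From mathcomp Require Import all_boot all_order all_algebra.
From mathcomp Require Import all_classical all_reals all_analysis.
From mathcomp Require Import measurable_realfun complex.
From mathcomp Require Import ring lra.

Set Implicit Arguments.
Unset Strict Implicit.
Unset Printing Implicit Defensive.

Import Order.TTheory GRing.Theory Num.Theory.
Import numFieldNormedType.Exports.

Local Open Scope classical_set_scope.
Local Open Scope ring_scope.
Local Open Scope complex_scope.

(** The proof combines an almost sure statement on the noise with a pathwise
    argument.

    Noise. Let [X_j] be the increments of the fractional Brownian motion over the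
    dyadic intervals of level [N] inside a fixed interval. They are jointly
    Gaussian, so by Isserlis' formula the variance of the sum of the [X_j ^+ 2] is
    twice the sum of the squared covariances. As [H > 1 / 2], the covariances are
    nonnegative; hence this sum is at most the largest covariance times the sum
    of all covariances, and the latter is the variance of the increment over the
    whole interval. After normalization the variance decays geometrically in [N],
    and almost surely the normalized quadratic variation over every dyadic
    interval converges to the length of the interval ([fBm_dyadic_var]).

    Paths. Fix a signal [w] with this property. If [f] is the Young integral of a
    Hoelder integrand [g] of exponent [gamma > 1 / 2] against [w], up to a
    Lipschitz drift, then its normalized dyadic quadratic variation over [[0, t]]
    converges to the integral of [g ^+ 2] ([path_quadratic_variation]). The
    distance between the increments of the Young integral and the one-point
    approximations [g (t_j) * (w (t_j.+1) - w (t_j))] is estimated in mean square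
    over the grid: refining the left-point sums by one level creates products of
    one increment of [g] and one of [w], and the squares of the latter are
    controlled by the quadratic variation of [w] itself ([young_error_le]). The
    drift is negligible as [H < 1], cross terms are handled by Cauchy--Schwarz,
    and the main term is a Riemann sum against the quadratic variation of [w]
    ([weighted_var_cvg]).

    Solutions. Tested against [psi], the weak equation says that [(omega_s, psi)]
    is of this form with [g s = (omega_s, xi . grad psi)]
    ([weak_equation_young_path]). What must be shown is that [g] is Hoelder
    continuous and that the integrand [(omega_s, u_s . grad psi + laplacian psi)]
    of the drift is bounded and continuous. Both follow from the Hoelder continuity of
    [omega] and [u] with values in [L^2]. For [omega] this holds because a Sobolev
    norm of nonnegative index dominates the [L^2] norm ([L2_le_Bnorm]); for [u]
    because the Biot--Savart law is bounded on [L^2], which is read off the Fourier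
    coefficients by testing the equations for the divergence and the curl against
    the modes ([biot_savart_L2]). Both steps bound the [L^2] norm by the l^2 norm of
    the Fourier coefficients ([parseval_le]), which rests on the density of
    trigonometric polynomials in [L^2] ([trigpol_dense]).

    A complex test function gives two real paths [f1] and [f2]; the real and
    imaginary parts of [(f1 + i f2) ^+ 2] are linear combinations of the squares of
    [f1], [f2] and [f1 + f2], and the result applies to each of these paths. *)

(** * Moments of Gaussian variables *)

Section gaussian_moments.
Context {R : realType}.
Local Notation mu := (@lebesgue_measure R).

Lemma integralT_cvg_itv (f : R -> R) : continuous f -> (forall x, 0 <= f x) ->
  (\int[mu]_(x in `[(- n.+1%:R)%R, (n.+1%:R)%R]) (f x)%:E @[n --> \oo] -->
   \int[mu]_x (f x)%:E)%E.
Proof.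
move=> cf f0.
have mf : measurable_fun [set: R] (EFin \o f).
  by apply/measurable_EFinP; exact: continuous_measurable_fun.
have -> : [set: R] = \bigcup_n [set` `[- n.+1%:R, n.+1%:R : R]].
  apply/esym; rewrite -subTset => x _ /=; exists (Num.truncn `|x|) => //=.
  by rewrite in_itv /= -ler_norml ltW// truncnS_gt.
apply: ge0_nondecreasing_set_cvg_integral => //.
- apply/nondecreasing_seqP => n; rewrite subsetEset; apply: subset_itv;
  by rewrite bnd_simp ?lerN2 ler_nat.
- by move=> n; exact: measurable_funTS.
- by move=> n x _; rewrite lee_fin.
Qed.

(** If an antiderivative [F] of [f - g] vanishes at both infinities, then the
    nonnegative functions [f] and [g] have the same integral. *)
Lemma integral_eq_antiderivative (f g F : R -> R) (A : R) :
  continuous f -> continuous g ->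
  (forall x, 0 <= f x) -> (forall x, 0 <= g x) ->
  (forall x : R, is_derive x (1 : R) F (f x - g x)) ->
  (F n.+1%:R - F (- n.+1%:R) @[n --> \oo] --> (0 : R)) ->
  (\int[mu]_x (f x)%:E)%E = A%:E -> (\int[mu]_x (g x)%:E)%E = A%:E.
Proof.
move=> cf cg f0 g0 dF F0 fA.
have itg h n : continuous h ->
    mu.-integrable `[- n.+1%:R, n.+1%:R] (EFin \o (h : R -> R)).
  move=> ch; apply: continuous_compact_integrable => //.
    exact: segment_compact.
  exact: continuous_subspaceT.
have key n : (\int[mu]_(x in `[(- n.+1%:R)%R, (n.+1%:R)%R]) (g x)%:E =
    \int[mu]_(x in `[(- n.+1%:R)%R, (n.+1%:R)%R]) (f x)%:E
    - (F n.+1%:R - F (- n.+1%:R))%R%:E)%E.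
  have := @continuous_FTC2 R (f \- g) F (- n.+1%:R) n.+1%:R.
  rewrite gtrN ?ltr0n// => /(_ isT) /= H.
  have cF : continuous F.
    move=> x; apply/differentiable_continuous/derivable1_diffP.
    exact: ex_derive.
  rewrite EFinN EFinB -EFinN -H.
  - under [X in (_ = _ - X)%E]eq_integral do rewrite EFinB.
    rewrite integralB//; [|exact: itg..].
    have ff := integrable_fin_num _ (itg f n cf).
    have fg := integrable_fin_num _ (itg g n cg).
    rewrite -(fineK (ff _))// -(fineK (fg _))// -!EFinB.
    by congr EFin; ring.
  - by apply: continuous_subspaceT => x; apply: cvgB; [exact: cf|exact: cg].
  - split; first by move=> x _; apply: ex_derive.
    + exact/cvg_at_right_filter/cF.
    + exact/cvg_at_left_filter/cF.
  - by move=> x _; rewrite derive1E; exact: derive_val.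
have := integralT_cvg_itv cg g0.
under eq_fun do rewrite key.
move/(cvg_lim (@ereal_hausdorff R)) => <-.
apply: (cvg_lim (@ereal_hausdorff R)).
rewrite -[in X in _ --> X](sube0 A%:E).
apply: cvgeB => //; first by rewrite -fA; exact: integralT_cvg_itv.
apply: cvg_EFin => //. exact: nearW.
Qed.

Lemma cvg_boundary0 (F : R -> R) (m C : R) : 0 <= C ->
  (forall x, 1 <= `|x - m| -> `|F x| <= C / `|x - m|) ->
  (F n.+1%:R - F (- n.+1%:R) @[n --> \oo] --> (0 : R)).
Proof.
move=> C0 FC; apply/cvgr0Pnorm_lt => e e0.
near=> n.
have hn : `|m| + 1 + (C + C + 1) / e <= n.+1%:R.
  near: n; have := nbhs_infty_ger (`|m| + 1 + (C + C + 1) / e).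
  by apply: filterS => n hn; rewrite (le_trans hn)// ler_nat.
have Ce0 : 0 < (C + C + 1) / e by rewrite divr_gt0//; lra.
have key (x : R) : `|x| = n.+1%:R -> `|F x| <= C / ((C + C + 1) / e).
  move=> xn; have h : (C + C + 1) / e + 1 <= `|x - m|.
    by have := lerB_dist x m; rewrite xn; lra.
  apply: (le_trans (FC _ _)); first lra.
  rewrite ler_wpM2l// lef_pV2 ?posrE//; lra.
apply: (le_lt_trans (ler_normB _ _)).
have h1 := key n.+1%:R (ger0_norm (ler0n _ _)).
have h2 := key (- n.+1%:R) (etrans (normrN _) (ger0_norm (ler0n _ _))).
apply: (le_lt_trans (lerD h1 h2)).
have -> : C / ((C + C + 1) / e) + C / ((C + C + 1) / e)
        = (C + C) / (C + C + 1) * e by field; lra.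
rewrite gtr_pMl// ltr_pdivrMr; lra.
Unshelve. all: by end_near. Qed.

Variables (m s : R).
Hypothesis s0 : 0 < s.
Local Notation p := (normal_pdf m s).

(** A crude decay of the density and its products with low powers, from
    [1 + u ^+ 2 / 2 <= expR u]. *)
Lemma normal_pdf_decay k (x : R) : (k <= 3)%N -> 1 <= `|x - m| ->
  `|(x - m) ^+ k * p x| <= (8 * s ^+ 4 * normal_peak s) / `|x - m|.
Proof.
move=> k3 y1; rewrite normal_pdfE ?gt_eqF// /normal_fun.
set y := x - m in y1 *; set K := normal_peak s.
have K0 : 0 <= K := normal_peak_ge0 s.
have s2 : 0 < s ^+ 2 by rewrite exprn_gt0.
set u := y ^+ 2 / (s ^+ 2 *+ 2).
have y0 : 0 < `|y| by lra.
have yy : y ^+ 2 = `|y| ^+ 2 by rewrite real_normK ?num_real.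
have u0 : 0 < u.
  by rewrite /u yy divr_gt0 ?exprn_gt0// mulrn_wgt0.
have e1 : expR (- y ^+ 2 / (s ^+ 2 *+ 2)) <= 2 / u ^+ 2.
  rewrite mulNr expRN -/u -[leRHS]invrK lef_pV2 ?posrE ?expR_gt0 ?invr_gt0 ?divr_gt0 ?exprn_gt0//.
  rewrite invf_div; have := expR_ge1Dxn 1 (ltW u0); rewrite [_`!%:R]/(2%:R); lra.
rewrite normrM normrX [X in _ * X]ger0_norm; last by rewrite mulr_ge0// expR_ge0.
have h1 : `|y| ^+ k <= `|y| ^+ 3 by exact: ler_weXn2l.
apply: (@le_trans _ _ (`|y| ^+ 3 * (K * (2 / u ^+ 2)))).
  by rewrite ler_pM// ?exprn_ge0 ?mulr_ge0 ?expR_ge0// ler_wpM2l.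
rewrite le_eqVlt; apply/orP; left; apply/eqP.
by rewrite /u yy; field; rewrite ?mulrn_eq0 gt_eqF//= gt_eqF.
Qed.

(** Integrating this derivative over the line expresses the moment of order
    [k + 1] through the one of order [k - 1]. *)
Lemma is_derive_normal_pdf k (x : R) :
  is_derive x (1 : R) (fun x => (x - m) ^+ k * p x)
    (k%:R * (x - m) ^+ k.-1 * p x - (x - m) ^+ k.+1 / s ^+ 2 * p x).
Proof.
rewrite normal_pdfE ?gt_eqF// /normal_fun; set K := normal_peak s.
have d0 : is_derive x (1 : R) (fun x : R => x - m) 1.
  by rewrite -[X in is_derive _ _ _ X]subr0; apply: is_deriveB.
have d1 n : is_derive x (1 : R) (fun x : R => (x - m) ^+ n) (n%:R * (x - m) ^+ n.-1).
  have := @is_deriveX _ _ _ n _ _ _ d0; rewrite /GRing.scale /= mulr1.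
  by rewrite (_ : _ ^+ n = fun x => (x - m) ^+ n)//; apply/funext => y; elim: n => [|n IH]; rewrite ?expr0 ?exprS -?IH.
have d2 : is_derive x (1 : R) (fun x : R => - (x - m) ^+ 2 / (s ^+ 2 *+ 2))
    (- (x - m) / s ^+ 2).
  have := is_deriveZ (- (s ^+ 2 *+ 2)^-1) (d1 2%N); rewrite /GRing.scale /=.
  have -> : ((- (s ^+ 2 *+ 2)^-1) \*: fun x : R => (x - m) ^+ 2) = (fun x : R => - (x - m) ^+ 2 / (s ^+ 2 *+ 2)).
    by apply/funext => y; rewrite /= /GRing.scale /=; ring.
  move=> h; apply: (is_derive_eq h).
  have : s ^+ 2 != 0 by rewrite gt_eqF// exprn_gt0.
  by move=> _; field; rewrite gt_eqF.
have d3 := is_derive1_comp (is_derive_expR _) d2.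
have d4 := is_deriveZ K d3.
have d5 := is_deriveM (d1 k) d4.
apply: (is_derive_eq d5); rewrite /GRing.scale /=.
rewrite (exprS (x - m) k) -[K *: _]/(K * _).
set E := expR _; set a := (x - m) ^+ k.-1; set b := (x - m) ^+ k; set c := s ^+ 2.
ring.
Qed.

Let continuousX k : continuous (fun x : R => (x - m) ^+ k).
Proof.
move=> x; apply: (continuous_comp (f := fun x : R => x - m) (g := fun x => x ^+ k)).
  by apply: cvgB; [exact: cvg_id|exact: cvg_cst].
exact: exprn_continuous.
Qed.

Let cp : continuous p.
Proof. by apply: continuous_normal_pdf; rewrite gt_eqF. Qed.

Let p0 x : 0 <= p x. Proof. exact: normal_pdf_ge0. Qed.

Let boundary0 k : (k <= 3)%N -> (let F x := (x - m) ^+ k * p x in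
  F n.+1%:R - F (- n.+1%:R) @[n --> \oo] --> (0 : R)).
Proof.
move=> k3; apply: (cvg_boundary0 (C := 8 * s ^+ 4 * normal_peak s)).
  by rewrite !mulr_ge0// ?exprn_ge0 ?normal_peak_ge0// ltW.
by move=> x; exact: normal_pdf_decay.
Qed.

Lemma integral_normal_sqr : (\int[mu]_x ((x - m) ^+ 2 * p x)%:E = (s ^+ 2)%:E)%E.
Proof.
have s2 : s ^+ 2 != 0 by rewrite gt_eqF// exprn_gt0.
have h : (\int[mu]_x ((x - m) ^+ 2 / s ^+ 2 * p x)%:E = 1%:E)%E.
  apply: (@integral_eq_antiderivative p _ (fun x => (x - m) ^+ 1 * p x)) => //.
  - move=> x; apply: cvgM; last exact: cp.
    by apply: cvgM; [exact: continuousX|exact: cvg_cst].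
  - by move=> x; rewrite mulr_ge0// divr_ge0 ?sqr_ge0.
  - move=> x; apply: (is_derive_eq (is_derive_normal_pdf 1 x)).
    by rewrite /= expr0; ring.
  - exact: (boundary0 (k := 1)).
  - exact: integral_normal_pdf.
transitivity (\int[mu]_x ((s ^+ 2)%:E * ((x - m) ^+ 2 / s ^+ 2 * p x)%:E))%E.
  by apply: eq_integral => x _; rewrite -EFinM; congr EFin; field; rewrite gt_eqF.
rewrite ge0_integralZl//; last 2 first.
- by move=> x _; rewrite lee_fin mulr_ge0// divr_ge0 ?sqr_ge0.
- by rewrite lee_fin sqr_ge0.
- by rewrite h mule1.
- apply/measurable_EFinP; apply: continuous_measurable_fun => x.
  apply: cvgM; last exact: cp.
  by apply: cvgM; [exact: continuousX|exact: cvg_cst].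
Qed.

Lemma integral_normal_expr4 :
  (\int[mu]_x ((x - m) ^+ 4 * p x)%:E = (3 * (s ^+ 2) ^+ 2)%:E)%E.
Proof.
have s2 : s ^+ 2 != 0 by rewrite gt_eqF// exprn_gt0.
have c24 k : continuous (fun x => (x - m) ^+ k * p x).
  by move=> x; apply: cvgM; [exact: continuousX|exact: cp].
have m24 k c : measurable_fun [set: R] (fun x => (c * ((x - m) ^+ k * p x))%:E).
  apply/measurable_EFinP; apply: continuous_measurable_fun => x.
  by apply: cvgM; [exact: cvg_cst|exact: c24].
have h : (\int[mu]_x ((s ^+ 2)^-1 * ((x - m) ^+ 4 * p x))%:E = (3 * s ^+ 2)%:E)%E.
  apply: (@integral_eq_antiderivative (fun x => 3 * ((x - m) ^+ 2 * p x)) _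
    (fun x => (x - m) ^+ 3 * p x)) => //.
  - by move=> x; apply: cvgM; [exact: cvg_cst|exact: c24].
  - by move=> x; apply: cvgM; [exact: cvg_cst|exact: c24].
  - by move=> x; rewrite mulr_ge0// mulr_ge0// sqr_ge0.
  - by move=> x; rewrite mulr_ge0 ?invr_ge0 ?sqr_ge0// mulr_ge0// exprn_even_ge0.
  - move=> x; apply: (is_derive_eq (is_derive_normal_pdf 3 x)).
    by rewrite /=; ring.
  - exact: (boundary0 (k := 3)).
  - under eq_integral do rewrite EFinM.
    rewrite ge0_integralZl//; last 2 first.
    + by apply: eq_measurable_fun (m24 2%N 1) => x _; rewrite mul1r.
    + by move=> x _; rewrite lee_fin mulr_ge0// sqr_ge0.
    + by rewrite integral_normal_sqr.
transitivity (\int[mu]_x ((s ^+ 2)%:E * ((s ^+ 2)^-1 * ((x - m) ^+ 4 * p x))%:E))%E.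
  by apply: eq_integral => x _; rewrite -EFinM; congr EFin; field; rewrite gt_eqF.
rewrite ge0_integralZl//; last 2 first.
- by move=> x _; rewrite lee_fin mulr_ge0 ?invr_ge0 ?sqr_ge0// mulr_ge0// exprn_even_ge0.
- by rewrite lee_fin sqr_ge0.
- by rewrite h -EFinM; congr EFin; ring.
- exact: m24.
Qed.

(** The density is symmetric about [m], in integrated form: this identifies
    the parameter [m] with the mean. *)
Lemma integral_normal_posneg : exists A : R,
  (\int[mu]_x (Num.max (x - m) 0 * p x)%:E = A%:E)%E /\
  (\int[mu]_x (Num.max (m - x) 0 * p x)%:E = A%:E)%E.
Proof.
have s2 : 0 < s ^+ 2 by rewrite exprn_gt0.
have csub (a b : R) : continuous (fun x : R => Num.max (a * x + b) 0 * p x).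
  move=> x; apply: cvgM; last exact: cp.
  apply: (@continuous_max R R (fun x => a * x + b) (cst 0) x); last exact: cvg_cst.
  by apply: cvgD; [apply: cvgM; [exact: cvg_cst|exact: cvg_id]|exact: cvg_cst].
have cpos : continuous (fun x : R => Num.max (x - m) 0 * p x).
  by move=> x; have := csub 1 (- m) x; under eq_fun do rewrite mul1r.
have cneg : continuous (fun x : R => Num.max (m - x) 0 * p x).
  move=> x; have := csub (-1) m x.
  by under eq_fun do rewrite mulN1r addrC.
have max0 (y : R) : 0 <= Num.max y 0 by rewrite le_max lexx orbT.
have cZ (h : R -> R) c : continuous h -> continuous (fun x => c * h x).
  by move=> ch x; apply: cvgM; [exact: cvg_cst|exact: ch].
have mc (h : R -> R) : continuous h -> measurable_fun [set: R] (fun x => (h x)%:E).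
  by move=> ch; apply/measurable_EFinP; exact: continuous_measurable_fun.
have fin : (\int[mu]_x (Num.max (m - x) 0 * p x)%:E < +oo)%E.
  apply: (@le_lt_trans _ _ (\int[mu]_x ((p x)%:E + ((x - m) ^+ 2 * p x)%:E))%E).
    apply: ge0_le_integral => //.
    - by move=> x _; rewrite lee_fin mulr_ge0.
    - exact: mc.
    - apply: emeasurable_funD; apply: mc => //.
      by move=> x; apply: cvgM; [exact: continuousX|exact: cp].
    - move=> x _; rewrite -EFinD lee_fin -{2}(mul1r (p x)) -mulrDl ler_wpM2r//.
      have := sqr_ge0 (x - m + 2^-1); have := sqr_ge0 (x - m).
      rewrite ge_max; move: (x - m) (opprB x m) => y <-; rewrite sqrrD => h1 h2.
      by apply/andP; split; lra.
  rewrite ge0_integralD//.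
  - by rewrite integral_normal_pdf integral_normal_sqr -EFinD ltry.
  - by move=> x _; rewrite lee_fin.
  - exact: mc.
  - by move=> x _; rewrite lee_fin mulr_ge0// sqr_ge0.
  - by apply: mc => x; apply: cvgM; [exact: continuousX|exact: cp].
have fnum : (\int[mu]_x (Num.max (m - x) 0 * p x)%:E)%E \is a fin_num.
  by rewrite ge0_fin_numE// integral_ge0// => x _; rewrite lee_fin mulr_ge0.
exists (fine (\int[mu]_x (Num.max (m - x) 0 * p x)%:E)%E).
split; last by rewrite fineK.
apply: (@integral_eq_antiderivative (fun x => Num.max (m - x) 0 * p x) _
  (fun x => s ^+ 2 * ((x - m) ^+ 0 * p x))) => //.
- by move=> x; rewrite mulr_ge0.
- by move=> x; rewrite mulr_ge0.
- move=> x; have := is_deriveZ (s ^+ 2) (is_derive_normal_pdf 0 x).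
  move=> h; apply: (is_derive_eq h); rewrite /GRing.scale /= mul0r mul0r sub0r.
  have -> : Num.max (m - x) 0 * p x - Num.max (x - m) 0 * p x = (m - x) * p x.
    rewrite -mulrBl; congr (_ * _).
    by case: (leP (m - x) 0); case: (leP (x - m) 0); lra.
  by rewrite expr1; field; rewrite gt_eqF.
- have := boundary0 (k := 0) isT; rewrite /= => h.
  rewrite -(mulr0 (s ^+ 2)); under eq_fun do rewrite -mulrBr.
  by apply: cvgM; [exact: cvg_cst|exact: h].
- by rewrite fineK.
Qed.

Lemma ge0_integral_normal_prob (f : R -> R) : measurable_fun [set: R] f ->
  (forall x, 0 <= f x) ->
  (\int[normal_prob m s]_x (f x)%:E = \int[mu]_x (f x * p x)%:E)%E.
Proof.
move=> mf f0.
have dom := @normal_prob_dominates R m s.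
have mfE : measurable_fun [set: R] (EFin \o f) by exact/measurable_EFinP.
rewrite -(Radon_Nikodym_SigmaFinite.change_of_variables dom (f := EFin \o f))//.
have mRN := measurable_int _ (Radon_Nikodym_SigmaFinite.f_integrable dom).
have mpE : measurable_fun [set: R] (EFin \o p).
  by apply/measurable_EFinP; exact: measurable_normal_pdf.
under [RHS]eq_integral do rewrite EFinM.
apply: ae_eq_integral => //.
- exact: emeasurable_funM.
- exact: emeasurable_funM.
- apply: ae_eqe_mul2l; apply: integral_ae_eq => //.
  + exact: Radon_Nikodym_SigmaFinite.f_integrable.
  + by move=> E _ mE; rewrite -Radon_Nikodym_SigmaFinite.f_integral.
Qed.

End gaussian_moments.

Section gaussian_law_moments.
Context {R : realType} {d : measure_display} {T : measurableType d}.
Variable P : probability T R.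

Lemma ge0_integral_law (X : T -> R) (nu : probability (measurableTypeR R) R)
    (f : R -> R) :
  measurable_fun [set: T] X ->
  (forall A : set (measurableTypeR R), measurable A -> pushforward P X A = nu A) ->
  measurable_fun [set: R] f -> (forall x, 0 <= f x) ->
  (\int[P]_x (f (X x))%:E = \int[nu]_x (f x)%:E)%E.
Proof.
move=> mX hX mf f0.
have mX' : @measurable_fun _ _ T (measurableTypeR R) setT X by exact: mX.
pose Y : {mfun T >-> measurableTypeR R} :=
  HB.pack X (isMeasurableFun.Build _ _ T (measurableTypeR R) X mX').
transitivity (\int[distribution P Y]_x (f x)%:E)%E.
  rewrite (ge0_integral_distribution (P := P) (f := EFin \o f) Y)//=.
  exact/measurable_EFinP.
by apply: eq_measure_integral => A mA _; apply: hX.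
Qed.

(** The mean, recovered from the integrals of the positive and negative parts of
    [X - m]. *)
Lemma mean_posneg (X : T -> R) (m A : R) : measurable_fun [set: T] X ->
  (\int[P]_x (Num.max (X x - m) 0)%:E = A%:E)%E ->
  (\int[P]_x (Num.max (m - X x) 0)%:E = A%:E)%E ->
  (\int[P]_x (X x)%:E = m%:E)%E.
Proof.
move=> mX h1 h2.
have max0 (y : R) : 0 <= Num.max y 0 by rewrite le_max lexx orbT.
have i1 : P.-integrable setT (EFin \o (fun x => Num.max (X x - m) 0)).
  apply/integrableP; split.
    apply/measurable_EFinP; apply: measurable_maxr => //.
    exact: measurable_funB.
  under eq_integral do rewrite /= ger0_norm//.
  by rewrite h1 ltry.
have i2 : P.-integrable setT (EFin \o (fun x => Num.max (m - X x) 0)).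
  apply/integrableP; split.
    apply/measurable_EFinP; apply: measurable_maxr => //.
    exact: measurable_funB.
  under eq_integral do rewrite /= ger0_norm//.
  by rewrite h2 ltry.
have i3 : P.-integrable setT (cst m%:E).
  exact: finite_measure_integrable_cst.
pose pos := fun x => Num.max (X x - m) 0; pose neg := fun x => Num.max (m - X x) 0.
transitivity (\int[P]_x ((((EFin \o pos) \- (EFin \o neg)) \+ cst m%:E) x))%E.
  apply: eq_integral => x _; rewrite /= /pos /neg -EFinB -EFinD; congr EFin.
  by case: (leP (m - X x) 0); case: (leP (X x - m) 0); lra.
rewrite integralD//; last exact: integrableB.
rewrite integralB// integral_cst//= h1 h2 -EFinB subrr add0e.
by rewrite (_ : P setT = 1%E) ?mule1//; exact: probability_setT.
Qed.

(** The second and fourth moments of a centred Gaussian variable. *)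
Lemma gaussian_law_moments (X : T -> R) : measurable_fun [set: T] X ->
  gaussian_law P X -> (\int[P]_x (X x)%:E = 0)%E ->
  exists v : R, [/\ 0 <= v, (\int[P]_x (X x ^+ 2)%:E = v%:E)%E &
    (\int[P]_x (X x ^+ 4)%:E = (3 * v ^+ 2)%:E)%E].
Proof.
move=> mX gX X0.
have mid : measurable_fun [set: R] (fun x : R => x) by exact: measurable_id.
have mX2 k : measurable_fun [set: R] (fun x : R => x ^+ k) by exact: measurable_funX.
have max0 (y : R) : 0 <= Num.max y 0 by rewrite le_max lexx orbT.
have mp m : measurable_fun [set: R] (fun x => Num.max (x - m) 0).
  by apply: measurable_maxr => //; exact: measurable_funB.
have mn m : measurable_fun [set: R] (fun x => Num.max (m - x) 0).
  by apply: measurable_maxr => //; exact: measurable_funB.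
have e2 (x : R) : 0 <= x ^+ 2 by exact: sqr_ge0.
have e4 (x : R) : 0 <= x ^+ 4 by exact: exprn_even_ge0.
case: gX => [[m hm]|[m [s [s0 hs]]]].
  have law f := @ge0_integral_law X (@dirac _ (measurableTypeR R) m R) f mX hm.
  have diracI (f : R -> R) : measurable_fun [set: R] f ->
      (\int[@dirac _ (measurableTypeR R) m R]_x (f x)%:E = (f m)%:E)%E.
    by move=> mf; rewrite integral_dirac ?diracT ?mul1e//; exact/measurable_EFinP.
  have m0 : m = 0.
    have : (\int[P]_x (X x)%:E = m%:E)%E.
      apply: (mean_posneg (A := 0)) => //.
        by rewrite (law (fun x => Num.max (x - m) 0))// diracI// subrr maxxx.
      by rewrite (law (fun x => Num.max (m - x) 0))// diracI// subrr maxxx.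
    by rewrite X0 => -[].
  exists 0; split => //.
    by rewrite (law (fun x => x ^+ 2))// diracI// m0 expr0n.
  by rewrite (law (fun x => x ^+ 4))// diracI// m0 !expr0n mulr0.
have law (f : R -> R) : measurable_fun [set: R] f -> (forall x, 0 <= f x) ->
    (\int[P]_x (f (X x))%:E =
     \int[@lebesgue_measure R]_x (f x * normal_pdf m s x)%:E)%E.
  move=> mf f0; rewrite -ge0_integral_normal_prob//.
  exact: (ge0_integral_law mX hs).
have m0 : m = 0.
  have [A [h1 h2]] := integral_normal_posneg m s0.
  have : (\int[P]_x (X x)%:E = m%:E)%E.
    apply: (mean_posneg (A := A)) => //.
      by rewrite (law (fun x => Num.max (x - m) 0)).
    by rewrite (law (fun x => Num.max (m - x) 0)).
  by rewrite X0 => -[].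
exists (s ^+ 2); split => //.
  rewrite (law (fun x => x ^+ 2))// -(integral_normal_sqr m s0).
  by under [RHS]eq_integral do rewrite {1}m0 subr0.
rewrite (law (fun x => x ^+ 4))// -(integral_normal_expr4 m s0).
by under [RHS]eq_integral do rewrite {1}m0 subr0.
Qed.

End gaussian_law_moments.

(** * Isserlis formula and almost sure convergence *)

Section gaussian_pairs.
Context {R : realType} {d : measure_display} {T : measurableType d}.
Variable P : probability T R.
Local Notation Int f := (P.-integrable setT (EFin \o f)).
Local Notation E f := (Rintegral P setT f).

Lemma ge0_Int (f : T -> R) (v : R) : measurable_fun setT f -> (forall x, 0 <= f x) ->
  (\int[P]_x (f x)%:E = v%:E)%E -> Int f /\ E f = v.
Proof.
move=> mf f0 fv; split; last by rewrite /Rintegral fv.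
apply/integrableP; split; first exact/measurable_EFinP.
by under eq_integral do rewrite /= ger0_norm//; rewrite fv ltry.
Qed.

Lemma IntD (f g : T -> R) : Int f -> Int g -> Int (fun x => f x + g x).
Proof. by move=> fi gi; have := integrableD measurableT fi gi. Qed.

Lemma IntZ (f : T -> R) c : Int f -> Int (fun x => c * f x).
Proof. by move=> fi; have := integrableZl measurableT c fi. Qed.

Lemma Int_cst c : Int (fun=> c).
Proof. exact: finite_measure_integrable_cst. Qed.

Lemma E_cst c : E (fun=> c) = c.
Proof.
rewrite (_ : (fun=> c) = cst c)// Rintegral_cst//=.
by rewrite (_ : P setT = 1%E) ?mulr1//; exact: probability_setT.
Qed.

Lemma ED (f g : T -> R) : Int f -> Int g -> E (fun x => f x + g x) = E f + E g.
Proof. by move=> fi gi; rewrite RintegralD. Qed.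

Lemma EZ (f : T -> R) c : Int f -> E (fun x => c * f x) = c * E f.
Proof. by move=> fi; rewrite RintegralZl. Qed.

Lemma Int_sum (F : nat -> T -> R) n : (forall i, Int (F i)) ->
  Int (fun x => \sum_(i < n) F i x).
Proof.
move=> iF; elim: n => [|n IH].
  by under eq_fun do rewrite big_ord0; exact: Int_cst.
by under eq_fun do rewrite big_ord_recr; exact: IntD.
Qed.

Lemma E_sum (F : nat -> T -> R) n : (forall i, Int (F i)) ->
  E (fun x => \sum_(i < n) F i x) = \sum_(i < n) E (F i).
Proof.
move=> iF; elim: n => [|n IH].
  by rewrite big_ord0; under eq_Rintegral do rewrite big_ord0; exact: E_cst.
under eq_Rintegral do rewrite big_ord_recr.
by rewrite /= ED// ?big_ord_recr/= ?IH//; exact: Int_sum.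
Qed.

(** Isserlis' formula for four factors, by polarization of the fourth moment. *)
Lemma gaussian_pair_moments (X Y : T -> R) :
  measurable_fun setT X -> measurable_fun setT Y ->
  (forall p q : R, gaussian_law P (fun x => p * X x + q * Y x)) ->
  (forall p q : R, (\int[P]_x (p * X x + q * Y x)%:E = 0)%E) ->
  [/\ Int (fun x => X x * Y x), Int (fun x => X x ^+ 2 * Y x ^+ 2) &
   E (fun x => X x ^+ 2 * Y x ^+ 2) =
     E (fun x => X x * X x) * E (fun x => Y x * Y x)
     + 2 * E (fun x => X x * Y x) ^+ 2].
Proof.
move=> mX mY gXY EXY.
have key (p q : R) : exists v, [/\ Int (fun x => (p * X x + q * Y x) ^+ 2),
    Int (fun x => (p * X x + q * Y x) ^+ 4),
    E (fun x => (p * X x + q * Y x) ^+ 2) = v &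
    E (fun x => (p * X x + q * Y x) ^+ 4) = 3 * v ^+ 2].
  have mZ : measurable_fun setT (fun x => p * X x + q * Y x).
    by apply: measurable_funD; apply: measurable_funM.
  have [v [v0 h2 h4]] := gaussian_law_moments mZ (gXY p q) (EXY p q).
  exists v.
  have [] := ge0_Int (measurable_funX 2 mZ) (fun x => sqr_ge0 _) h2.
  have [] // := ge0_Int (measurable_funX 4 mZ) (fun x => exprn_even_ge0 (n := 4) _ isT) h4.
have [a [ia2 ia4 a2 a4]] := key 1 0.
have [b [ib2 ib4 b2 b4]] := key 0 1.
have [u [iu2 iu4 u2 u4]] := key 1 1.
have [w [iw2 iw4 w2 w4]] := key 1 (-1).
have eXY : (fun x => X x * Y x) = (fun x => 4^-1 * (1 * X x + 1 * Y x) ^+ 2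
    + (- 4^-1) * (1 * X x + (-1) * Y x) ^+ 2).
  by apply/funext => x; field.
have eX2Y2 : (fun x => X x ^+ 2 * Y x ^+ 2) =
  (fun x => 12^-1 * (1 * X x + 1 * Y x) ^+ 4 + (12^-1 * (1 * X x + (-1) * Y x) ^+ 4
    + (- 6^-1 * (1 * X x + 0 * Y x) ^+ 4 + - 6^-1 * (0 * X x + 1 * Y x) ^+ 4))).
  by apply/funext => x; field.
have iXY : Int (fun x => X x * Y x) by rewrite eXY; apply: IntD; exact: IntZ.
split => //.
  by rewrite eX2Y2; apply: IntD; [|apply: IntD; [|apply: IntD]]; exact: IntZ.
have -> : E (fun x => X x * X x) = a.
  by rewrite -a2; congr Rintegral; apply/funext => x; ring.
have -> : E (fun x => Y x * Y x) = b.
  by rewrite -b2; congr Rintegral; apply/funext => x; ring.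
have EXYE : E (fun x => X x * Y x) = 4^-1 * u + - 4^-1 * w.
  by rewrite eXY ED ?EZ ?u2 ?w2//; exact: IntZ.
have uw : u + w = 2 * a + 2 * b.
  rewrite -u2 -w2 -a2 -b2 -!EZ// -!ED//; [|exact: IntZ..].
  by congr Rintegral; apply/funext => x; ring.
rewrite EXYE eX2Y2.
rewrite ED; [|exact: IntZ|by apply: IntD; [exact: IntZ|apply: IntD; exact: IntZ]].
rewrite ED; [|exact: IntZ|by apply: IntD; exact: IntZ].
rewrite ED; [|exact: IntZ|exact: IntZ].
rewrite !EZ// u4 w4 a4 b4 (_ : w = 2 * a + 2 * b - u); last by lra.
by field.
Qed.

(** The variance of a sum of squares of variables with common variance [v] whose
    fourth moments satisfy Isserlis' formula. *)
Lemma variance_sum_sqr (X : nat -> T -> R) (n : nat) (v : R) :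
  (forall i j, Int (fun x => X i x * X j x)) ->
  (forall i j, Int (fun x => X i x ^+ 2 * X j x ^+ 2)) ->
  (forall i j, E (fun x => X i x ^+ 2 * X j x ^+ 2) =
     E (fun x => X i x * X i x) * E (fun x => X j x * X j x)
     + 2 * E (fun x => X i x * X j x) ^+ 2) ->
  (forall i, E (fun x => X i x * X i x) = v) ->
  Int (fun x => (\sum_(i < n) X i x ^+ 2 - n%:R * v) ^+ 2) /\
  E (fun x => (\sum_(i < n) X i x ^+ 2 - n%:R * v) ^+ 2) =
    2 * \sum_(i < n) \sum_(j < n) E (fun x => X i x * X j x) ^+ 2.
Proof.
move=> i2 i4 e4 ev.
have [w wE] : exists w, w = v ^+ 2 by exists (v ^+ 2).
pose F i j x := X i x ^+ 2 * X j x ^+ 2 + (- v * (X i x * X i x)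
   + (- v * (X j x * X j x) + w)).
have iF i j : Int (F i j).
  apply: IntD => //; apply: IntD; first exact: IntZ.
  by apply: IntD; [exact: IntZ|exact: Int_cst].
have iFs i : Int (fun x => \sum_(j < n) F i j x) by exact: Int_sum.
have eF i j : E (F i j) = 2 * E (fun x => X i x * X j x) ^+ 2.
  rewrite /F ED//; last first.
    apply: IntD; first exact: IntZ.
    by apply: IntD; [exact: IntZ|exact: Int_cst].
  rewrite ED//; [|exact: IntZ|by apply: IntD; [exact: IntZ|exact: Int_cst]].
  rewrite ED//; [|exact: IntZ|exact: Int_cst].
  by rewrite !EZ// e4 !ev E_cst wE; ring.
have -> : (fun x => (\sum_(i < n) X i x ^+ 2 - n%:R * v) ^+ 2) =
   (fun x => \sum_(i < n) \sum_(j < n) F i j x).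
  apply/funext => x.
  have -> : \sum_(i < n) X i x ^+ 2 - n%:R * v = \sum_(i < n) (X i x ^+ 2 - v).
    by rewrite sumrB sumr_const card_ord mulr_natl.
  rewrite expr2 big_distrlr /=; apply: eq_bigr => i _; apply: eq_bigr => j _.
  by rewrite /F wE; ring.
split; first exact: (Int_sum _ (F := fun i x => \sum_(j < n) F i j x)).
rewrite (E_sum _ (F := fun i x => \sum_(j < n) F i j x))// mulr_sumr.
apply: eq_bigr => i _; rewrite (E_sum _ (F := F i))// mulr_sumr.
by apply: eq_bigr => j _; rewrite eF.
Qed.

(** Almost sure convergence from geometrically decaying second moments. *)
Lemma ae_cvg_geometric (Z : nat -> T -> R) (C q : R) :
  0 <= q < 1 -> (forall k, measurable_fun setT (Z k)) ->
  (forall k, (\int[P]_x (Z k x ^+ 2)%:E <= (C * q ^+ k)%:E)%E) ->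
  {ae P, forall x, Z k x @[k --> \oo] --> (0 : R)}.
Proof.
move=> /andP[q0 q1] mZ hZ.
have mZ2 k : measurable_fun setT (fun x => (Z k x ^+ 2)%:E).
  by apply/measurable_EFinP; exact: measurable_funX.
pose S x := (\sum_(0 <= k <oo) (Z k x ^+ 2)%:E)%E.
have S0 x : (0 <= S x)%E by apply: nneseries_ge0 => k _ _; rewrite lee_fin sqr_ge0.
have mS : measurable_fun setT S.
  by apply: ge0_emeasurable_sum => // k x _ _; rewrite lee_fin sqr_ge0.
have iS : (\int[P]_x S x < +oo)%E.
  rewrite integral_nneseries//; last by move=> k x _; rewrite lee_fin sqr_ge0.
  apply: (@le_lt_trans _ _ (\sum_(0 <= k <oo) (C * q ^+ k)%:E)%E).
    apply: lee_nneseries => // k _ _.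
    by apply: integral_ge0 => x _; rewrite lee_fin sqr_ge0.
  have := @cvg_geometric_series R C q; rewrite ger0_norm// => /(_ q1) h.
  have -> : (\sum_(0 <= k <oo) (C * q ^+ k)%:E)%E = (C * (1 - q)^-1)%:E.
    apply/cvg_lim => //.
    under eq_fun do rewrite sumEFin.
    apply: cvg_EFin; first exact: nearW.
    exact: h.
  by rewrite ltry.
have : {ae P, forall x, S x \is a fin_num}.
  have : P.-integrable setT S.
    by apply/integrableP; split => //; under eq_integral do rewrite gee0_abs//.
  move/(integrable_ae measurableT); apply: filterS => x; exact.
apply: filterS => x Sx.
have : (\sum_(k <oo) (Z k x ^+ 2)%:E < +oo)%E by rewrite ltey_eq Sx.
move=> Sfin.
have cv : cvgn (series (fun k => Z k x ^+ 2)).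
  apply: nondecreasing_is_cvgn.
    apply/nondecreasing_seqP => k.
    by rewrite /series /= big_nat_recr//= lerDl sqr_ge0.
  exists (fine (S x)) => _ [k _ <-].
  rewrite -lee_fin fineK// /series /= -sumEFin.
  by apply: nneseries_lim_ge => i _ _; rewrite lee_fin sqr_ge0.
have h := cvg_series_cvg_0 cv.
apply/cvgr0Pnorm_lt => e e0.
have e2 : 0 < e ^+ 2 by rewrite exprn_gt0.
have /cvgr0Pnorm_lt /(_ _ e2) := h.
apply: filterS => k; rewrite normrX.
by rewrite ltr_pXn2r// ?nnegrE// ltW.
Qed.
End gaussian_pairs.

(** * Quadratic variation of fractional Brownian motion *)

Section fbm_quadratic_variation.
Context {R : realType} {d : measure_display} {T : measurableType d}.
Variables (P : probability T R) (H : R) (W : R -> {RV P >-> R}).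
Hypotheses (H1 : 2^-1 < H) (H2 : H < 1).
Hypothesis fW : fBm H W.
Local Notation Int f := (P.-integrable setT (EFin \o f)).
Local Notation E f := (Rintegral P setT f).

Lemma Int_fin (f : T -> R) v : Int f -> E f = v -> (\int[P]_x (f x)%:E = v%:E)%E.
Proof. by move=> /(integrable_fin_num measurableT) fi <-; rewrite /Rintegral fineK. Qed.

Let mW s : measurable_fun setT (W s : T -> R).
Proof. exact: measurable_funPT. Qed.

Lemma fBm_mean0 s : 0 <= s -> (\int[P]_x (W s x)%:E = 0)%E.
Proof. by case: fW => _ h _ _ s0; rewrite -expectation_def; exact: h. Qed.

Lemma fBm_Int s : 0 <= s -> Int (W s).
Proof.
move=> s0; case: fW => gW _ _ _.
have gs : gaussian_law P (W s).
  have := gW 1%N (fun=> 1) (fun=> s) (fun=> s0).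
  by under eq_fun do rewrite big_ord1 mul1r.
have [v [v0 h2 _]] := gaussian_law_moments (mW s) gs (fBm_mean0 s0).
have [i2 _] := ge0_Int (measurable_funX 2 (mW s)) (fun x => sqr_ge0 _) h2.
apply: (@le_integrable _ _ _ P setT _ _ (EFin \o (fun x => 1 + W s x ^+ 2))) => //.
- exact/measurable_EFinP.
- move=> x _ /=; rewrite lee_fin.
  rewrite [leRHS]ger0_norm; last by rewrite addr_ge0// sqr_ge0.
  rewrite -(real_normK (num_real (W s x))).
  by have := sqr_ge0 (`|W s x| - 2^-1); rewrite sqrrB; lra.
- by apply: IntD => //; exact: Int_cst.
Qed.

(** The covariance of fractional Brownian motion at nonnegative times. *)
Definition fBm_cov (r s : R) : R :=
  2^-1 * (r `^ (2 * H) + s `^ (2 * H) - `|r - s| `^ (2 * H)).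

Lemma fBm_cov_Int r s : 0 <= r -> 0 <= s ->
  Int (fun x => W r x * W s x) /\ E (fun x => W r x * W s x) = fBm_cov r s.
Proof.
move=> r0 s0; case: (fW) => gW mean cov _.
have [] := @gaussian_pair_moments _ _ _ P (W r) (W s) (mW r) (mW s).
- move=> p q.
  have := gW 2%N (fun i => if i == ord0 then p else q)
    (fun i => if i == ord0 then r else s).
  rewrite (_ : (fun x => _) = (fun x => p * W r x + q * W s x)); first apply.
    by move=> i; case: ifP.
  by apply/funext => x; rewrite !big_ord_recl big_ord0 addr0.
- move=> p q; rewrite (@Int_fin _ 0)//.
    by apply: IntD; apply: IntZ; exact: fBm_Int.
  rewrite ED; [|by apply: IntZ; exact: fBm_Int|by apply: IntZ; exact: fBm_Int].
  rewrite !EZ; [|exact: fBm_Int|exact: fBm_Int].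
  by rewrite /Rintegral !fBm_mean0//= !mulr0 addr0.
move=> i _ _; split => //.
have := cov r s r0 s0; rewrite unlock !mean//= => h.
suff : (\int[P]_x (W r x * W s x)%:E = (fBm_cov r s)%:E)%E by rewrite /Rintegral => ->.
rewrite -h unlock; apply: eq_integral => x _.
rewrite -[((_ \- _) * (_ \- _)) x]/((W r x - 0) * (W s x - 0)).
by rewrite !subr0.
Qed.

(** Isserlis' formula for two increments of the fractional Brownian motion, whose
    covariance is a second difference of [fBm_cov]. *)
Lemma fBm_incr_pair a b c e : 0 <= a -> 0 <= b -> 0 <= c -> 0 <= e ->
  let X x := W b x - W a x in let Y x := W e x - W c x in
  [/\ Int (fun x => X x * Y x), Int (fun x => X x ^+ 2 * Y x ^+ 2),
   E (fun x => X x ^+ 2 * Y x ^+ 2) =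
     E (fun x => X x * X x) * E (fun x => Y x * Y x)
     + 2 * E (fun x => X x * Y x) ^+ 2 &
   E (fun x => X x * Y x) =
     fBm_cov b e - fBm_cov b c - fBm_cov a e + fBm_cov a c].
Proof.
move=> a0 b0 c0 e0 X Y; case: (fW) => gW _ _ _.
have IW := fBm_Int.
have [] := @gaussian_pair_moments _ _ _ P X Y.
- exact: measurable_funB.
- exact: measurable_funB.
- move=> p q.
  have := gW 4%N (fun i => nth 0 [:: p; - p; q; - q] i)
    (fun i => nth 0 [:: b; a; e; c] i).
  rewrite (_ : (fun x => _) = (fun x => p * X x + q * Y x)); first apply.
    by case=> [[|[|[|[|]]]]].
  by apply/funext => x; rewrite !big_ord_recl big_ord0 /= /X /Y; ring.
- move=> p q; rewrite (_ : (fun x => _) = EFin \o (fun x => p * W b x + (- p * W a x + (q * W e x + - q * W c x)))); last first.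
    by apply/funext => x /=; rewrite /X /Y; congr EFin; ring.
  have Z s r : 0 <= s -> Int (fun x => r * W s x) by move=> ?; apply: IntZ; exact: IW.
  apply: Int_fin.
    by apply: IntD; [|apply: IntD; [|apply: IntD]]; exact: Z.
  rewrite ED; [|exact: Z|by apply: IntD; [|apply: IntD]; exact: Z].
  rewrite ED; [|exact: Z|by apply: IntD; exact: Z].
  rewrite ED; [|exact: Z|exact: Z].
  rewrite !EZ; [|exact: IW..].
  by rewrite /Rintegral !fBm_mean0//= !mulr0 !addr0.
move=> i2 i4 e4; split => //.
have C s r : 0 <= s -> 0 <= r -> Int (fun x => W s x * W r x).
  by move=> s0 r0; have [] := fBm_cov_Int s0 r0.
have V s r : 0 <= s -> 0 <= r -> E (fun x => W s x * W r x) = fBm_cov s r.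
  by move=> s0 r0; have [] := fBm_cov_Int s0 r0.
have CZ s r k : 0 <= s -> 0 <= r -> Int (fun x => k * (W s x * W r x)).
  by move=> s0 r0; apply: IntZ; exact: C.
have -> : (fun x => X x * Y x) = (fun x => W b x * W e x + (-1 * (W b x * W c x) +
   (-1 * (W a x * W e x) + W a x * W c x))).
  by apply/funext => x; rewrite /X /Y; ring.
rewrite ED; [|exact: C|by apply: IntD; [exact: CZ|apply: IntD; [exact: CZ|exact: C]]].
rewrite ED; [|exact: CZ|by apply: IntD; [exact: CZ|exact: C]].
rewrite ED; [|exact: CZ|exact: C].
rewrite !EZ; [|exact: C..].
by rewrite !V//; ring.
Qed.

Let powR1_1 (p : R) : 1 `^ p = 1 :> R.
Proof. by rewrite powR1. Qed.

Lemma powR_half_exp (p : R) N : (1 / 2 ^+ N) `^ p = ((1 / 2) `^ p) ^+ N.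
Proof.
elim: N => [|N IH]; first by rewrite expr0 divr1 powR1.
have -> : 1 / 2 ^+ N.+1 = (1 / 2) * (1 / 2 ^+ N) :> R by rewrite exprS; field.
by rewrite powRM ?divr_ge0// IH exprS.
Qed.

Lemma fBm_cov_diag (r : R) : 0 <= r -> fBm_cov r r = r `^ (2 * H).
Proof.
move=> r0; rewrite /fBm_cov subrr normr0 powR0; first by field.
have h : 0 < 2 * H by move: H1; lra.
by rewrite gt_eqF.
Qed.

(** Midpoint convexity of [`|x| `^ p]: second differences of the variance function
    are nonnegative. *)
Lemma powR_midpoint (p u h : R) : 1 <= p ->
  2 * `|u| `^ p <= `|u + h| `^ p + `|u - h| `^ p.
Proof.
move=> p1; have h2 : 0 < 2^-1 :> R by [].
suff : `|u| `^ p <= 2^-1 * `|u + h| `^ p + 2^-1 * `|u - h| `^ p by lra.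
apply: (@le_trans _ _ ((2^-1 * `|u + h| + 2^-1 * `|u - h|) `^ p)).
  rewrite ge0_ler_powR ?nnegrE//; first lra.
  rewrite [X in `|X| <= _](_ : u = 2^-1 * (u + h) + 2^-1 * (u - h)); last by field.
  by apply: (le_trans (ler_normD _ _)); rewrite !normrM [`|2^-1|]ger0_norm.
rewrite {2 4}(_ : 2^-1 = 1 - 2^-1); last by field.
by apply: (convex_powR p1 (Itv01 _ _)) => //=;
  rewrite ?inE/= ?in_itv/= ?normr_ge0// ?invr_ge0// invf_le1 ?ler1n.
Qed.

(** Increments of fractional Brownian motion over a uniform grid are
    nonnegatively correlated when [H] exceeds one half. *)
Lemma fBm_cov_incr_ge0 (h : R) (t : nat -> R) (i j : nat) :
  (forall n, t n.+1 = t n + h) ->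
  0 <= fBm_cov (t i.+1) (t j.+1) - fBm_cov (t i.+1) (t j)
     - fBm_cov (t i) (t j.+1) + fBm_cov (t i) (t j).
Proof.
move=> tS; rewrite /fBm_cov.
have -> : t i.+1 - t j.+1 = t i - t j by rewrite !tS; ring.
have -> : t i.+1 - t j = (t i - t j) + h by rewrite !tS; ring.
have -> : t i - t j.+1 = (t i - t j) - h by rewrite !tS; ring.
have := @powR_midpoint (2 * H) (t i - t j) h.
have -> : 1 <= 2 * H by move: H1; lra.
by move=> /(_ isT); lra.
Qed.

(** Quadratic variation of [w] over the [n] dyadic intervals of level [N]
    starting at [a / 2 ^ N], with the normalization of index [H]. *)
Definition dyadic_var (w : R -> R) (N a n : nat) : R :=
  (1 / 2 ^+ N) `^ (1 - 2 * H) *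
  \sum_(j < n) (w (dyadic N (a + j).+1) - w (dyadic N (a + j))) ^+ 2.

(** With [v] the variance of one increment, the squared covariances sum to at most
    [v] times the sum of the covariances, and this sum telescopes to the variance
    of the increment over the whole interval, which is at most one. *)
Lemma dyadic_var_mean_sqr (N a n : nat) : (n <= 2 ^ N)%N ->
  (\int[P]_x ((dyadic_var (fun s => W s x) N a n - n%:R / 2 ^+ N) ^+ 2)%:E
   <= (2 * ((1 / 2) `^ (2 - 2 * H)) ^+ N)%:E)%E.
Proof.
move=> nN.
pose h : R := 1 / 2 ^+ N; have h0 : 0 < h by rewrite divr_gt0.
have th k : dyadic N k = k%:R * h by rewrite /dyadic /h mul1r.
pose t k : R := k%:R * h.
have t0 k : 0 <= t k by rewrite mulr_ge0// ltW.
pose X j x := W (t (a + j).+1) x - W (t (a + j)%N) x.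
pose v := h `^ (2 * H).
pose rho i j := E (fun x => X i x * X j x).
have rhoE i j : rho i j = fBm_cov (t (a + i).+1) (t (a + j).+1)
   - fBm_cov (t (a + i).+1) (t (a + j)%N)
   - fBm_cov (t (a + i)%N) (t (a + j).+1) + fBm_cov (t (a + i)%N) (t (a + j)%N).
  by have [] := fBm_incr_pair (t0 (a + i)%N) (t0 (a + i).+1) (t0 (a + j)%N) (t0 (a + j).+1).
have rho_ge0 i j : 0 <= rho i j by rewrite rhoE; apply: (@fBm_cov_incr_ge0 h t) => k; rewrite /t -natr1; ring.
have tS k : t k.+1 - t k = h by rewrite /t -natr1; ring.
have rhoii i : rho i i = v.
  rewrite rhoE !fBm_cov_diag// /fBm_cov tS distrC tS (gtr0_norm h0) -/v.
  by field.
have i2 i j : Int (fun x => X i x * X j x).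
  by have [] := fBm_incr_pair (t0 (a + i)%N) (t0 (a + i).+1) (t0 (a + j)%N) (t0 (a + j).+1).
have i4 i j : Int (fun x => X i x ^+ 2 * X j x ^+ 2).
  by have [] := fBm_incr_pair (t0 (a + i)%N) (t0 (a + i).+1) (t0 (a + j)%N) (t0 (a + j).+1).
have e4 i j : E (fun x => X i x ^+ 2 * X j x ^+ 2) = rho i i * rho j j + 2 * rho i j ^+ 2.
  by have [] := fBm_incr_pair (t0 (a + i)%N) (t0 (a + i).+1) (t0 (a + j)%N) (t0 (a + j).+1).
have [iV EV] := variance_sum_sqr n i2 i4 e4 rhoii.
have rho_le i j : rho i j <= v.
  have : 0 <= E (fun x => (X i x - X j x) ^+ 2).
    by apply: Rintegral_ge0 => x _; exact: sqr_ge0.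
  have -> : (fun x => (X i x - X j x) ^+ 2) = (fun x => X i x * X i x + (- 2 * (X i x * X j x) + X j x * X j x)).
    by apply/funext => x; ring.
  rewrite ED//; last by apply: IntD => //; exact: IntZ.
  rewrite ED//; last exact: IntZ.
  rewrite EZ// -/(rho i i) -/(rho i j) -/(rho j j) !rhoii; lra.
have sum_rho : \sum_(i < n) \sum_(j < n) rho i j = (n%:R * h) `^ (2 * H).
  have rowE i : \sum_(j < n) rho i j = fBm_cov (t (a + i).+1) (t (a + n)%N)
      - fBm_cov (t (a + i).+1) (t a)
      - (fBm_cov (t (a + i)%N) (t (a + n)%N) - fBm_cov (t (a + i)%N) (t a)).
    rewrite -(big_mkord predT (rho i)).
    rewrite (@telescope_sumr_eq _ 0 n (fun j => fBm_cov (t (a + i).+1) (t (a + j)%N)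
       - fBm_cov (t (a + i)%N) (t (a + j)%N)))// ?addn0; first by ring.
    by move=> j _; rewrite rhoE addnS; ring.
  under eq_bigr do rewrite rowE.
  pose D k := fBm_cov (t k) (t (a + n)%N) - fBm_cov (t k) (t a).
  rewrite -(big_mkord predT (fun i => D (a + i).+1 - D (a + i)%N)).
  rewrite (@telescope_sumr_eq _ 0 n (fun j => D (a + j)%N))// ?addn0; last first.
    by move=> j _; rewrite addnS.
  rewrite /D !fBm_cov_diag// /fBm_cov.
  have -> : t (a + n)%N - t a = n%:R * h by rewrite /t natrD; ring.
  have -> : t a - t (a + n)%N = - (n%:R * h) by rewrite /t natrD; ring.
  by rewrite normrN ger0_norm ?mulr_ge0 ?(ltW h0)//; field.
pose kap := h `^ (1 - 2 * H).
have kap0 : 0 <= kap by exact: powR_ge0.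
have v0 : 0 <= v by exact: powR_ge0.
have kv : kap * v = h.
  rewrite /kap /v -powRD ?(gt_eqF h0) ?implybT// (_ : 1 - 2 * H + 2 * H = 1) ?powRr1 ?ltW//; ring.
have -> : (fun x => ((dyadic_var (fun s => W s x) N a n - n%:R / 2 ^+ N) ^+ 2)%:E) =
   (fun x => (kap ^+ 2 * (\sum_(i < n) X i x ^+ 2 - n%:R * v) ^+ 2)%:E).
  apply/funext => x; congr EFin; rewrite -exprMn; congr (_ ^+ 2).
  rewrite /dyadic_var -/h -/kap mulrBr; congr (_ - _); last first.
    by rewrite mulrCA kv /h mul1r.
  by congr (_ * _); apply: eq_bigr => i _; rewrite !th.
rewrite (Int_fin (IntZ _ iV) (EZ _ iV)) EV lee_fin.
have sq_le : \sum_(i < n) \sum_(j < n) E (fun x => X i x * X j x) ^+ 2 <= v.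
  apply: (@le_trans _ _ (v * \sum_(i < n) \sum_(j < n) rho i j)).
    rewrite mulr_sumr; apply: ler_sum => i _; rewrite mulr_sumr; apply: ler_sum => j _.
    by rewrite expr2; apply: ler_wpM2r; [exact: rho_ge0|exact: rho_le].
  rewrite sum_rho ler_piMr// -[leRHS](powR1_1 (2 * H)) ge0_ler_powR ?nnegrE ?mulr_ge0 ?(ltW h0)//; first by move: H1; lra.
  by rewrite /h mulrA mulr1 ler_pdivrMr// mul1r -natrX ler_nat.
apply: (@le_trans _ _ (kap ^+ 2 * (2 * v))).
  by rewrite ler_wpM2l ?sqr_ge0// ler_wpM2l.
rewrite -powR_half_exp -/h le_eqVlt; apply/orP; left; apply/eqP.
have -> : kap ^+ 2 * (2 * v) = 2 * (kap * (kap * v)) by ring.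
rewrite kv; congr (_ * _).
rewrite -[X in kap * X](powRr1 (ltW h0)) /kap -powRD ?(gt_eqF h0) ?implybT//.
by congr powR; ring.
Qed.

(** Almost surely, the quadratic variation over each dyadic interval converges
    to the length of the interval. *)
Lemma fBm_dyadic_var : {ae P, forall x, forall m i : nat,
  dyadic_var (fun s => W s x) (m + k) (i * 2 ^ k) (2 ^ k) @[k --> \oo]
    --> (1 / 2 ^+ m : R)}.
Proof.
apply: ae_foralln => m; apply: ae_foralln => i.
pose Z k x := dyadic_var (fun s => W s x) (m + k) (i * 2 ^ k) (2 ^ k) - 1 / 2 ^+ m.
have : {ae P, forall x, Z k x @[k --> \oo] --> (0 : R)}.
  set q := (1 / 2) `^ (2 - 2 * H).
  have q01 : 0 <= q < 1.
    rewrite powR_ge0/= /q -[ltRHS](powR1_1 (2 - 2 * H)) gt0_ltr_powR ?nnegrE//; move: H2; lra.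
  apply: (@ae_cvg_geometric _ _ _ _ Z 2 q) => //.
    move=> k; apply: measurable_funB => //; apply: measurable_funM => //.
    apply: measurable_sum => j; apply: measurable_funX.
    exact: measurable_funB.
  move=> k; have := @dyadic_var_mean_sqr (m + k) (i * 2 ^ k) (2 ^ k) _.
  rewrite leq_exp2l// leq_addl => /(_ isT).
  have -> : (2 ^ k)%:R / 2 ^+ (m + k) = 1 / 2 ^+ m :> R.
    by rewrite natrX exprD; field; rewrite !expf_neq0.
  move=> h; apply: (le_trans h); rewrite lee_fin ler_wpM2l// -/q exprD.
  case/andP: q01 => q0 q1; rewrite ler_piMl ?exprn_ge0// exprn_ile1// ltW//.
apply: filterS => x h.
have e k : dyadic_var (fun s => W s x) (m + k) (i * 2 ^ k) (2 ^ k) = Z k x + 1 / 2 ^+ m.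
  by rewrite /Z subrK.
under eq_fun do rewrite e.
have := @cvgD _ _ _ \oo _ _ _ _ _ h (@cvg_cst _ (1 / 2 ^+ m : R) _ \oo _).
by rewrite add0r; exact.
Qed.

End fbm_quadratic_variation.

(** * Finite sums and dyadic grids *)

Section finite_sums.
Context {R : realType}.

Lemma sum_cauchy_schwarz (n : nat) (x y : nat -> R) :
  (\sum_(i < n) x i * y i) ^+ 2 <= (\sum_(i < n) x i ^+ 2) * \sum_(i < n) y i ^+ 2.
Proof.
have : 0 <= \sum_(i < n) \sum_(j < n) (x i * y j - x j * y i) ^+ 2.
  by apply: sumr_ge0 => i _; apply: sumr_ge0 => j _; exact: sqr_ge0.
have -> : \sum_(i < n) \sum_(j < n) (x i * y j - x j * y i) ^+ 2 =
   2 * ((\sum_(i < n) x i ^+ 2) * \sum_(i < n) y i ^+ 2)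
   - 2 * (\sum_(i < n) x i * y i) ^+ 2.
  set A := \sum_(i < n) x i ^+ 2; set B := \sum_(i < n) y i ^+ 2.
  have -> : 2 * (A * B) = A * B + B * A by ring.
  rewrite (expr2 (\sum_(i < n) x i * y i)) /A /B !big_distrlr /=.
  rewrite -big_split /= mulr_sumr -sumrB.
  apply: eq_bigr => i _; rewrite -big_split /= mulr_sumr -sumrB.
  by apply: eq_bigr => j _ /=; ring.
lra.
Qed.

Lemma sum_sqr_le (n : nat) (x : nat -> R) :
  (\sum_(i < n) x i) ^+ 2 <= n%:R * \sum_(i < n) x i ^+ 2.
Proof.
have := sum_cauchy_schwarz n (fun=> 1) x.
under eq_bigr do rewrite mul1r; under [X in _ <= X * _]eq_bigr do rewrite expr1n.
by rewrite sumr_const card_ord.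
Qed.

(** Minkowski's inequality for finite sums, with bounds [X] and [Y] on the norms. *)
Lemma sum_minkowski (n : nat) (x y : nat -> R) (X Y : R) : 0 <= X -> 0 <= Y ->
  \sum_(i < n) x i ^+ 2 <= X ^+ 2 -> \sum_(i < n) y i ^+ 2 <= Y ^+ 2 ->
  \sum_(i < n) (x i + y i) ^+ 2 <= (X + Y) ^+ 2.
Proof.
move=> X0 Y0 hx hy.
have hxy : \sum_(i < n) x i * y i <= X * Y.
  have h : (\sum_(i < n) x i * y i) ^+ 2 <= (X * Y) ^+ 2.
    apply: (le_trans (sum_cauchy_schwarz n x y)); rewrite exprMn.
    by apply: ler_pM => //; apply: sumr_ge0 => i _; exact: sqr_ge0.
  have XY : 0 <= X * Y by exact: mulr_ge0.
  rewrite leNgt; apply/negP => h2; move: h; apply/negP; rewrite -ltNge.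
  by rewrite ltr_pXn2r ?nnegrE// (le_trans XY)// ltW.
have -> : \sum_(i < n) (x i + y i) ^+ 2 =
    \sum_(i < n) x i ^+ 2 + 2 * \sum_(i < n) x i * y i + \sum_(i < n) y i ^+ 2.
  rewrite mulr_sumr -!big_split /=; apply: eq_bigr => i _; ring.
have -> : (X + Y) ^+ 2 = X ^+ 2 + 2 * (X * Y) + Y ^+ 2 by ring.
by rewrite lerD// lerD// ler_wpM2l.
Qed.

Lemma sum_blocks (F : nat -> R) (N b : nat) :
  \sum_(j < N * b) F j = \sum_(i < N) \sum_(j < b) F (i * b + j)%N.
Proof.
elim: N => [|N IH]; first by rewrite mul0n !big_ord0.
by rewrite big_ord_recr /= -IH mulSn addnC big_split_ord.
Qed.

Lemma sum_ord_split (F : nat -> R) (m n : nat) : (m <= n)%N ->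
  \sum_(j < n) F j = \sum_(j < m) F j + \sum_(j < n - m) F (m + j)%N.
Proof. by move=> /subnKC; move: (n - m)%N => p <-; rewrite big_split_ord. Qed.

Lemma sum_ord_widen_le (F : nat -> R) (m n : nat) : (m <= n)%N ->
  (forall i, 0 <= F i) -> \sum_(j < m) F j <= \sum_(j < n) F j.
Proof.
by move=> mn F0; rewrite -(subnKC mn) big_split_ord /= lerDl; exact: sumr_ge0.
Qed.

Lemma cvg0_sqr (u : nat -> R) : u k ^+ 2 @[k --> \oo] --> (0 : R) ->
  u k @[k --> \oo] --> (0 : R).
Proof.
move=> h; apply/cvgr0Pnorm_lt => e e0.
have e2 : 0 < e ^+ 2 by rewrite exprn_gt0.
have /cvgr0Pnorm_lt /(_ _ e2) := h.
apply: filterS => k; rewrite normrX.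
by rewrite ltr_pXn2r// ?nnegrE// ltW.
Qed.

Lemma cvg_sumr (F : nat -> nat -> R) (l : nat -> R) (n : nat) :
  (forall i, (i < n)%N -> F i k @[k --> \oo] --> l i) ->
  \sum_(i < n) F i k @[k --> \oo] --> \sum_(i < n) l i.
Proof.
elim: n => [|n IH] h.
  by under eq_fun do rewrite big_ord0; rewrite big_ord0; exact: cvg_cst.
under eq_fun do rewrite big_ord_recr; rewrite big_ord_recr /=.
by apply: cvgD; [apply: IH => i ni; apply: h; exact: ltnW|exact: h].
Qed.

Lemma cvg0_geometric (C q : R) (u : nat -> R) : 0 <= q < 1 ->
  (forall k, 0 <= u k <= C * q ^+ k) -> u k @[k --> \oo] --> (0 : R).
Proof.
move=> /andP[q0 q1] h.
apply: (@squeeze_cvgr _ _ _ _ (cst 0) (fun k => C * q ^+ k)).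
- exact: nearW.
- exact: cvg_cst.
- by apply: cvg_geometric; rewrite ger0_norm.
Qed.

End finite_sums.

Section dyadic_grid.
Context {R : realType}.
Implicit Types t : R.

Lemma dyadic0 n : dyadic n 0 = 0 :> R.
Proof. by rewrite /dyadic mul0r. Qed.

Lemma dyadic_ge0 n a : 0 <= dyadic n a :> R.
Proof. by rewrite /dyadic divr_ge0. Qed.

Lemma dyadicS n a : dyadic n a.+1 - dyadic n a = 1 / 2 ^+ n :> R.
Proof. by rewrite /dyadic -mulrBl -natr1 addrC addKr. Qed.

Lemma dyadic_refine n a m : dyadic (n + m) (a * 2 ^ m) = dyadic n a :> R.
Proof.
by rewrite /dyadic natrM natrX exprD; field; rewrite !expf_neq0.
Qed.

Lemma ltr_dyadic n : {mono (@dyadic R n) : a b / (a < b)%N >-> a < b}.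
Proof.
by move=> a b; rewrite /dyadic ltr_pM2r ?ltr_nat// invr_gt0 exprn_gt0.
Qed.

Lemma ler_dyadic n : {mono (@dyadic R n) : a b / (a <= b)%N >-> a <= b}.
Proof.
by move=> a b; rewrite /dyadic ler_pM2r ?ler_nat// invr_gt0 exprn_gt0.
Qed.

(** The number of dyadic intervals of level [k] contained in [[0, t]]. *)
Definition dyadic_count t (k : nat) : nat := Num.truncn (t * 2 ^+ k).

Lemma dyadic_countP t k j : 0 <= t ->
  (j <= dyadic_count t k)%N = (dyadic k j <= t).
Proof.
move=> t0; have t2 : 0 <= t * 2 ^+ k by rewrite mulr_ge0 ?exprn_ge0.
rewrite /dyadic ler_pdivrMr ?exprn_gt0// /dyadic_count.
by rewrite truncn_ge_nat.
Qed.

Lemma dyadic_indexE t k : 0 < t -> dyadic_index t k = [set j | (j < dyadic_count t k)%N].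
Proof.
move=> t0; apply/seteqP; split => j /=.
  rewrite dyadic_countP ?(ltW t0)// => /(_ (dyadic k j.+1)) /=.
  by rewrite !in_itv /= lexx ler_dyadic leqnSn => /(_ isT)/andP[].
rewrite dyadic_countP ?(ltW t0)// => jt r /=; rewrite !in_itv /= => /andP[jr rj].
by rewrite (le_trans _ jr) ?dyadic_ge0//= (le_trans rj).
Qed.

Lemma dyadic_index_sum (V : nmodType) t k (F : nat -> V) : 0 < t ->
  \sum_(j \in dyadic_index t k) F j = \sum_(j < dyadic_count t k) F j.
Proof.
by move=> t0; rewrite dyadic_indexE// fsbig_ord.
Qed.

End dyadic_grid.

Section dyadic_young.
Context {R : realType}.

(** A Young integral over a dyadic interval starting at [0] is the limit of the
    left-point sums over the dyadic grids. *)
Lemma young_dyadic_cvg (g w : R -> R) (k j : nat) (I : R) :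
  is_young_integral g w 0 (dyadic k j) I ->
  \sum_(i < j * 2 ^ M) g (dyadic (k + M) i) *
     (w (dyadic (k + M) i.+1) - w (dyadic (k + M) i)) @[M --> \oo] --> I.
Proof.
move=> yI; apply/cvgrPdist_lt => e e0.
have [dl dl0 hd] := yI e e0.
have half : `|1 / 2 : R| < 1 by rewrite ger0_norm ?divr_ge0//; lra.
have := @cvg_geometric R 1 _ half => /cvgr0Pnorm_lt /(_ _ dl0).
apply: filterS => M; rewrite /geometric /= mul1r ger0_norm ?exprn_ge0 ?divr_ge0// => hM.
set n := (k + M)%N; set N := (j * 2 ^ M)%N.
have bN : dyadic k j = dyadic n N :> R by rewrite -(dyadic_refine k j M).
pose s := [seq @dyadic R n i | i <- iota 1 N].
have s0E : 0 :: s = [seq @dyadic R n i | i <- iota 0 N.+1] by rewrite /= dyadic0.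
have sz : size s = N by rewrite size_map size_iota.
have pE i : (i <= N)%N -> nth (dyadic k j) (0 :: s) i = dyadic n i.
  move=> iN; rewrite s0E (nth_map 0%N) ?size_iota ?ltnS// nth_iota ?ltnS//.
have part : itv_partition 0 (dyadic k j) s.
  split.
    rewrite -(dyadic0 n) path_map.
    have := iota_ltn_sorted 0 N.+1; rewrite /=.
    by apply: sub_path => a b /=; rewrite ltr_dyadic.
  by rewrite (last_nth (dyadic k j)) sz pE// bN.
have := hd s part; rewrite sz; cbv zeta => h.
rewrite distrC; apply: (le_lt_trans _ (h _)).
  rewrite le_eqVlt; apply/orP; left; apply/eqP; congr (`|_ - _|).
  by apply: eq_bigr => -[i iN] _; rewrite !pE// ltnW.
move=> i iN; rewrite !pE// 1?ltnW// dyadicS; apply: le_lt_trans hM.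
rewrite exprVn !mul1r lef_pV2 ?posrE ?exprn_gt0//.
by rewrite /n ler_eXn2l ?leq_addl// ltr1n.
Qed.

End dyadic_young.

(** * Integrals over time *)

Section time_integrals.
Context {R : realType}.
Local Notation mu := (@lebesgue_measure R).

Lemma holder_within_continuous (F : R -> R) (A : set R) (C gamma : R) :
  0 < gamma -> (forall r s, A r -> A s -> `|F r - F s| <= C * `|r - s| `^ gamma) ->
  {within A, continuous F}.
Proof.
move=> g0 hF; apply/subspace_continuousP => x Ax.
apply/cvgrPdist_lt => e e0.
have C1 : 0 < `|C| + 1 by rewrite ltr_wpDl.
pose dl := (e / (`|C| + 1)) `^ gamma^-1.
have dl0 : 0 < dl by rewrite powR_gt0// divr_gt0.
rewrite near_withinE; near=> y => Ay.
have xy : `|x - y| < dl by near: y; exact: cvgr_dist_lt.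
apply: (le_lt_trans (hF _ _ Ax Ay)).
have h : `|x - y| `^ gamma < e / (`|C| + 1).
  have -> : e / (`|C| + 1) = dl `^ gamma.
    by rewrite /dl -powRrM mulVf ?gt_eqF// powRr1// ltW// divr_gt0.
  by rewrite gt0_ltr_powR ?nnegrE// ltW.
apply: (@le_lt_trans _ _ (`|C| * `|x - y| `^ gamma)).
  by rewrite ler_wpM2r ?powR_ge0// ler_norm.
apply: (@le_lt_trans _ _ (`|C| * (e / (`|C| + 1)))); first by rewrite ler_wpM2l// ltW.
by rewrite mulrCA gtr_pMr// ltr_pdivrMr// mul1r ltrDl.
Unshelve. all: by end_near. Qed.

Lemma within_continuous_integrable (F : R -> R) (t a b : R) :
  {within `[0, t], continuous F} -> 0 <= a -> b <= t ->
  mu.-integrable `[a, b] (EFin \o F).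
Proof.
move=> cF a0 bt.
have i0t : mu.-integrable `[0, t] (EFin \o F).
  by apply: continuous_compact_integrable => //; exact: segment_compact.
apply: integrableS i0t => //.
by apply: subset_itv; rewrite bnd_simp.
Qed.

Lemma time_int_bound (F : R -> R) (a b M : R) : a <= b ->
  mu.-integrable `[a, b] (EFin \o F) ->
  (forall x, x \in `[a, b] -> `|F x| <= M) ->
  `|time_int a b F| <= M * (b - a).
Proof.
move=> ab iF FM; rewrite /time_int.
apply: (le_trans (le_normr_Rintegral _ iF)) => //.
have -> : M * (b - a) = \int[mu]_(x in `[a, b]) cst M x.
  rewrite Rintegral_cst//= lebesgue_measure_itv /= lte_fin.
  by case: ltgtP ab => // -> _; rewrite subrr mulr0.
apply: le_Rintegral => //.
- exact: (integrable_norm iF).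
- by apply: continuous_compact_integrable; [exact: segment_compact|move=> x; exact: cst_continuous].
Qed.

Lemma time_intB (F : R -> R) (a b c : R) : a <= b -> b <= c ->
  mu.-integrable `[a, c] (EFin \o F) ->
  time_int a c F - time_int a b F = time_int b c F.
Proof.
move=> ab bc iF; rewrite /time_int.
rewrite (@Rintegral_itvB R F (BLeft a) (BRight c) b iF); last 2 first.
- by rewrite leBSide.
- by rewrite leBSide.
rewrite Rintegral_itv_obnd_cbnd//; apply: integrableS iF => //.
by apply: subset_itv; rewrite leBSide /= ?lexx.
Qed.

End time_integrals.

(** * Quadratic variation of Young integrals *)

Section path_quadratic_variation.
Context {R : realType}.
Variables (H gamma t C : R) (g w : R -> R).
Hypotheses (H1 : 2^-1 < H) (H2 : H < 1) (g1 : 2^-1 < gamma) (t0 : 0 < t)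
  (C0 : 0 <= C).
(** The driving signal has quadratic variation of index [H] equal to time. *)
Hypothesis hQ : forall m i,
  dyadic_var H w (m + k) (i * 2 ^ k) (2 ^ k) @[k --> \oo] --> (1 / 2 ^+ m : R).
Hypothesis hg : forall r s, r \in `[0, t] -> s \in `[0, t] ->
  `|g r - g s| <= C * `|r - s| `^ gamma.

Local Notation tau := (@dyadic R).
Local Notation delta n a := (w (tau n a.+1) - w (tau n a)).
Local Notation N := (dyadic_count t).
Local Notation kap n := ((1 / 2 ^+ n) `^ (1 - 2 * H)).

Let kq : R := (1 / 2) `^ (1 - 2 * H).
Let gq : R := (1 / 2) `^ gamma.
(* [rho] is the ratio of the geometric series of refinement errors; it is below
   one as [gamma + H > 1]. *)
Let rho : R := (1 / 2) `^ (gamma + H - 1).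
(* Up to a constant, [A ^+ k] bounds the Young error at level [k] in the
   unnormalized l^2 norm. *)
Let A : R := (1 / 2) `^ (gamma + H - 2^-1).

Let half0 : 0 < 1 / 2 :> R. Proof. by rewrite divr_gt0. Qed.
Let kq0 : 0 < kq. Proof. exact: powR_gt0. Qed.
Let gq0 : 0 < gq. Proof. exact: powR_gt0. Qed.
Let rho0 : 0 < rho. Proof. exact: powR_gt0. Qed.
Let A0 : 0 < A. Proof. exact: powR_gt0. Qed.
Let half_lt1 (p : R) : 0 < p -> (1 / 2 : R) `^ p < 1.
Proof.
move=> p0; have one : 1 `^ p = 1 :> R by rewrite powR1.
by rewrite -[ltRHS]one gt0_ltr_powR ?nnegrE ?divr_ge0//; lra.
Qed.
Let rho1 : rho < 1. Proof. apply: half_lt1; move: H1 g1; lra. Qed.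
Let gq1 : gq < 1. Proof. apply: half_lt1; move: g1; lra. Qed.
Let A1 : A < 1. Proof. apply: half_lt1; move: H1 g1; lra. Qed.
Let halfD (p q : R) : (1 / 2 : R) `^ p * (1 / 2) `^ q = (1 / 2) `^ (p + q).
Proof. by rewrite -powRD// (gt_eqF half0) implybT. Qed.
Let gqE : gq ^+ 2 = A ^+ 2 * kq.
Proof. by rewrite /gq /A /kq !expr2 !halfD; congr powR; field. Qed.
Let AE : A ^+ 2 = rho ^+ 2 / 2.
Proof.
have -> : rho ^+ 2 / 2 = rho ^+ 2 * (1 / 2) `^ 1 by rewrite powRr1 ?ltW//; field.
by rewrite /A /rho !expr2 !halfD; congr powR; field.
Qed.

Let tau_in n a : (a <= N n)%N -> tau n a \in `[0, t].
Proof.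
move=> aN; rewrite in_itv /= dyadic_ge0 /= -dyadic_countP//; exact: ltW.
Qed.

Let N_refine k M a : (a < N k)%N -> forall i, (i <= 2 ^ M)%N ->
  (a * 2 ^ M + i <= N (k + M))%N.
Proof.
move=> aN i iM; rewrite dyadic_countP ?(ltW t0)//.
apply: (@le_trans _ _ (tau (k + M) (a.+1 * 2 ^ M))).
  by rewrite ler_dyadic mulSn addnC leq_add2r.
by rewrite dyadic_refine -dyadic_countP// ltW.
Qed.

Lemma holder_step n a : (a < N n)%N ->
  `|g (tau n a.+1) - g (tau n a)| <= C * gq ^+ n.
Proof.
move=> aN; apply: (le_trans (hg (tau_in aN) (tau_in (ltnW aN)))).
by rewrite dyadicS ger0_norm ?divr_ge0 ?exprn_ge0// powR_half_exp.
Qed.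

(* An integer bound on [t]: the estimates on [[0, t]] are deduced from those on
   [[0, Tc]], a union of dyadic intervals of level [0]. *)
Let Tc := (Num.truncn t).+1.

Let N_le n : (N n <= Tc * 2 ^ n)%N.
Proof.
rewrite -(ler_dyadic (R := R) n).
have -> : tau n (Tc * 2 ^ n) = Tc%:R by rewrite /dyadic natrM natrX mulfK ?expf_neq0.
rewrite (@le_trans _ _ t)//; first by rewrite -dyadic_countP// ltW.
by rewrite ltW// truncnS_gt.
Qed.

(** The normalized quadratic variation of [w] over [[0, Tc]] is convergent, hence
    bounded. *)
Lemma total_var_bounded : exists2 K, 0 <= K & forall n,
  kap n * \sum_(b < Tc * 2 ^ n) delta n b ^+ 2 <= K ^+ 2.
Proof.
pose u n := kap n * \sum_(b < Tc * 2 ^ n) delta n b ^+ 2.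
have u0 n : 0 <= u n.
  by rewrite mulr_ge0 ?powR_ge0// sumr_ge0// => b _; exact: sqr_ge0.
have ucvg : u n @[n --> \oo] --> \sum_(i < Tc) (1 / 2 ^+ 0 : R).
  have -> : u = fun n => \sum_(i < Tc) dyadic_var H w (0 + n) (i * 2 ^ n) (2 ^ n).
    apply/funext => n; rewrite /u (sum_blocks (fun b => delta n b ^+ 2)) mulr_sumr.
    by apply: eq_bigr => i _.
  by apply: (@cvg_sumr R (fun i n => dyadic_var H w (0 + n) (i * 2 ^ n) (2 ^ n))
     (fun=> 1 / 2 ^+ 0)) => i _; exact: hQ.
have [K [_ hK]] := cvg_seq_bounded (cvgP _ ucvg).
have K1 : 0 <= `|K| + 1 by rewrite addr_ge0.
have KK : K < `|K| + 1 by rewrite (le_lt_trans (ler_norm K))// ltrDl.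
exists (`|K| + 1) => // n.
have := hK _ KK n I; rewrite /= ger0_norm// => h.
by apply: (le_trans h); rewrite expr2 ler_peMr// lerDr.
Qed.

(** Left-point sums of [g dw] over the [2 ^ M] intervals of level [k + M] inside
    the [j]-th interval of level [k]. *)
Let B k M j := \sum_(i < 2 ^ M) g (tau (k + M) (j * 2 ^ M + i)) *
  delta (k + M)%N (j * 2 ^ M + i)%N.

(* One refinement: only the odd intervals of level [k + M + 1] contribute, with the
   increment of [g] over the even interval preceding them. *)
Let B_step k M j : B k M.+1 j - B k M j =
  \sum_(i < 2 ^ M) (g (tau (k + M.+1) (2 * (j * 2 ^ M + i)).+1)
    - g (tau (k + M.+1) (2 * (j * 2 ^ M + i)))) *
    delta (k + M.+1)%N (2 * (j * 2 ^ M + i)).+1.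
Proof.
rewrite /B expnSr (sum_blocks (fun b => g (tau (k + M.+1) (j * (2 ^ M * 2) + b)) *
  delta (k + M.+1)%N (j * (2 ^ M * 2) + b)%N)) -sumrB.
have half a : tau (k + M) a = tau (k + M.+1) (2 * a).
  by have := @dyadic_refine R (k + M) a 1; rewrite addn1 -addnS expn1 mulnC => <-.
apply: eq_bigr => i _.
rewrite !big_ord_recl big_ord0 /= !half /bump /= addr0.
have -> : (j * (2 ^ M * 2) + (i * 2 + 0) = 2 * (j * 2 ^ M + i))%N.
  by rewrite addn0 mulnA -mulnDl mulnC.
have -> : (j * (2 ^ M * 2) + (i * 2 + 1) = (2 * (j * 2 ^ M + i)).+1)%N.
  by rewrite addn1 addnS mulnA -mulnDl mulnC.
rewrite mulnS add2n.
ring.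
Qed.

Let sum_odd_le n m : \sum_(a < m) delta n (2 * a).+1 ^+ 2 <=
  \sum_(b < m * 2) delta n b ^+ 2.
Proof.
rewrite (sum_blocks (fun b => delta n b ^+ 2)); apply: ler_sum => a _.
rewrite !big_ord_recl big_ord0 addr0 /= /bump /= addn0.
rewrite addn1 mulnC.
by rewrite lerDr sqr_ge0.
Qed.

Section bounded_variation.
Variable K : R.
Hypothesis K0 : 0 <= K.
Hypothesis hK : forall n, kap n * \sum_(b < Tc * 2 ^ n) delta n b ^+ 2 <= K ^+ 2.

Let B_diff k M : \sum_(j < N k) (B k M.+1 j - B k M j) ^+ 2 <=
  (C * K * A ^+ k * rho ^+ M) ^+ 2.
Proof.
set n := (k + M.+1)%N.
have step j : (j < N k)%N -> (B k M.+1 j - B k M j) ^+ 2 <=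
    2 ^+ M * (C * gq ^+ n) ^+ 2 * \sum_(i < 2 ^ M) delta n (2 * (j * 2 ^ M + i)).+1 ^+ 2.
  move=> jN; rewrite B_step -/n.
  apply: (le_trans (sum_sqr_le _ (fun i => (g (tau n (2 * (j * 2 ^ M + i)).+1)
    - g (tau n (2 * (j * 2 ^ M + i)))) * delta n (2 * (j * 2 ^ M + i)).+1))).
  rewrite natrX -mulrA ler_wpM2l ?exprn_ge0// mulr_sumr; apply: ler_sum => -[i iM] _ /=.
  rewrite exprMn ler_wpM2r ?sqr_ge0//.
  have aN : (2 * (j * 2 ^ M + i) < N n)%N.
    have h := N_refine jN iM; rewrite addnS in h.
    by have := N_refine h (M := 1) (i := 1) isT; rewrite expn1 addn1 mulnC addn1 -addnS.
  rewrite -real_normK ?num_real// ler_pXn2r ?nnegrE ?mulr_ge0 ?exprn_ge0 ?(ltW gq0)//.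
  exact: holder_step.
apply: (@le_trans _ _ (\sum_(j < N k) 2 ^+ M * (C * gq ^+ n) ^+ 2 *
    \sum_(i < 2 ^ M) delta n (2 * (j * 2 ^ M + i)).+1 ^+ 2)).
  by apply: ler_sum => j _; exact: step.
rewrite -mulr_sumr -(sum_blocks (fun a => delta n (2 * a).+1 ^+ 2)).
set S := \sum_(j < _) _.
have hS : S <= \sum_(b < Tc * 2 ^ n) delta n b ^+ 2.
  apply: (le_trans (sum_odd_le _ _)).
  apply: (@sum_ord_widen_le R (fun b => delta n b ^+ 2)); last by move=> i; exact: sqr_ge0.
  rewrite /n addnS expnS expnD.
  by rewrite -mulnA (mulnC 2%N) !mulnA -(mulnA (N k)) -(mulnA (Tc * _)) leq_mul.
have kS : kq ^+ n * S <= K ^+ 2.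
  by apply: le_trans (hK n); rewrite powR_half_exp ler_wpM2l// exprn_ge0// (ltW kq0).
have -> : 2 ^+ M * (C * gq ^+ n) ^+ 2 * S = 2 ^+ M * (C ^+ 2 * (A ^+ n) ^+ 2) * (kq ^+ n * S).
  have -> : (C * gq ^+ n) ^+ 2 = C ^+ 2 * (gq ^+ 2) ^+ n by rewrite exprMn -!exprM mulnC.
  by rewrite gqE exprMn -exprM [in RHS]mulnC exprM; ring.
apply: (@le_trans _ _ (2 ^+ M * (C ^+ 2 * (A ^+ n) ^+ 2) * K ^+ 2)).
  by rewrite ler_wpM2l// mulr_ge0 ?exprn_ge0// mulr_ge0 ?sqr_ge0.
have -> : (A ^+ n) ^+ 2 = (A ^+ k) ^+ 2 * ((A ^+ 2) ^+ M) * A ^+ 2.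
  have -> : A ^+ n = A ^+ k * (A * A ^+ M) by rewrite /n exprD exprS.
  by rewrite -(exprM A 2 M) mulnC (exprM A M 2); ring.
rewrite {1}AE expr_div_n.
have -> : 2 ^+ M * (C ^+ 2 * ((A ^+ k) ^+ 2 * ((rho ^+ 2) ^+ M / 2 ^+ M) * A ^+ 2)) * K ^+ 2
  = A ^+ 2 * (C * K * A ^+ k * rho ^+ M) ^+ 2.
  rewrite -(exprM rho) (mulnC 2%N) (exprM rho); field; exact: expf_neq0.
by rewrite ler_piMl ?sqr_ge0// exprn_ile1 ?ltW.
Qed.

Let B_err k M : \sum_(j < N k) (B k M j - B k 0 j) ^+ 2 <=
  (C * K * A ^+ k * \sum_(m < M) rho ^+ m) ^+ 2.
Proof.
elim: M => [|M IH].
  rewrite big_ord0 mulr0 expr0n big1// => j _; by rewrite subrr expr0n.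
have -> : \sum_(j < N k) (B k M.+1 j - B k 0 j) ^+ 2 =
   \sum_(j < N k) ((B k M j - B k 0 j) + (B k M.+1 j - B k M j)) ^+ 2.
  by apply: eq_bigr => j _; congr (_ ^+ 2); ring.
rewrite big_ord_recr /= mulrDr.
apply: (sum_minkowski (x := fun j => B k M j - B k 0 j)
  (y := fun j => B k M.+1 j - B k M j)) => //.
- rewrite !mulr_ge0 ?exprn_ge0 ?(ltW A0)// sumr_ge0// => m _.
  by rewrite exprn_ge0// ltW.
- by rewrite !mulr_ge0 ?exprn_ge0 ?(ltW A0) ?(ltW rho0).
Qed.

Variable I : R -> R.
Hypothesis hI : forall r, r \in `[0, t] -> is_young_integral g w 0 r (I r).

Let B_cvg k j : (j < N k)%N ->
  B k M j @[M --> \oo] --> I (tau k j.+1) - I (tau k j).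
Proof.
move=> jN.
have h1 := young_dyadic_cvg (hI (tau_in jN)).
have h0 := young_dyadic_cvg (hI (tau_in (ltnW jN))).
under eq_fun => M.
  have -> : B k M j =
      \sum_(i < j.+1 * 2 ^ M) g (tau (k + M) i) * delta (k + M)%N i
      - \sum_(i < j * 2 ^ M) g (tau (k + M) i) * delta (k + M)%N i.
    by rewrite mulSn addnC big_split_ord /= addrAC subrr add0r.
  over.
exact: cvgB.
Qed.

Let B0E k j : B k 0 j = g (tau k j) * delta k j.
Proof. by rewrite /B expn0 big_ord1 muln1 !addn0. Qed.

(** A discrete form of the Young--Loeve estimate, in mean square over the grid. *)
Lemma young_error_le k :
  \sum_(j < N k) (I (tau k j.+1) - I (tau k j) - g (tau k j) * delta k j) ^+ 2
  <= (C * K / (1 - rho) * A ^+ k) ^+ 2.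
Proof.
have r1 : 0 < 1 - rho by rewrite subr_gt0.
have geom M : \sum_(m < M) rho ^+ m <= (1 - rho)^-1.
  rewrite -div1r ler_pdivlMr// mulrC -opprB mulNr -subrX1 opprB gerBl.
  by rewrite exprn_ge0// ltW.
have cv : \sum_(j < N k) (B k M j - B k 0 j) ^+ 2 @[M --> \oo] -->
  \sum_(j < N k) (I (tau k j.+1) - I (tau k j) - g (tau k j) * delta k j) ^+ 2.
  apply: (@cvg_sumr R (fun j M => (B k M j - B k 0 j) ^+ 2)
    (fun j => (I (tau k j.+1) - I (tau k j) - g (tau k j) * delta k j) ^+ 2)) => j jN.
  have h : B k M j - B k 0 j @[M --> \oo] --> I (tau k j.+1) - I (tau k j) - g (tau k j) * delta k j.
    by rewrite -B0E; apply: cvgB; [exact: B_cvg|exact: cvg_cst].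
  by under eq_fun do rewrite expr2; rewrite expr2; apply: cvgM.
apply: (cvgr_to_le cv); apply: nearW => M.
apply: (le_trans (B_err k M)).
have nn x : 0 <= x -> 0 <= C * K * A ^+ k * x.
  by move=> x0; rewrite !mulr_ge0 ?exprn_ge0 ?(ltW A0).
have s0 : 0 <= \sum_(m < M) rho ^+ m.
  by apply: sumr_ge0 => m _; rewrite exprn_ge0// ltW.
have -> : C * K / (1 - rho) * A ^+ k = C * K * A ^+ k * (1 - rho)^-1 by ring.
rewrite ler_pXn2r ?nnegrE ?nn ?invr_ge0 ?(ltW r1)//.
by rewrite ler_wpM2l// !mulr_ge0 ?exprn_ge0 ?(ltW A0).
Qed.

Lemma young_error_cvg0 : kap k *
  \sum_(j < N k) (I (tau k j.+1) - I (tau k j) - g (tau k j) * delta k j) ^+ 2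
  @[k --> \oo] --> (0 : R).
Proof.
apply: (@cvg0_geometric R ((C * K / (1 - rho)) ^+ 2) (gq ^+ 2)).
  by rewrite sqr_ge0 exprn_ilt1// ltW.
move=> k; rewrite mulr_ge0 ?powR_ge0 ?sumr_ge0//=; last by move=> j _; exact: sqr_ge0.
apply: (@le_trans _ _ (kap k * (C * K / (1 - rho) * A ^+ k) ^+ 2)).
  by rewrite ler_wpM2l ?powR_ge0// young_error_le.
have -> : (gq ^+ 2) ^+ k = (A ^+ k) ^+ 2 * kq ^+ k by rewrite gqE exprMn -!exprM mulnC.
by rewrite powR_half_exp -/kq le_eqVlt; apply/orP; left; apply/eqP; ring.
Qed.

End bounded_variation.

Let N_step k l : (N k * 2 ^ l <= N (k + l) <= (N k).+1 * 2 ^ l)%N.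
Proof.
apply/andP; split.
  by rewrite dyadic_countP ?(ltW t0)// dyadic_refine -dyadic_countP// ltW.
rewrite -(ler_dyadic (R := R) (k + l)) dyadic_refine.
apply: (@le_trans _ _ t); first by rewrite -dyadic_countP// ltW.
by rewrite ltW// ltNge -dyadic_countP ?(ltW t0)// ltnn.
Qed.

Let count_le m : (N m)%:R * (1 / 2 ^+ m) <= t.
Proof.
have := leqnn (N m); rewrite dyadic_countP ?(ltW t0)//.
by rewrite /dyadic mul1r.
Qed.

Section weighted_variation.
Variables (F : R -> R) (C' Bd : R).
Hypotheses (C'0 : 0 <= C') (FB : forall r, r \in `[0, t] -> `|F r| <= Bd).
Hypothesis hF : forall r s, r \in `[0, t] -> s \in `[0, t] ->
  `|F r - F s| <= C' * `|r - s| `^ gamma.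

Let gamma0 : 0 < gamma. Proof. by move: g1; lra. Qed.

Let Bd0 : 0 <= Bd.
Proof. by apply: (le_trans (normr_ge0 (F 0))); apply: FB; rewrite in_itv /= lexx ltW. Qed.

Let F_close m i r : (i < N m)%N -> tau m i <= r -> r <= tau m i.+1 ->
  `|F r - F (tau m i)| <= C' * gq ^+ m.
Proof.
move=> iN ir ri.
have rt : r \in `[0, t].
  rewrite in_itv /= (le_trans (dyadic_ge0 _ _) ir) (le_trans ri)//.
  by have := tau_in iN; rewrite in_itv => /andP[].
apply: (le_trans (hF rt (tau_in (ltnW iN)))).
rewrite ler_wpM2l// -powR_half_exp ge0_ler_powR ?nnegrE ?divr_ge0 ?exprn_ge0//.
  exact: ltW.
by rewrite ger0_norm ?subr_ge0// -(dyadicS m i) lerB.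
Qed.

(* The term [Bd / 2 ^+ m] accounts for the piece of [[0, t]] to the right of the last
   grid point. *)
Let riemann_le m : `|\sum_(i < N m) F (tau m i) * (1 / 2 ^+ m) - time_int 0 t F|
  <= C' * gq ^+ m * t + Bd / 2 ^+ m.
Proof.
have cF : {within `[0, t], continuous F} by exact: holder_within_continuous gamma0 hF.
have iF a b : 0 <= a -> b <= t -> (@lebesgue_measure R).-integrable `[a, b] (EFin \o F).
  exact: within_continuous_integrable.
have tauN : tau m (N m) <= t by rewrite -dyadic_countP// ltW.
have J0 : time_int 0 (tau m 0) F = 0.
  by rewrite dyadic0 /time_int set_itv1 Rintegral_set1.
have split_int : time_int 0 t F = \sum_(i < N m) time_int (tau m i) (tau m i.+1) F
    + time_int (tau m (N m)) t F.
  rewrite -(time_intB (dyadic_ge0 m (N m)) tauN); last exact: iF.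
  have -> : \sum_(i < N m) time_int (tau m i) (tau m i.+1) F = time_int 0 (tau m (N m)) F.
    rewrite -(big_mkord predT (fun i => time_int (tau m i) (tau m i.+1) F)).
    rewrite (@telescope_sumr_eq _ 0 (N m) (fun i => time_int 0 (tau m i) F))// ?J0 ?subr0//.
    move=> i /andP[_ iN]; rewrite time_intB ?dyadic_ge0 ?ler_dyadic//.
    by apply: iF => //; apply: le_trans tauN; rewrite ler_dyadic.
  by rewrite addrC subrK.
have -> : \sum_(i < N m) F (tau m i) * (1 / 2 ^+ m) - time_int 0 t F =
   - (\sum_(i < N m) (time_int (tau m i) (tau m i.+1) F - F (tau m i) * (1 / 2 ^+ m))
      + time_int (tau m (N m)) t F).
  by rewrite split_int sumrB; ring.
rewrite normrN; apply: (le_trans (ler_normD _ _)); apply: lerD; last first.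
  have h : `|time_int (tau m (N m)) t F| <= Bd * (t - tau m (N m)).
    apply: time_int_bound => //; first by apply: iF => //; exact: dyadic_ge0.
    move=> x; rewrite in_itv /= => /andP[x1 x2]; apply: FB.
    by rewrite in_itv /= x2 (le_trans (dyadic_ge0 _ _) x1).
  apply: (le_trans h); rewrite ler_wpM2l// -div1r -(dyadicS m (N m)) lerB//.
  by rewrite ltW// ltNge -dyadic_countP ?(ltW t0)// ltnn.
apply: (le_trans (ler_norm_sum _ _ _)).
apply: (@le_trans _ _ (\sum_(i < N m) C' * gq ^+ m * (1 / 2 ^+ m))); last first.
  rewrite sumr_const card_ord -[X in X <= _]mulr_natr mulrAC -mulrA [X in _ * X]mulrC.
  by rewrite ler_wpM2l ?mulr_ge0 ?exprn_ge0 ?(ltW gq0)// mulrC.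
apply: ler_sum => -[i iN] _ /=.
have it : tau m i.+1 <= t by have := tau_in iN; rewrite in_itv => /andP[].
have cst_int : time_int (tau m i) (tau m i.+1) (cst (F (tau m i))) = F (tau m i) * (1 / 2 ^+ m).
  rewrite /time_int Rintegral_cst//= lebesgue_measure_itv /= lte_fin ltr_dyadic ltnSn.
  by rewrite -EFinB /= dyadicS.
have ic : (@lebesgue_measure R).-integrable `[tau m i, tau m i.+1]
    (EFin \o cst (F (tau m i))).
  by apply: continuous_compact_integrable; [exact: segment_compact|move=> x; exact: cst_continuous].
have iFi := iF _ _ (dyadic_ge0 m i) it.
rewrite -cst_int /time_int -RintegralB// -(dyadicS m i).
apply: (@time_int_bound R (fun x => F x - F (tau m i))).
- by rewrite ler_dyadic.
- have mi : measurable (`[tau m i, tau m i.+1]%classic : set (measurableTypeR R)) by exact: measurable_itv.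
  by have := integrableB mi iFi ic.
- by move=> x; rewrite in_itv /= => /andP[x1 x2]; exact: F_close.
Qed.

(** The quadratic variation of [w], weighted by a Hoelder continuous [F], converges
    to the integral of [F]: at level [m + l], the weight is replaced by its value at
    the grid points of a fixed level [m], over whose intervals [hQ] applies. *)
Lemma weighted_var_cvg :
  kap k * \sum_(j < N k) F (tau k j) * delta k j ^+ 2 @[k --> \oo] --> time_int 0 t F.
Proof.
pose L k := kap k * \sum_(j < N k) F (tau k j) * delta k j ^+ 2.
pose V m l i := dyadic_var H w (m + l) (i * 2 ^ l) (2 ^ l).
have VE m l i : V m l i = kap (m + l)%N * \sum_(j < 2 ^ l) delta (m + l)%N (i * 2 ^ l + j)%N ^+ 2 by [].
have kap0 n : 0 <= kap n by exact: powR_ge0.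
have V0 m l i : 0 <= V m l i.
  by rewrite VE mulr_ge0// sumr_ge0// => j _; exact: sqr_ge0.
have Lclose m l : `|L (m + l)%N - \sum_(i < N m) F (tau m i) * V m l i| <=
    C' * gq ^+ m * \sum_(i < N m) V m l i + Bd * V m l (N m).
  have /andP[N1 N2] := N_step m l.
  have -> : L (m + l)%N = kap (m + l)%N * (\sum_(i < N m) \sum_(j < 2 ^ l)
        F (tau (m + l) (i * 2 ^ l + j)) * delta (m + l)%N (i * 2 ^ l + j)%N ^+ 2)
      + kap (m + l)%N * \sum_(j < N (m + l) - N m * 2 ^ l)
        F (tau (m + l) (N m * 2 ^ l + j)) * delta (m + l)%N (N m * 2 ^ l + j)%N ^+ 2.
    rewrite -mulrDr -(sum_blocks (fun b => F (tau (m + l) b) * delta (m + l)%N b ^+ 2)).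
    by rewrite /L (sum_ord_split (fun b => F (tau (m + l) b) * delta (m + l)%N b ^+ 2) N1).
  rewrite addrAC; apply: (le_trans (ler_normD _ _)); apply: lerD.
    rewrite mulr_sumr -sumrB; apply: (le_trans (ler_norm_sum _ _ _)).
    rewrite mulr_sumr; apply: ler_sum => -[i iN] _ /=.
    rewrite VE mulrCA -mulrBr normrM (ger0_norm (kap0 _)) mulrCA ler_wpM2l//.
    rewrite mulr_sumr -sumrB; apply: (le_trans (ler_norm_sum _ _ _)).
    rewrite mulr_sumr; apply: ler_sum => -[j jl] _ /=.
    rewrite -mulrBl normrM [`|_ ^+ 2|]ger0_norm ?sqr_ge0// ler_wpM2r ?sqr_ge0//.
    apply: F_close => //.
      by rewrite -(dyadic_refine m i l) ler_dyadic leq_addr.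
    by rewrite -(dyadic_refine m i.+1 l) ler_dyadic mulSn addnC leq_add2r ltnW.
  rewrite normrM (ger0_norm (kap0 _)) VE mulrCA ler_wpM2l//.
  apply: (le_trans (ler_norm_sum _ _ _)).
  apply: (@le_trans _ _ (\sum_(j < N (m + l) - N m * 2 ^ l)
     Bd * delta (m + l)%N (N m * 2 ^ l + j)%N ^+ 2)).
    apply: ler_sum => -[j jl] _ /=.
    rewrite normrM [`|_ ^+ 2|]ger0_norm ?sqr_ge0// ler_wpM2r ?sqr_ge0//.
    by apply: FB; apply: tau_in; apply: ltnW; rewrite -ltn_subRL.
  rewrite -mulr_sumr ler_wpM2l//.
  apply: (@sum_ord_widen_le R (fun j => delta (m + l)%N (N m * 2 ^ l + j)%N ^+ 2)).
    by rewrite leq_subLR -mulSnr.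
  by move=> j; exact: sqr_ge0.
have half_lt1' : `|1 / 2 : R| < 1 by rewrite ger0_norm ?divr_ge0//; lra.
have gq1' : `|gq| < 1 by rewrite ger0_norm ?(ltW gq0).
apply/cvgrPdist_lt => e e0.
have [m hm] : exists m, C' * gq ^+ m * t + Bd / 2 ^+ m < e / 4.
  have h : C' * gq ^+ m * t + Bd / 2 ^+ m @[m --> \oo] --> (0 : R).
    have -> : 0 = 0 * t + 0 :> R by rewrite mul0r addr0.
    apply: cvgD.
      by apply: cvgM; [exact: cvg_geometric gq1'|exact: cvg_cst].
    under eq_fun do rewrite -exprVn -div1r.
    exact: cvg_geometric half_lt1'.
  have e4 : 0 < e / 4 by rewrite divr_gt0.
  have /cvgr0Pnorm_lt /(_ _ e4) [m _ hm] := h.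
  by exists m; apply: (le_lt_trans (ler_norm _)); apply: hm => /=.
have Vcvg i : V m l i @[l --> \oo] --> (1 / 2 ^+ m : R) by exact: hQ.
have c1 : \sum_(i < N m) F (tau m i) * V m l i @[l --> \oo] -->
    \sum_(i < N m) F (tau m i) * (1 / 2 ^+ m).
  apply: (@cvg_sumr R (fun i l => F (tau m i) * V m l i)
    (fun i => F (tau m i) * (1 / 2 ^+ m))) => i _.
  by apply: cvgM; [exact: cvg_cst|exact: Vcvg].
have c2 : C' * gq ^+ m * \sum_(i < N m) V m l i + Bd * V m l (N m) @[l --> \oo] -->
    C' * gq ^+ m * \sum_(i < N m) (1 / 2 ^+ m) + Bd * (1 / 2 ^+ m).
  apply: cvgD; apply: cvgM; [exact: cvg_cst| |exact: cvg_cst|exact: Vcvg].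
  exact: (@cvg_sumr R (fun i l => V m l i) (fun=> 1 / 2 ^+ m)).
have c2_lt : C' * gq ^+ m * \sum_(i < N m) (1 / 2 ^+ m) + Bd * (1 / 2 ^+ m) < e / 4.
  apply: le_lt_trans hm; rewrite div1r lerD2r ler_wpM2l ?mulr_ge0 ?exprn_ge0 ?(ltW gq0)//.
  by rewrite sumr_const card_ord; have := count_le m; rewrite div1r mulr_natl.
have e4 : 0 < e / 4 by rewrite divr_gt0.
have : \forall l \near \oo, `|time_int 0 t F - L (m + l)%N| < e.
  move/cvgrPdist_lt: (c1) => /(_ _ e4) n1.
  have n2 := cvgr_lt _ c2 _ c2_lt.
  have [na _ ha] := n1; have [nb _ hb] := n2 _.
  exists (maxn na nb) => // l /=; rewrite geq_max => /andP[la lb].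
  have b1 := ha l la; have b2 := hb l lb; rewrite /= in b1 b2.
  have b3 := le_lt_trans (riemann_le m) hm.
  have b4 := le_lt_trans (Lclose m l) b2.
  move: b1 b3 b4; set X := \sum_(i < N m) _; set Y := \sum_(i < N m) _ => b1 b3 b4.
  have -> : time_int 0 t F - L (m + l)%N = - (X - time_int 0 t F) + (X - Y) - (L (m + l)%N - Y) by ring.
  apply: (le_lt_trans (ler_normB _ _)); apply: (le_lt_trans (lerD (ler_normD _ _) (lexx _))).
  rewrite normrN; lra.
move=> [n _ hn]; exists (m + n)%N => // k /= mk.
rewrite -(subnKC (leq_trans (leq_addr n m) mk)); apply: hn => /=.
by rewrite leq_subRL// (leq_trans (leq_addr n m) mk).
Qed.

End weighted_variation.

Let g_bound r : r \in `[0, t] -> `|g r| <= `|g 0| + C * t `^ gamma.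
Proof.
move=> rt; have zt : 0 \in `[0, t] by rewrite in_itv /= lexx ltW.
have h := hg rt zt; rewrite subr0 in h.
have -> : g r = g 0 + (g r - g 0) by ring.
apply: (le_trans (ler_normD _ _)); rewrite lerD2l (le_trans h)// ler_wpM2l//.
move: rt; rewrite in_itv /= => /andP[r0 rt].
rewrite ge0_ler_powR ?nnegrE// ?ger0_norm//; last exact: ltW.
by move: g1; lra.
Qed.

Let main_term_cvg : kap k * \sum_(j < N k) (g (tau k j) * delta k j) ^+ 2
  @[k --> \oo] --> time_int 0 t (fun s => g s ^+ 2).
Proof.
pose G := `|g 0| + C * t `^ gamma.
have G0 : 0 <= G by rewrite addr_ge0// mulr_ge0// powR_ge0.
under eq_fun do under eq_bigr do rewrite exprMn.
apply: (@weighted_var_cvg (fun s => g s ^+ 2) (2 * G * C) (G ^+ 2)).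
- by rewrite !mulr_ge0.
- by move=> r rt; rewrite normrX ler_pXn2r ?nnegrE// g_bound.
- move=> r s rt st; rewrite subr_sqr normrM mulrC -[leRHS]mulrA.
  apply: ler_pM => //; last exact: hg.
  apply: (le_trans (ler_normD _ _)).
  by have := g_bound rt; have := g_bound st; rewrite -/G; lra.
Qed.

Variables (f D I : R -> R) (CD : R).
Hypothesis hI : forall r, r \in `[0, t] -> is_young_integral g w 0 r (I r).
Hypothesis hD : forall r s, r \in `[0, t] -> s \in `[0, t] ->
  `|D r - D s| <= CD * `|r - s|.
Hypothesis hf : forall r, r \in `[0, t] -> f r = f 0 + D r + I r.

Let drift_cvg0 : kap k * \sum_(j < N k) (D (tau k j.+1) - D (tau k j)) ^+ 2
  @[k --> \oo] --> (0 : R).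
Proof.
apply: (@cvg0_geometric R (CD ^+ 2 * t) ((1 / 2) `^ (2 - 2 * H))).
  by rewrite powR_ge0 half_lt1//; move: H2; lra.
move=> k; rewrite mulr_ge0 ?powR_ge0 ?sumr_ge0//=; last by move=> j _; exact: sqr_ge0.
have h : \sum_(j < N k) (D (tau k j.+1) - D (tau k j)) ^+ 2 <=
    (N k)%:R * (CD * (1 / 2 ^+ k)) ^+ 2.
  rewrite mulr_natl -[X in _ *+ X]card_ord -sumr_const; apply: ler_sum => -[j jN] _ /=.
  have := hD (tau_in jN) (tau_in (ltnW jN)); rewrite dyadicS (ger0_norm (divr_ge0 _ _)) ?exprn_ge0// => h.
  by rewrite -real_normK ?num_real// ler_pXn2r ?nnegrE// ?(le_trans _ h).
apply: (@le_trans _ _ (kap k * ((N k)%:R * (CD * (1 / 2 ^+ k)) ^+ 2))).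
  by rewrite ler_wpM2l ?powR_ge0.
have -> : kap k * ((N k)%:R * (CD * (1 / 2 ^+ k)) ^+ 2) =
   CD ^+ 2 * ((N k)%:R * (1 / 2 ^+ k)) * (kap k * (1 / 2 ^+ k)) by ring.
have -> : ((1 / 2) `^ (2 - 2 * H)) ^+ k = kap k * (1 / 2 ^+ k).
  rewrite powR_half_exp (_ : 1 / 2 ^+ k = ((1 / 2) `^ 1) ^+ k); last first.
    by rewrite powRr1 ?divr_ge0// expr_div_n expr1n.
  by rewrite -exprMn halfD; congr (powR _ _ ^+ _); ring.
rewrite ler_wpM2r ?mulr_ge0 ?powR_ge0 ?divr_ge0 ?exprn_ge0//.
by rewrite ler_wpM2l ?sqr_ge0.
Qed.

(** Deterministic core: a path [f] whose increments are those of a Young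
    integral of [g] against [w], up to a Lipschitz drift, has quadratic
    variation of index [H] equal to the time integral of [g ^+ 2]. *)
Lemma path_quadratic_variation :
  kap k * \sum_(j < N k) (f (tau k j.+1) - f (tau k j)) ^+ 2 @[k --> \oo] -->
  time_int 0 t (fun s => g s ^+ 2).
Proof.
have [K K0 hK] := total_var_bounded.
pose a k j := g (tau k j) * delta k j.
pose r k j := I (tau k j.+1) - I (tau k j) - a k j.
pose b k j := D (tau k j.+1) - D (tau k j).
pose e k j := b k j + r k j.
have kap0 n : 0 <= kap n by exact: powR_ge0.
have sq0 k (x : nat -> R) : 0 <= kap k * \sum_(j < N k) x j ^+ 2.
  by rewrite mulr_ge0// sumr_ge0// => j _; exact: sqr_ge0.
have r_cvg : kap k * \sum_(j < N k) r k j ^+ 2 @[k --> \oo] --> (0 : R).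
  exact: (young_error_cvg0 K0 hK hI).
have e_cvg : kap k * \sum_(j < N k) e k j ^+ 2 @[k --> \oo] --> (0 : R).
  apply: (@squeeze_cvgr _ _ _ _ (cst 0) (fun k =>
    2 * (kap k * \sum_(j < N k) b k j ^+ 2) + 2 * (kap k * \sum_(j < N k) r k j ^+ 2))).
  - apply: nearW => k; rewrite sq0 /=.
    rewrite !(mulrCA 2) -mulrDr ler_wpM2l// !mulr_sumr -big_split /=.
    apply: ler_sum => j _; rewrite -subr_ge0.
    by rewrite [leRHS](_ : _ = (b k j - r k j) ^+ 2) ?sqr_ge0//; rewrite /= /e; ring.
  - exact: cvg_cst.
  - have := cvgD (cvgM (cvg_cst (2 : R)) drift_cvg0) (cvgM (cvg_cst (2 : R)) r_cvg).
    by rewrite mulr0 addr0; apply.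
have x_cvg : kap k * \sum_(j < N k) a k j * e k j @[k --> \oo] --> (0 : R).
  apply: cvg0_sqr.
  apply: (@squeeze_cvgr _ _ _ _ (cst 0) (fun k =>
    (kap k * \sum_(j < N k) a k j ^+ 2) * (kap k * \sum_(j < N k) e k j ^+ 2))).
  - apply: nearW => k; rewrite sqr_ge0 /= exprMn.
    have -> : kap k * (\sum_(j < N k) a k j ^+ 2) * (kap k * \sum_(j < N k) e k j ^+ 2)
      = kap k ^+ 2 * ((\sum_(j < N k) a k j ^+ 2) * \sum_(j < N k) e k j ^+ 2) by ring.
    by rewrite ler_wpM2l ?sqr_ge0// sum_cauchy_schwarz.
  - exact: cvg_cst.
  - by have := cvgM main_term_cvg e_cvg; rewrite mulr0; apply.
have -> : (fun k => kap k * \sum_(j < N k) (f (tau k j.+1) - f (tau k j)) ^+ 2) =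
  (fun k => kap k * (\sum_(j < N k) a k j ^+ 2) + (2 * (kap k * \sum_(j < N k) a k j * e k j)
     + kap k * \sum_(j < N k) e k j ^+ 2)).
  apply/funext => k; rewrite (mulrCA 2) -!mulrDr; congr (_ * _).
  rewrite mulr_sumr -!big_split /=; apply: eq_bigr => -[j jN] _ /=.
  rewrite (hf (tau_in jN)) (hf (tau_in (ltnW jN))) /e /r /b; ring.
have := cvgD main_term_cvg (cvgD (cvgM (cvg_cst (2 : R)) x_cvg) e_cvg).
by rewrite mulr0 !addr0; apply.
Qed.

End path_quadratic_variation.

(** * Square integrable functions *)

Section square_integrable.
Context {d : measure_display} {T : measurableType d} {R : realType}.
Variables (mu : {measure set T -> \bar R}) (D : set T).
Hypotheses (mD : measurable D) (muD : (mu D < +oo)%E).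
Local Notation Int f := (mu.-integrable D (EFin \o f)).

(** Square integrable functions over [D]; elements of [L^2] are represented by
    functions. *)
Definition sqint (f : T -> R) : Prop :=
  measurable_fun D f /\ (\int[mu]_(x in D) (f x ^+ 2)%:E < +oo)%E.

(** The inner product of [L^2(D)]; meaningful on square integrable functions. *)
Definition ip (f g : T -> R) : R := Rintegral mu D (fun x => f x * g x).

Lemma sqint_Int2 f : sqint f -> Int (fun x => f x ^+ 2).
Proof.
move=> [mf ff]; apply/integrableP; split.
  by apply/measurable_EFinP; exact: measurable_funX.
by under eq_integral do rewrite /= ger0_norm ?sqr_ge0//.
Qed.

Lemma sqint_mul f g : sqint f -> sqint g -> Int (fun x => f x * g x).
Proof.
move=> f2 g2; have [mf _] := f2; have [mg _] := g2.
apply: (@le_integrable _ _ _ mu D mD _ (EFin \o (fun x => f x ^+ 2 + g x ^+ 2))).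
- by apply/measurable_EFinP; exact: measurable_funM.
- move=> x _ /=; rewrite lee_fin [leRHS]ger0_norm ?addr_ge0 ?sqr_ge0//.
  rewrite normrM -(real_normK (num_real (f x))) -(real_normK (num_real (g x))).
  move: (`|f x|) (`|g x|) (normr_ge0 (f x)) (normr_ge0 (g x)) => a b a0 b0.
  nra.
- by have := integrableD mD (sqint_Int2 f2) (sqint_Int2 g2).
Qed.

Lemma sqint_cst c : sqint (cst c).
Proof.
split; first exact: measurable_cst.
have -> : (fun x : T => (cst c x ^+ 2)%:E) = cst (c ^+ 2)%:E by [].
by rewrite integral_cst// lte_mul_pinfty// lee_fin sqr_ge0.
Qed.

Lemma sqint_bounded (f : T -> R) (M : R) : measurable_fun D f -> (forall x, D x -> `|f x| <= M) ->
  sqint f.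
Proof.
move=> mf fM; split => //.
have [_] := sqint_cst M; apply: le_lt_trans; apply: ge0_le_integral => //.
- by move=> x _; rewrite lee_fin sqr_ge0.
- by apply/measurable_EFinP; exact: measurable_funX.
- exact: (@measurable_cst _ _ T _ D (M ^+ 2)%:E).
- move=> x Dx; rewrite lee_fin /= -real_normK ?num_real//.
  by rewrite ler_pXn2r ?nnegrE// ?fM// (le_trans _ (fM _ Dx)).
Qed.

Lemma sqint_Int f : sqint f -> Int f.
Proof.
move=> f2; have := sqint_mul f2 (sqint_cst 1).
by congr (mu.-integrable D (EFin \o _)); apply/funext => x; rewrite /= mulr1.
Qed.

Lemma sqint_mulb (f g : T -> R) (M : R) : sqint f -> measurable_fun D g ->
  (forall x, D x -> `|g x| <= M) -> sqint (fun x => f x * g x).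
Proof.
move=> f2 mg gM; have [mf _] := f2; split; first exact: measurable_funM.
have i2 : Int (fun x => M ^+ 2 * f x ^+ 2).
  by have := integrableZl mD (M ^+ 2) (sqint_Int2 f2).
have /integrableP[_] := i2; apply: le_lt_trans; apply: ge0_le_integral => //.
- by move=> x _; rewrite lee_fin sqr_ge0.
- by apply/measurable_EFinP; apply: measurable_funX; exact: measurable_funM.
- by apply/measurable_EFinP; apply: measurableT_comp => //; apply: measurable_funM => //; exact: measurable_funX.
- move=> x Dx; rewrite /= lee_fin.
  have n0 : 0 <= M ^+ 2 * f x ^+ 2 by rewrite mulr_ge0// sqr_ge0.
  rewrite (ger0_norm n0) exprMn mulrC.
  rewrite ler_wpM2r ?sqr_ge0// -real_normK ?num_real//.
  by rewrite ler_pXn2r ?nnegrE// ?gM// (le_trans _ (gM _ Dx)).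
Qed.

Lemma sqintZ c f : sqint f -> sqint (fun x => c * f x).
Proof.
move=> f2; have := @sqint_mulb f (cst c) `|c| f2 (measurable_cst c) (fun _ _ => lexx _).
by congr sqint; apply/funext => x; rewrite mulrC.
Qed.

Lemma sqintD f g : sqint f -> sqint g -> sqint (fun x => f x + g x).
Proof.
move=> f2 g2; have [mf _] := f2; have [mg _] := g2; split.
  exact: measurable_funD.
have : Int (fun x => f x ^+ 2 + 2 * (f x * g x) + g x ^+ 2).
  have h1 := integrableD mD (sqint_Int2 f2) (integrableZl mD 2 (sqint_mul f2 g2)).
  by have := integrableD mD h1 (sqint_Int2 g2).
move=> /integrableP[_]; apply: le_lt_trans.
rewrite le_eqVlt; apply/orP; left; apply/eqP; apply: eq_integral => x _ /=.
have -> : f x ^+ 2 + 2 * (f x * g x) + g x ^+ 2 = (f x + g x) ^+ 2 by ring.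
by rewrite ger0_norm// sqr_ge0.
Qed.

Lemma sqintN f : sqint f -> sqint (fun x => - f x).
Proof. by move=> /(sqintZ (-1)); congr sqint; apply/funext => x; rewrite mulN1r. Qed.

Lemma sqintB f g : sqint f -> sqint g -> sqint (fun x => f x - g x).
Proof. by move=> f2 g2; apply: sqintD => //; exact: sqintN. Qed.

Lemma ipC f g : ip f g = ip g f.
Proof. by rewrite /ip; congr Rintegral; apply/funext => x; rewrite mulrC. Qed.

Lemma ipDl f g h : sqint f -> sqint g -> sqint h ->
  ip (fun x => f x + g x) h = ip f h + ip g h.
Proof.
move=> f2 g2 h2; rewrite /ip -RintegralD//; try exact: sqint_mul.
by congr Rintegral; apply/funext => x; rewrite mulrDl.
Qed.

Lemma ipZl c f h : sqint f -> sqint h -> ip (fun x => c * f x) h = c * ip f h.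
Proof.
move=> f2 h2; rewrite /ip -RintegralZl//; try exact: sqint_mul.
by congr Rintegral; apply/funext => x; rewrite mulrA.
Qed.

Lemma ipBl f g h : sqint f -> sqint g -> sqint h ->
  ip (fun x => f x - g x) h = ip f h - ip g h.
Proof.
move=> f2 g2 h2; rewrite /ip -RintegralB//; try exact: sqint_mul.
by congr Rintegral; apply/funext => x; rewrite mulrBl.
Qed.

Lemma ipDr f g h : sqint f -> sqint g -> sqint h ->
  ip h (fun x => f x + g x) = ip h f + ip h g.
Proof. by move=> f2 g2 h2; rewrite ipC ipDl// ![ip _ h]ipC. Qed.

Lemma ipZr c f h : sqint f -> sqint h -> ip h (fun x => c * f x) = c * ip h f.
Proof. by move=> f2 h2; rewrite ipC ipZl// ipC. Qed.

Lemma ipBr f g h : sqint f -> sqint g -> sqint h ->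
  ip h (fun x => f x - g x) = ip h f - ip h g.
Proof. by move=> f2 g2 h2; rewrite ipC ipBl// ![ip _ h]ipC. Qed.

Lemma ip_ge0 f : 0 <= ip f f.
Proof. by apply: Rintegral_ge0 => x _; rewrite -expr2 sqr_ge0. Qed.

Lemma ip_sqr_integral f : sqint f ->
  (\int[mu]_(x in D) (f x ^+ 2)%:E = (ip f f)%:E)%E.
Proof.
move=> f2; rewrite /ip /Rintegral fineK.
  by apply: eq_integral => x _; rewrite expr2.
exact: (integrable_fin_num mD (sqint_mul f2 f2)).
Qed.

Lemma ip_cauchy_schwarz f g : sqint f -> sqint g ->
  ip f g ^+ 2 <= ip f f * ip g g.
Proof.
move=> f2 g2; set a := ip f f; set b := ip f g; set c := ip g g.
have key x : 0 <= a + 2 * x * b + x ^+ 2 * c.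
  have := ip_ge0 (fun y => f y + x * g y).
  have xg := sqintZ x g2.
  rewrite ipDl ?ipDr ?ipZl ?ipZr//; try exact: sqintD.
  by rewrite (ipC g f) -/a -/b -/c; congr (0 <= _); ring.
have c0 : 0 <= c by exact: ip_ge0.
have a0 : 0 <= a by exact: ip_ge0.
have [cE|cN] := eqVneq c 0.
  have [-> |bN] := eqVneq b 0; first by rewrite expr0n mulr_ge0.
  have := key (- (a + 1) / (2 * b)); rewrite cE mulr0 addr0.
  have -> : a + 2 * (- (a + 1) / (2 * b)) * b = -1 by field.
  by rewrite ler0N1.
have cp : 0 < c by rewrite lt_def cN.
have := key (- b / c).
have -> : a + 2 * (- b / c) * b + (- b / c) ^+ 2 * c = (a * c - b ^+ 2) / c by field.
by rewrite pmulr_lge0 ?invr_gt0// subr_ge0.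
Qed.

Lemma ip_cauchy_schwarz_le f g A B : 0 <= A -> 0 <= B -> sqint f -> sqint g ->
  ip f f <= A ^+ 2 -> ip g g <= B ^+ 2 -> `|ip f g| <= A * B.
Proof.
move=> A0 B0 f2 g2 fA gB.
rewrite -(@ler_pXn2r _ 2) ?nnegrE ?mulr_ge0// real_normK ?num_real//.
apply: (le_trans (ip_cauchy_schwarz f2 g2)); rewrite exprMn.
by apply: ler_pM => //; exact: ip_ge0.
Qed.

Lemma ip_pythagoras f g : sqint f -> sqint g -> ip f g = 0 ->
  ip (fun x => f x + g x) (fun x => f x + g x) = ip f f + ip g g.
Proof.
move=> f2 g2 fg; have fg2 := sqintD f2 g2.
by rewrite ipDl// (ipDr f2 g2 f2) (ipDr f2 g2 g2) (ipC g f) fg addr0 add0r.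
Qed.

Lemma ip_add_le f g : sqint f -> sqint g ->
  ip (fun x => f x + g x) (fun x => f x + g x) <= 2 * ip f f + 2 * ip g g.
Proof.
move=> f2 g2; have := ip_ge0 (fun x => f x - g x).
rewrite ipBl ?ipBr//; try exact: sqintB.
rewrite ipDl ?ipDr//; try exact: sqintD.
by rewrite (ipC g f); lra.
Qed.

End square_integrable.

(** * Density of an algebra of functions in L^2 *)

Section polynomial_step.
Context {R : realType}.

Lemma bernoulli_sub (z : R) N : 0 <= z <= 1 -> 1 - N%:R * z <= (1 - z) ^+ N.
Proof.
move=> /andP[z0 z1]; elim: N => [|N IH]; first by rewrite mul0r subr0 expr0.
rewrite exprS -natr1; have h : 0 <= 1 - z by rewrite subr_ge0.
apply: (le_trans _ (ler_wpM2l h IH)).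
have n0 : 0 <= N%:R :> R by [].
by have := mulr_ge0 (mulr_ge0 n0 z0) z0; lra.
Qed.

Lemma bernoulli_inv (z : R) N : 0 <= z <= 1 -> (1 - z) ^+ N * (1 + N%:R * z) <= 1.
Proof.
move=> /andP[z0 z1]; have h : 0 <= 1 - z by rewrite subr_ge0.
elim: N => [|N IH]; first by rewrite mul0r addr0 expr0 mulr1.
apply: le_trans IH; rewrite exprSr -mulrA ler_wpM2l ?exprn_ge0// -natr1.
have n0 : 0 <= N%:R :> R by [].
by have := mulr_ge0 (mulr_ge0 n0 z0) z0; have := mulr_ge0 z0 z0; lra.
Qed.

Lemma cvg_natmul_geometric (x : R) : 0 <= x < 1 -> n%:R * x ^+ n @[n --> \oo] --> (0 : R).
Proof.
move=> /andP[x0 x1]; set s := Num.sqrt x.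
have s0 : 0 <= s by exact: sqrtr_ge0.
have s1 : s < 1 by rewrite -sqrtr1 ltr_sqrt.
have xE : x = s * s by rewrite -expr2 sqr_sqrtr.
have r1 : 0 < 1 - s by rewrite subr_gt0.
have ns n : n%:R * s ^+ n <= (1 - s)^-1.
  rewrite -div1r ler_pdivlMr//.
  apply: (@le_trans _ _ ((1 - s) * \sum_(i < n) s ^+ i)).
    rewrite mulrC ler_wpM2l ?(ltW r1)// mulr_natl -[X in _ *+ X]card_ord -sumr_const.
    by apply: ler_sum => -[i ni] _; apply: ler_wiXn2l => //; [exact: ltW|exact: ltnW].
  by rewrite -opprB mulNr -subrX1 opprB gerBl exprn_ge0.
apply: (@squeeze_cvgr _ _ _ _ (cst 0) (fun n => (1 - s)^-1 * s ^+ n)).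
- apply: nearW => n; rewrite mulr_ge0 ?exprn_ge0//= xE exprMn mulrA.
  by rewrite ler_wpM2r ?exprn_ge0.
- exact: cvg_cst.
- by apply: cvg_geometric; rewrite ger0_norm.
Qed.

(** Explicit polynomials, bounded by one on the unit interval and converging
    there pointwise to the indicator function of [y < 1 / 2]. *)
Definition step_poly (n : nat) (y : R) : R := (1 - y ^+ n) ^+ (n * 2 ^ n).

Lemma step_poly_bound n (y : R) : 0 <= y <= 1 -> 0 <= step_poly n y <= 1.
Proof.
move=> /andP[y0 y1]; have h0 : 0 <= 1 - y ^+ n by rewrite subr_ge0 exprn_ile1.
rewrite /step_poly exprn_ge0//= exprn_ile1//.
by rewrite gerBl exprn_ge0.
Qed.

Lemma step_poly_cvg (y : R) : 0 <= y <= 1 ->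
  step_poly n y @[n --> \oo] --> ((y < 1 / 2)%R%:R : R).
Proof.
move=> y01; have /andP[y0 y1] := y01.
have z01 n : 0 <= y ^+ n <= 1 by rewrite exprn_ge0//= exprn_ile1.
have [yl|yg] := ltP y (1 / 2).
  apply: (@squeeze_cvgr _ _ _ _ (fun n => 1 - n%:R * (2 * y) ^+ n) (cst 1)).
  - apply: nearW => n; have /andP[_ ->] := step_poly_bound n y01; rewrite andbT.
    apply: le_trans (bernoulli_sub (n * 2 ^ n) (z01 n)).
    by rewrite natrM natrX exprMn mulrA.
  - rewrite -[X in _ --> X]subr0; apply: cvgB; first exact: cvg_cst.
    by apply: cvg_natmul_geometric; apply/andP; split; lra.
  - exact: cvg_cst.
apply: (@squeeze_cvgr _ _ _ _ (cst 0) (fun n => n.+1%:R^-1)).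
- apply: nearW => n; have /andP[-> _] := step_poly_bound n y01.
  rewrite /= -div1r ler_pdivlMr//; apply: le_trans (bernoulli_inv (n * 2 ^ n) (z01 n)).
  have h0 : 0 <= 1 - y ^+ n by rewrite subr_ge0; case/andP: (z01 n).
  rewrite ler_wpM2l ?exprn_ge0// -natr1 addrC lerD2l natrM natrX -mulrA -exprMn.
  by rewrite ler_peMr// exprn_ege1//; lra.
- exact: cvg_cst.
- exact: cvg_harmonic.
Qed.

End polynomial_step.

Section density.
Context {d : measure_display} {T : measurableType d} {R : realType}.
Variables (mu : {measure set T -> \bar R}) (D : set T).
Hypotheses (mD : measurable D) (muD : (mu D < +oo)%E).
Variable Pol : (T -> R) -> Prop.
Hypotheses
  (Pol_meas : forall p, Pol p -> measurable_fun setT p)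
  (Pol_bnd : forall p, Pol p -> exists M, forall x, `|p x| <= M)
  (Pol1 : Pol (cst 1))
  (PolD : forall p q, Pol p -> Pol q -> Pol (fun x => p x + q x))
  (PolZ : forall c p, Pol p -> Pol (fun x => c * p x))
  (PolM : forall p q, Pol p -> Pol q -> Pol (fun x => p x * q x)).

Local Notation sq := (sqint mu D).
Local Notation nsq f := (ip mu D f f).

(** Bounded measurable functions that are limits in mean square over [D] of
    functions of the algebra [Pol]. *)
Definition approximable (f : T -> R) : Prop :=
  [/\ measurable_fun setT f, exists M, forall x, `|f x| <= M &
   forall e, 0 < e -> exists2 p, Pol p & nsq (fun x => f x - p x) < e].

Let bnd_sq (f : T -> R) (M : R) : measurable_fun setT f -> (forall x, `|f x| <= M) -> sq f.
Proof.
move=> mf fM; apply: (sqint_bounded mD muD (M := M)) => //.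
exact: measurable_funTS.
Qed.

Let appr_sq f : approximable f -> sq f.
Proof. by move=> [mf [M fM] _]; exact: (bnd_sq mf fM). Qed.

Let pol_sq p : Pol p -> sq p.
Proof. by move=> pp; have [M pM] := Pol_bnd pp; exact: (bnd_sq (Pol_meas pp) pM). Qed.

Lemma nsq_dist_le f g h : sq f -> sq g -> sq h ->
  nsq (fun x => f x - h x) <=
  2 * nsq (fun x => f x - g x) + 2 * nsq (fun x => g x - h x).
Proof.
move=> f2 g2 h2.
have := ip_add_le mD (sqintB mD f2 g2) (sqintB mD g2 h2).
apply: le_trans; rewrite le_eqVlt; apply/orP; left; apply/eqP.
by congr ip; apply/funext => x; ring.
Qed.

Lemma nsq_mul_le (f g : T -> R) (M : R) : sq f -> measurable_fun D g -> (forall x, D x -> `|g x| <= M) ->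
  nsq (fun x => f x * g x) <= M ^+ 2 * nsq f.
Proof.
move=> f2 mg gM.
have fg2 := sqint_mulb mD f2 mg gM.
rewrite -lee_fin EFinM -!ip_sqr_integral// -ge0_integralZl//; last 3 first.
- by apply/measurable_EFinP; apply: measurable_funX; case: f2.
- by move=> x _; rewrite lee_fin sqr_ge0.
- by rewrite lee_fin sqr_ge0.
apply: ge0_le_integral => //.
- by move=> x _; rewrite lee_fin sqr_ge0.
- by apply/measurable_EFinP; apply: measurable_funX; case: fg2.
- apply/measurable_EFinP; apply: measurable_funM => //; apply: measurable_funX.
  by case: f2.
- move=> x Dx; rewrite -EFinM lee_fin exprMn mulrC ler_wpM2r ?sqr_ge0//.
  rewrite -real_normK ?num_real//.
  by rewrite ler_pXn2r ?nnegrE// ?gM// (le_trans _ (gM _ Dx)).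
Qed.

Lemma approximable_pol p : Pol p -> approximable p.
Proof.
move=> pp; split; [exact: Pol_meas|exact: Pol_bnd|move=> e e0; exists p => //].
rewrite /ip; under eq_Rintegral do rewrite subrr mulr0.
by rewrite Rintegral_cst//= mul0r.
Qed.

Lemma approximableD f g : approximable f -> approximable g ->
  approximable (fun x => f x + g x).
Proof.
move=> af ag; have f2 := appr_sq af; have g2 := appr_sq ag.
have [mf [M fM] fp] := af; have [mg [N gN] gq] := ag.
split; first exact: measurable_funD.
  by exists (M + N) => x; rewrite (le_trans (ler_normD _ _))// lerD.
move=> e e0; have e4 : 0 < e / 4 by rewrite divr_gt0.
have [p pp hp] := fp _ e4; have [q qq hq] := gq _ e4.
exists (fun x => p x + q x); first exact: PolD.
have p2 := pol_sq pp; have q2 := pol_sq qq.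
have -> : (fun x => f x + g x - (p x + q x)) = (fun x => (f x - p x) + (g x - q x)).
  by apply/funext => x; ring.
apply: (le_lt_trans (ip_add_le mD (sqintB mD f2 p2) (sqintB mD g2 q2))); lra.
Qed.

Lemma approximableZ c f : approximable f -> approximable (fun x => c * f x).
Proof.
move=> af; have f2 := appr_sq af; have [mf [M fM] fp] := af.
split; first exact: measurable_funM.
  by exists (`|c| * M) => x; rewrite normrM ler_wpM2l.
move=> e e0; have c1 : 0 < c ^+ 2 + 1 by rewrite ltr_wpDl ?sqr_ge0.
have [p pp hp] := fp _ (divr_gt0 e0 c1).
have p2 := pol_sq pp; have fp2 := sqintB mD f2 p2.
exists (fun x => c * p x); first exact: PolZ.
have -> : (fun x => c * f x - c * p x) = (fun x => c * (f x - p x)).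
  by apply/funext => x; ring.
rewrite ipZl ?ipZr//; last exact: sqintZ.
have n0 := ip_ge0 mu D (fun x => f x - p x).
move: hp n0; rewrite ltr_pdivlMr//.
move: (ip mu D _ _) => n hn n0; rewrite mulrA -expr2; lra.
Qed.

Lemma approximableM f g : approximable f -> approximable g ->
  approximable (fun x => f x * g x).
Proof.
move=> af ag; have f2 := appr_sq af; have g2 := appr_sq ag.
have [mf [M fM] fp] := af; have [mg [N gN] gq] := ag.
split; first exact: measurable_funM.
  exists (M * N) => x; rewrite normrM ler_pM//.
move=> e e0; have M1 : 0 < 4 * (M ^+ 2 + 1) by rewrite mulr_gt0// ltr_wpDl ?sqr_ge0.
have [q qq hq] := gq _ (divr_gt0 e0 M1); have [K qK] := Pol_bnd qq.
have K1 : 0 < 4 * (K ^+ 2 + 1) by rewrite mulr_gt0// ltr_wpDl ?sqr_ge0.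
have [p pp hp] := fp _ (divr_gt0 e0 K1).
have p2 := pol_sq pp; have q2 := pol_sq qq.
have fp2 := sqintB mD f2 p2; have gq2 := sqintB mD g2 q2.
have mf' : measurable_fun D f by exact: measurable_funTS.
have mq' : measurable_fun D q by apply: measurable_funTS; exact: Pol_meas.
exists (fun x => p x * q x); first exact: PolM.
have -> : (fun x => f x * g x - p x * q x) =
    (fun x => (g x - q x) * f x + (f x - p x) * q x).
  by apply/funext => x; ring.
have s1 := sqint_mulb mD gq2 mf' (fun x _ => fM x).
have s2 := sqint_mulb mD fp2 mq' (fun x _ => qK x).
apply: (le_lt_trans (ip_add_le mD s1 s2)).
have h1 := nsq_mul_le gq2 mf' (fun x _ => fM x).
have h2 := nsq_mul_le fp2 mq' (fun x _ => qK x).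
have n1 := ip_ge0 mu D (fun x => g x - q x).
have n2 := ip_ge0 mu D (fun x => f x - p x).
move: hp hq; rewrite !ltr_pdivlMr//; lra.
Qed.

Lemma approximable1 : approximable (cst 1).
Proof. exact: approximable_pol. Qed.

Lemma approximableX f n : approximable f -> approximable (fun x => f x ^+ n).
Proof.
move=> af; elim: n => [|n IH]; first exact: approximable1.
by under eq_fun do rewrite exprS; exact: approximableM.
Qed.

Lemma approximableB f g : approximable f -> approximable g ->
  approximable (fun x => f x - g x).
Proof.
move=> af ag; have := approximableD af (approximableZ (-1) ag).
by under eq_fun do rewrite mulN1r.
Qed.

Lemma nsq_dominated_cvg (f_ : nat -> T -> R) (f G : T -> R) :
  (forall n, measurable_fun D (f_ n)) -> sq f -> sq G ->
  (forall n x, D x -> `|f x - f_ n x| <= G x) ->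
  (forall x, D x -> f_ n x @[n --> \oo] --> f x) ->
  nsq (fun x => f x - f_ n x) @[n --> \oo] --> (0 : R).
Proof.
move=> mf_ f2 G2 fG cv; have [mf _] := f2; have [mG _] := G2.
have sB n : sq (fun x => f x - f_ n x).
  split; first exact: measurable_funB.
  have [_] := G2; apply: le_lt_trans; apply: ge0_le_integral => //.
  - by move=> x _; rewrite lee_fin sqr_ge0.
  - by apply/measurable_EFinP; apply: measurable_funX; exact: measurable_funB.
  - by apply/measurable_EFinP; exact: measurable_funX.
  - move=> x Dx; rewrite lee_fin -real_normK ?num_real//.
    by rewrite ler_pXn2r ?nnegrE ?fG// (le_trans _ (fG 0%N x Dx)).
have key : (\int[mu]_(x in D) ((f x - f_ n x) ^+ 2)%:E @[n --> \oo] -->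
    \int[mu]_(x in D) (cst 0 x))%E.
  apply: (@dominated_cvg _ _ _ mu D mD (fun n x => ((f x - f_ n x) ^+ 2)%:E)
     (cst 0%E) (fun x => (G x ^+ 2)%:E)) => //.
  - by move=> n; apply/measurable_EFinP; apply: measurable_funX; exact: measurable_funB.
  - move=> x Dx.
    have h : f x - f_ n x @[n --> \oo] --> (0 : R).
      by rewrite -(subrr (f x)); apply: cvgB; [exact: cvg_cst|exact: cv].
    have h2 : (f x - f_ n x) ^+ 2 @[n --> \oo] --> (0 : R).
      by under eq_fun do rewrite expr2; have := cvgM h h; rewrite mulr0; apply.
    by apply: (cvg_EFin _ h2); exact: nearW.
  - exact: sqint_Int2.
  - move=> n x Dx; rewrite /= lee_fin ger0_norm ?sqr_ge0// -real_normK ?num_real//.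
    by rewrite ler_pXn2r ?nnegrE ?fG// (le_trans _ (fG 0%N x Dx)).
rewrite integral_cst// mul0e in key.
under eq_fun do rewrite -[ip _ _ _ _]/(fine (ip mu D _ _)%:E) -ip_sqr_integral//.
exact: fine_cvg key.
Qed.

(** Pointwise limits of uniformly bounded approximable functions are approximable. *)
Lemma approximable_lim (f_ : nat -> T -> R) (f : T -> R) (M : R) :
  (forall n, approximable (f_ n)) -> (forall n x, `|f_ n x| <= M) ->
  (forall x, f_ n x @[n --> \oo] --> f x) -> approximable f.
Proof.
move=> af_ fM cv.
have mf : measurable_fun setT f.
  by apply: (measurable_fun_cvg (h := f_)) => [n|x _]; [case: (af_ n)|exact: cv].
have fM' x : `|f x| <= M.
  by apply: (cvgr_to_le (cvg_norm (cv x))); apply: nearW => n; exact: fM.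
split => //; first by exists M.
move=> e e0.
have f2 := bnd_sq mf fM'.
have cv0 : nsq (fun x => f x - f_ n x) @[n --> \oo] --> (0 : R).
  apply: (@nsq_dominated_cvg f_ f (cst (M + M))) => //.
  - by move=> n; apply: measurable_funTS; case: (af_ n).
  - exact: sqint_cst.
  - by move=> n x _; rewrite (le_trans (ler_normB _ _))// lerD.
have e4 : 0 < e / 4 by rewrite divr_gt0.
have [n hn] : exists n, nsq (fun x => f x - f_ n x) < e / 4.
  have /cvgr0Pnorm_lt /(_ _ e4) [n _ hn] := cv0.
  by exists n; apply: le_lt_trans (hn n _) => //=; exact: ler_norm.
have [_ _ /(_ _ e4) [p pp hp]] := af_ n.
exists p => //; apply: (le_lt_trans (nsq_dist_le f2 (appr_sq (af_ n)) (pol_sq pp))).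
lra.
Qed.

Lemma approximable_ae (f g : T -> R) : approximable f -> measurable_fun setT g ->
  (exists M, forall x, `|g x| <= M) ->
  {ae mu, forall x, D x -> f x = g x} -> approximable g.
Proof.
move=> af mg gM fg; have [mf _ fp] := af; split => // e e0.
have [p pp hp] := fp e e0; exists p => //.
have mp := Pol_meas pp.
suff <- : nsq (fun x => f x - p x) = nsq (fun x => g x - p x) by [].
rewrite /ip /Rintegral; congr fine; apply: ae_eq_integral => //.
- apply/measurable_EFinP; apply: measurable_funTS; apply: measurable_funM;
  exact: measurable_funB.
- apply/measurable_EFinP; apply: measurable_funTS; apply: measurable_funM;
  exact: measurable_funB.
- by apply: filterS fg => x h Dx; rewrite h.
Qed.

(** Superlevel sets: apply [step_poly n] to an affine image of [h] with values in
    [[0, 1]] that is below one half exactly where [c < h]. *)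
Lemma approximable_gt h c : approximable h -> approximable (\1_[set x | c < h x]).
Proof.
move=> ah; have [mh [M hM] _] := ah.
pose K := `|M| + `|c| + 1.
have K0 : 0 < K by rewrite ltr_wpDl// addr_ge0.
pose y x := (1 / 2 + c / (4 * K)) * cst 1 x + (- (4 * K)^-1) * h x.
have ay : approximable y by apply: approximableD; apply: approximableZ => //; exact: approximable1.
have yE x : y x = 1 / 2 + (c - h x) / (4 * K) by rewrite /y /cst; ring.
have hK x : `|c - h x| <= K.
  have := ler_normB c (h x); have := hM x; have := ler_norm M; rewrite /K; lra.
have K4 : 0 < 4 * K by rewrite mulr_gt0.
have y01 x : 0 <= y x <= 1.
  rewrite yE; have := hK x; rewrite ler_norml => /andP[h1 h2].
  have q1 : - 4^-1 <= (c - h x) / (4 * K) by rewrite ler_pdivlMr//; lra.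
  have q2 : (c - h x) / (4 * K) <= 4^-1 by rewrite ler_pdivrMr//; lra.
  by apply/andP; split; lra.
apply: (@approximable_lim (fun n x => step_poly n (y x)) _ 1).
- move=> n; apply: approximableX; apply: approximableB; first exact: approximable1.
  exact: approximableX.
- by move=> n x; have /andP[s0 s1] := step_poly_bound n (y01 x); rewrite ger0_norm.
- move=> x; have := step_poly_cvg (y01 x).
  suff -> : (y x < 1 / 2) = (x \in [set x | c < h x]) by rewrite indicE.
  rewrite yE gtrDl pmulr_llt0 ?invr_gt0// subr_lt0.
  by apply/idP/idP; rewrite inE.
Qed.

Lemma approximable_sigma_algebra :
  sigma_algebra setT [set A | measurable A /\ approximable (\1_A : T -> R)].
Proof.
have ind_fun A (f : T -> R) : (forall x, \1_A x = f x) -> approximable f -> approximable (\1_A : T -> R).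
  by move=> h; rewrite (_ : \1_A = f)//; exact/funext.
split.
- split; first exact: measurable0.
  apply: (@ind_fun set0 (fun x => 0 * cst 1 x)).
    by move=> x; rewrite indicE in_set0 mul0r.
  by apply: approximableZ; exact: approximable1.
- move=> A [mA aA]; split; first by apply: measurableD.
  apply: (@ind_fun _ (fun x => cst 1 x - \1_A x)).
    by move=> x; rewrite setTD !indicE in_setC /cst; case: (x \in A); rewrite /= ?subr0 ?subrr.
  by apply: approximableB => //; exact: approximable1.
- move=> F mF; split; first by apply: bigcup_measurable => n _; case: (mF n).
  pose g n x := \prod_(i < n) (cst 1 x - \1_(F i) x : R).
  have ag n : approximable (g n).
    elim: n => [|n IH].
      by rewrite /g; under eq_fun do rewrite big_ord0; exact: approximable1.
    rewrite /g; under eq_fun do rewrite big_ord_recr.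
    apply: approximableM => //; apply: approximableB; first exact: approximable1.
    by case: (mF n).
  have gE n x : g n x = (x \notin \bigcup_(i in [set i | (i < n)%N]) F i)%:R.
    rewrite /g; have [/existsP[i xi]|/existsPn xi] := boolP [exists i : 'I_n, x \in F i].
      rewrite (bigD1 i)//= indicE xi subrr mul0r.
      rewrite mem_set//; exists i => //=; exact: set_mem.
    rewrite big1; last by move=> i _; rewrite indicE (negbTE (xi i)) subr0.
    rewrite memNset// => -[i /= ni Fi].
    by have := xi (Ordinal ni); rewrite mem_set.
  apply: (@approximable_lim (fun n x => cst 1 x - g n x) _ 1).
  + by move=> n; apply: approximableB => //; exact: approximable1.
  + by move=> n x; rewrite gE; case: (_ \notin _) => /=; rewrite /cst ?subrr ?subr0 ?normr0 ?normr1.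
  + move=> x; rewrite indicE.
    have [xU|xU] := boolP (x \in \bigcup_k F k).
      move: xU; rewrite inE => -[k _ Fk].
      apply: cvg_near_cst; exists k.+1 => // n /= kn.
      by rewrite gE mem_set/= ?subr0//; exists k.
    apply: cvg_near_cst; apply: nearW => n.
    rewrite gE memNset/= ?subrr// => -[i _ Fi].
    by move: xU; rewrite mem_set//; exists i.
Qed.

Hypothesis approx_meas : forall A : set T, measurable A -> approximable (\1_A : T -> R).

Import HBNNSimple.

Lemma nnsfun_approximable (h : {nnsfun T >-> R}) : approximable h.
Proof.
have [s ->] : exists s : seq R,
    (h : T -> R) = (fun x => \sum_(y <- s) y * \1_(h @^-1` [set y]) x).
  by eexists; apply/funext => x; rewrite fimfunE fsbig_finite.
elim: s => [|y s IH].
  under eq_fun do rewrite big_nil; rewrite (_ : (fun=> 0) = (fun x => 0 * cst 1 x)).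
    by apply: approximableZ; exact: approximable1.
  by apply/funext => x; rewrite mul0r.
under eq_fun do rewrite big_cons; apply: approximableD => //.
by apply: approximableZ; apply: approx_meas; exact: measurable_funPTI.
Qed.

Let dense_ge0 f e : sq f -> (forall x, D x -> 0 <= f x) -> 0 < e ->
  exists2 p, Pol p & nsq (fun x => f x - p x) < e.
Proof.
move=> f2 f0 e0; have [mf _] := f2.
have mfE : measurable_fun D (EFin \o f) by exact/measurable_EFinP.
pose h := nnsfun_approx mD mfE.
have f0E x : D x -> (0 <= (EFin \o f) x)%E by move=> Dx; rewrite lee_fin; exact: f0.
have hcv x : D x -> h n x @[n --> \oo] --> f x.
  by move=> Dx; have := cvg_nnsfun_approx mD mfE f0E Dx; exact: fine_cvg.
have hle n x : D x -> h n x <= f x.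
  move=> Dx; have := hcv x Dx => cv.
  rewrite -(cvg_lim (@Rhausdorff R) cv); apply: (@nondecreasing_cvgn_le _ (fun n => h n x)).
    by move=> a b ab; have /lefP := nd_nnsfun_approx mD mfE ab; apply.
  exact: (cvgP _ cv).
have cv0 : nsq (fun x => f x - h n x) @[n --> \oo] --> (0 : R).
  apply: (@nsq_dominated_cvg (fun n => h n) f f) => //.
    by move=> n; exact: measurable_funTS.
  move=> n x Dx; rewrite ger0_norm ?subr_ge0 ?hle//.
  by rewrite gerBl; apply: fun_ge0.
have e4 : 0 < e / 4 by rewrite divr_gt0.
have [n hn] : exists n, nsq (fun x => f x - h n x) < e / 4.
  have /cvgr0Pnorm_lt /(_ _ e4) [n _ hn] := cv0.
  by exists n; apply: le_lt_trans (hn n _) => //=; exact: ler_norm.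
have ah := nnsfun_approximable (h n).
have [_ _ /(_ _ e4) [p pp hp]] := ah.
exists p => //; apply: (le_lt_trans (nsq_dist_le f2 (appr_sq ah) (pol_sq pp))).
lra.
Qed.

(** If the indicator functions of measurable sets are approximable, the algebra
    [Pol] is dense in the square integrable functions. *)
Theorem approximable_dense f (e : R) : sq f -> 0 < e ->
  exists2 p, Pol p & nsq (fun x => f x - p x) < e.
Proof.
move=> f2 e0; have [mf _] := f2.
pose fp x : R := Num.max (f x) 0; pose fn x : R := Num.max (- f x) 0.
have part (g : T -> R) : measurable_fun D g -> (forall x, `|g x| <= `|f x|) -> sq g.
  move=> mg gf; split => //; have [_] := f2; apply: le_lt_trans.
  apply: ge0_le_integral => //.
  - by move=> x _; rewrite lee_fin sqr_ge0.
  - by apply/measurable_EFinP; exact: measurable_funX.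
  - by apply/measurable_EFinP; exact: measurable_funX.
  - move=> x Dx; rewrite lee_fin -real_normK ?num_real// -[leRHS]real_normK ?num_real//.
    by rewrite ler_pXn2r ?nnegrE.
have fp2 : sq fp.
  apply: part; first by apply: measurable_maxr.
  by move=> x; rewrite /fp; case: (leP (f x) 0) => h; rewrite ?normr0.
have fn2 : sq fn.
  apply: part; first by apply: measurable_maxr => //; apply: measurable_funN.
  by move=> x; rewrite /fn; case: (leP (- f x) 0) => h; rewrite ?normr0 ?normrN.
have max0 (y : R) : 0 <= Num.max y 0 by rewrite le_max lexx orbT.
have e4 : 0 < e / 4 by rewrite divr_gt0.
have [p pp hp] := dense_ge0 fp2 (fun x _ => max0 _) e4.
have [q pq hq] := dense_ge0 fn2 (fun x _ => max0 _) e4.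
exists (fun x => p x + (-1) * q x); first by apply: PolD => //; exact: PolZ.
have -> : (fun x => f x - (p x + (-1) * q x)) = (fun x => (fp x - p x) + (-1) * (fn x - q x)).
  apply/funext => x; have -> : f x = fp x - fn x.
    by rewrite /fp /fn; case: (leP (f x) 0); case: (leP (- f x) 0); lra.
  ring.
have fnq2 := sqintB mD fn2 (pol_sq pq).
apply: (le_lt_trans (ip_add_le mD (sqintB mD fp2 (pol_sq pp)) (sqintZ mD (-1) fnq2))).
rewrite ipZl ?ipZr//; last exact: sqintZ.
lra.
Qed.

End density.

(** * Trigonometric polynomials on the torus *)

Section torus_trig.
Context {R : realType}.
Local Notation R2 := (measurableTypeR R * measurableTypeR R)%type.
Local Notation mu2 := (@lebesgue_measure R \x @lebesgue_measure R)%E.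
Local Notation D := (torus : set R2).
Local Notation tp := (2 * pi : R).

Let pi_gt0 : 0 < pi :> R. Proof. exact: trigo.pi_gt0. Qed.

Lemma measurable_torus : measurable D.
Proof. by apply: measurableX; exact: measurable_itv. Qed.

Lemma lebesgue_torus_side : lebesgue_measure (`[0, 2 * pi]%classic : set R) = tp%:E.
Proof.
by rewrite lebesgue_measure_itv /= lte_fin mulr_gt0// oppr0 adde0.
Qed.

Lemma measure_torus : mu2 D = (tp ^+ 2)%:E.
Proof.
by rewrite /torus product_measure1E//= !lebesgue_torus_side -EFinM expr2.
Qed.

Lemma measure_torus_fin : (mu2 D < +oo)%E.
Proof. by rewrite measure_torus ltry. Qed.

(** The phase [k . x]. *)
Definition phase (k : int * int) (x : R * R) : R := k.1%:~R * x.1 + k.2%:~R * x.2.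

(** The real modes of frequency [k]. *)
Definition tcos k (x : R * R) : R := cos (phase k x).
Definition tsin k (x : R * R) : R := sin (phase k x).

(** Real trigonometric polynomials. *)
Inductive trigpol : (R * R -> R) -> Prop :=
| trigpol_cos k : trigpol (tcos k)
| trigpol_sin k : trigpol (tsin k)
| trigpolD p q : trigpol p -> trigpol q -> trigpol (fun x => p x + q x)
| trigpolZ c p : trigpol p -> trigpol (fun x => c * p x).

(** Addition and opposite of frequencies. *)
Definition addk (k l : int * int) : int * int := (k.1 + l.1, k.2 + l.2).
Definition oppk (k : int * int) : int * int := (- k.1, - k.2).

Lemma phaseD k l x : phase (addk k l) x = phase k x + phase l x.
Proof. by rewrite /phase /= !intrD; ring. Qed.

Lemma phaseN k x : phase (oppk k) x = - phase k x.
Proof. by rewrite /phase /= !mulrNz; ring. Qed.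

Lemma phase0 x : phase (0, 0) x = 0.
Proof. by rewrite /phase /= !mul0r addr0. Qed.

Lemma measurable_phase k : measurable_fun [set: R2] (phase k).
Proof.
by apply: measurable_funD; apply: measurable_funM.
Qed.

Lemma trigpol_measurable p : trigpol p -> measurable_fun [set: R2] p.
Proof.
elim=> [k|k|p' q _ mp _ mq|c q _ mq].
- apply: measurableT_comp; last exact: measurable_phase.
  by apply: continuous_measurable_fun; exact: continuous_cos.
- apply: measurableT_comp; last exact: measurable_phase.
  by apply: continuous_measurable_fun; exact: continuous_sin.
- exact: measurable_funD.
- exact: measurable_funM.
Qed.

Lemma trigpol_bounded p : trigpol p -> exists M, forall x, `|p x| <= M.
Proof.
elim=> [k|k|p' q _ [M hM] _ [N hN]|c q _ [M hM]].
- by exists 1 => x; exact: cos_max.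
- by exists 1 => x; exact: sin_max.
- by exists (M + N) => x; rewrite (le_trans (ler_normD _ _))// lerD.
- by exists (`|c| * M) => x; rewrite normrM ler_wpM2l.
Qed.

Lemma trigpol1 : trigpol (cst 1).
Proof.
rewrite (_ : cst 1 = tcos (0, 0)); first exact: trigpol_cos.
by apply/funext => x; rewrite /tcos phase0 cos0.
Qed.

Lemma trigpol_eq p q : trigpol p -> (forall x, p x = q x) -> trigpol q.
Proof. by move=> tp0 /funext <-. Qed.

Lemma trigpolM p q : trigpol p -> trigpol q -> trigpol (fun x => p x * q x).
Proof.
have cosBE k l x : cos (phase (addk k (oppk l)) x) =
    cos (phase k x) * cos (phase l x) + sin (phase k x) * sin (phase l x).
  by rewrite phaseD phaseN cosB.
have sinBE k l x : sin (phase (addk k (oppk l)) x) =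
    sin (phase k x) * cos (phase l x) - cos (phase k x) * sin (phase l x).
  by rewrite phaseD phaseN sinB.
have cosDE k l x : cos (phase (addk k l) x) =
    cos (phase k x) * cos (phase l x) - sin (phase k x) * sin (phase l x).
  by rewrite phaseD cosD.
have sinDE k l x : sin (phase (addk k l) x) =
    sin (phase k x) * cos (phase l x) + cos (phase k x) * sin (phase l x).
  by rewrite phaseD sinD.
pose C := trigpol_cos; pose S := trigpol_sin.
move=> tp0; elim: tp0 q => [k|k|p1 p2 _ h1 _ h2|c p1 _ h1] q tq; last 2 first.
- by apply: (trigpol_eq (trigpolD (h1 q tq) (h2 q tq))) => x; ring.
- by apply: (trigpol_eq (trigpolZ c (h1 q tq))) => x; ring.
- elim: tq => [l|l|q1 q2 _ h1 _ h2|c q1 _ h1].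
  + apply: (trigpol_eq (trigpolD (trigpolZ 2^-1 (C (addk k l))) (trigpolZ 2^-1 (C (addk k (oppk l)))))) => x.
    by rewrite /= /tcos cosDE cosBE; field.
  + apply: (trigpol_eq (trigpolD (trigpolZ 2^-1 (S (addk k l))) (trigpolZ (- 2^-1) (S (addk k (oppk l)))))) => x.
    by rewrite /= /tcos /tsin sinDE sinBE; field.
  + by apply: (trigpol_eq (trigpolD h1 h2)) => x; ring.
  + by apply: (trigpol_eq (trigpolZ c h1)) => x; ring.
- elim: tq => [l|l|q1 q2 _ h1 _ h2|c q1 _ h1].
  + apply: (trigpol_eq (trigpolD (trigpolZ 2^-1 (S (addk k l))) (trigpolZ 2^-1 (S (addk k (oppk l)))))) => x.
    by rewrite /= /tcos /tsin sinDE sinBE; field.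
  + apply: (trigpol_eq (trigpolD (trigpolZ 2^-1 (C (addk k (oppk l)))) (trigpolZ (- 2^-1) (C (addk k l))))) => x.
    by rewrite /= /tcos /tsin cosBE cosDE; field.
  + by apply: (trigpol_eq (trigpolD h1 h2)) => x; ring.
  + by apply: (trigpol_eq (trigpolZ c h1)) => x; ring.
Qed.

Local Notation appr := (approximable mu2 D trigpol).

(** The arc of the circle between the angles [0] and [a] is a superlevel set of a
    trigonometric polynomial of degree one. *)
Lemma cos_arc (a x : R) : 0 < a <= tp -> 0 <= x <= tp -> x != 0 ->
  (cos (a / 2) < cos (x - a / 2)) = (x < a).
Proof.
move=> /andP[a0 a2] /andP[x0 x2] xN.
have xp : 0 < x by rewrite lt_def xN.
have c_in : a / 2 \in `[0, (pi : R)] by rewrite in_itv /=; apply/andP; split; lra.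
have [le_pi|gt_pi] := leP `|x - a / 2| pi.
  rewrite -(cos_norm (x - a / 2)) ltr_cos//; last by rewrite in_itv /= normr_ge0.
  by rewrite ltr_norml; apply/andP/idP => [[_]|h]; [lra|split; lra].
have gt_pi' : pi < x - a / 2.
  by move: gt_pi; case: (ger0P (x - a / 2)) => //; lra.
have -> : cos (x - a / 2) = cos (2 * pi - (x - a / 2)).
  rewrite -(cosN (2 * pi - _)) -(cosD2pi (- (2 * pi - (x - a / 2)))).
  by congr cos; rewrite mulr2n; ring.
rewrite ltr_cos//; last by rewrite in_itv /=; apply/andP; split; lra.
by apply/idP/idP; lra.
Qed.

(** The edges [x_i = 0] of the fundamental square are negligible: there the
    description of arcs by [cos_arc] fails. *)
Lemma ae_torus_neq0 : {ae mu2, forall x : R2, x.1 != 0 /\ x.2 != 0}.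
Proof.
have z1 : mu2 ([set 0 : R] `*` [set: R]) = 0%E.
  by rewrite product_measure1E//= lebesgue_measure_set1 mul0e.
have z2 : mu2 ([set: R] `*` [set 0 : R]) = 0%E.
  by rewrite product_measure1E//= lebesgue_measure_set1 mule0.
exists (([set 0 : R] `*` [set: R]) `|` ([set: R] `*` [set 0 : R])); split.
- by apply: measurableU; apply: measurableX.
- apply/eqP; rewrite eq_le measure_ge0 andbT.
  have m1 : measurable ([set 0] `*` [set: R] : set R2) by exact: measurableX.
  have m2 : measurable ([set: R] `*` [set 0] : set R2) by exact: measurableX.
  apply: (le_trans (measureU2 mu2 m1 m2)).
  by rewrite [X in (X + _)%E]z1 [X in (_ + X)%E]z2 adde0.
- move=> [x y] /= /not_andP[] /negP; rewrite negbK => /eqP ->; [left|right] => //.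
Qed.

Let indic_le1 (A : set R2) x : `|\1_A x : R| <= 1.
Proof. by rewrite indicE; case: (_ \in _); rewrite ?normr1 ?normr0. Qed.

Let apprD f g : appr f -> appr g -> appr (fun x => f x + g x).
Proof.
by apply: (approximableD measurable_torus measure_torus_fin trigpol_measurable
  trigpol_bounded) => *; exact: trigpolD.
Qed.

Let apprM f g : appr f -> appr g -> appr (fun x => f x * g x).
Proof.
by apply: (approximableM measurable_torus measure_torus_fin trigpol_measurable
  trigpol_bounded) => *; exact: trigpolM.
Qed.

Let apprZ c f : appr f -> appr (fun x => c * f x).
Proof.
by apply: (approximableZ measurable_torus measure_torus_fin trigpol_measurable
  trigpol_bounded) => *; exact: trigpolZ.
Qed.

Let appr_pol p : trigpol p -> appr p.
Proof. exact: (approximable_pol _ measurable_torus trigpol_measurable trigpol_bounded). Qed.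

Let appr_gt h c : appr h -> appr (\1_[set x | c < h x]).
Proof.
exact: (approximable_gt measurable_torus measure_torus_fin trigpol_measurable
  trigpol_bounded trigpol1 trigpolD trigpolZ trigpolM).
Qed.

Let appr_sigma : sigma_algebra setT [set A : set R2 | measurable A /\ appr (\1_A : R2 -> R)].
Proof.
exact: (approximable_sigma_algebra measurable_torus measure_torus_fin trigpol_measurable
  trigpol_bounded trigpol1 trigpolD trigpolZ trigpolM).
Qed.

Section coordinate.
Variable u : R2 -> R.
Hypotheses (mu_ : measurable_fun setT u)
  (uC : trigpol (fun x => cos (u x))) (uS : trigpol (fun x => sin (u x)))
  (u_in : forall x, D x -> 0 <= u x <= tp)
  (u_ae : {ae mu2, forall x, u x != 0}).

Let good_ray a : measurable (u @^-1` `[a, +oo[) /\ appr (\1_(u @^-1` `[a, +oo[) : R2 -> R).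
Proof.
have mA : measurable (u @^-1` `[a, +oo[).
  by rewrite -[_ @^-1` _]setTI; exact: (mu_ measurableT (measurable_itv _)).
split => //.
have ae_case (g : R2 -> R) : appr g ->
    (forall x, D x -> u x != 0 -> g x = \1_(u @^-1` `[a, +oo[) x) ->
    appr (\1_(u @^-1` `[a, +oo[) : R2 -> R).
  move=> ag gE; apply: (approximable_ae measurable_torus trigpol_measurable ag) => //.
  - by exists 1.
  - by apply: filterS u_ae => x ux Dx; exact: gE.
have memE x : \1_(u @^-1` `[a, +oo[) x = (a <= u x)%R%:R :> R.
  rewrite indicE; congr (nat_of_bool _)%:R.
  by apply/idP/idP; rewrite inE /= in_itv /= andbT.
have [a0|a0] := leP a 0.
  apply: (ae_case _ (appr_pol trigpol1)) => x Dx _; rewrite memE.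
  by have /andP[u0 _] := u_in Dx; rewrite (le_trans a0 u0).
have [a2|a2] := leP a tp; last first.
  apply: (ae_case _ (apprZ 0 (appr_pol trigpol1))) => x Dx _; rewrite memE mul0r.
  have /andP[_ u2] := u_in Dx.
  by rewrite leNgt (le_lt_trans u2 a2).
have tc : trigpol (fun x => cos (a / 2) * cos (u x) + sin (a / 2) * sin (u x)).
  by apply: trigpolD; exact: trigpolZ.
apply: (ae_case (fun x => cst 1 x + (-1) *
   \1_[set x | cos (a / 2) < cos (a / 2) * cos (u x) + sin (a / 2) * sin (u x)] x)).
  apply: apprD; first exact: appr_pol trigpol1.
  by apply: apprZ; apply: appr_gt; exact: appr_pol.
move=> x Dx ux; rewrite memE indicE.
have -> : (x \in [set x | cos (a / 2) < cos (a / 2) * cos (u x) + sin (a / 2) * sin (u x)]) = (u x < a).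
  rewrite -(@cos_arc a (u x)) ?a0 ?u_in//.
  have -> : cos (u x - a / 2) = cos (a / 2) * cos (u x) + sin (a / 2) * sin (u x).
    by rewrite cosB; ring.
  by apply/idP/idP; rewrite inE.
by rewrite leNgt /cst; case: ltP => /= _; rewrite ?mulr1 ?mulr0 ?subrr ?addr0 ?subr0//; ring.
Qed.

(** Sets depending on one coordinate [u]: rays are handled by [cos_arc], and the
    approximable sets form a sigma-algebra. *)
Lemma approximable_coordinate (A : set (measurableTypeR R)) : measurable A ->
  measurable (u @^-1` A) /\ appr (\1_(u @^-1` A) : R2 -> R).
Proof.
have [s0 sC sU] := appr_sigma.
pose G := [set B : set R | measurable (u @^-1` B) /\ appr (\1_(u @^-1` B) : R2 -> R)].
have sG : sigma_algebra setT G.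
  split.
  - by rewrite /G /= preimage_set0; exact: s0.
  - by move=> B GB; exact: (sC _ GB).
  - move=> F GF; rewrite /G /= preimage_bigcup; exact: sU.
move=> mA.
have : (@RGenCInfty.G R).-sigma.-measurable A by rewrite -RGenCInfty.measurableE.
apply: (smallest_sub sG) => _ [a ->].
exact: good_ray.
Qed.

End coordinate.

Lemma approximable_torus (A : set R2) : measurable A -> appr (\1_A : R2 -> R).
Proof.
have tc1 : trigpol (fun x : R * R => cos x.1).
  by apply: (trigpol_eq (trigpol_cos (1, 0))) => x; rewrite /tcos /phase /= mul0r addr0 mul1r.
have ts1 : trigpol (fun x : R * R => sin x.1).
  by apply: (trigpol_eq (trigpol_sin (1, 0))) => x; rewrite /tsin /phase /= mul0r addr0 mul1r.
have tc2 : trigpol (fun x : R * R => cos x.2).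
  by apply: (trigpol_eq (trigpol_cos (0, 1))) => x; rewrite /tcos /phase /= mul0r add0r mul1r.
have ts2 : trigpol (fun x : R * R => sin x.2).
  by apply: (trigpol_eq (trigpol_sin (0, 1))) => x; rewrite /tsin /phase /= mul0r add0r mul1r.
have D1 (x : R2) : D x -> 0 <= x.1 <= tp by case; rewrite /= !in_itv.
have D2 (x : R2) : D x -> 0 <= x.2 <= tp by case; rewrite /= !in_itv.
have a1 : {ae mu2, forall x : R2, x.1 != 0} by apply: filterS ae_torus_neq0 => x [].
have a2 : {ae mu2, forall x : R2, x.2 != 0} by apply: filterS ae_torus_neq0 => x [].
have c1 := @approximable_coordinate fst measurable_fst tc1 ts1 D1 a1.
have c2 := @approximable_coordinate snd measurable_snd tc2 ts2 D2 a2.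
rewrite measurable_prod_measurableType => mA.
suff : [set A : set R2 | measurable A /\ appr (\1_A : R2 -> R)] A by case.
apply: (smallest_sub appr_sigma) mA => _ [A1 mA1 [A2 mA2 <-]].
split; first exact: measurableX.
rewrite (_ : (\1_(A1 `*` A2) : R2 -> R) =
  (fun x => \1_(fst @^-1` A1) x * \1_(snd @^-1` A2) x)).
  by apply: apprM; [case: (c1 _ mA1)|case: (c2 _ mA2)].
apply/funext => x; rewrite !indicE -natrM mulnb; congr (nat_of_bool _)%:R.
by apply/idP/andP; rewrite !inE.
Qed.

(** Trigonometric polynomials are dense in the square integrable functions on
    the torus. *)
Theorem trigpol_dense (f : R * R -> R) (e : R) : sqint mu2 D f -> 0 < e ->
  exists2 p, trigpol p & ip mu2 D (fun x => f x - p x) (fun x => f x - p x) < e.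
Proof.
apply: (approximable_dense measurable_torus measure_torus_fin trigpol_measurable
  trigpol_bounded trigpol1 trigpolD trigpolZ).
exact: approximable_torus.
Qed.

End torus_trig.

(** * Orthogonality of the modes and Parseval's inequality *)

Section trig_orthogonality.
Context {R : realType}.
Local Notation R2 := (measurableTypeR R * measurableTypeR R)%type.
Local Notation mu := (@lebesgue_measure R).
Local Notation mu2 := (@lebesgue_measure R \x @lebesgue_measure R)%E.
Local Notation D := (torus : set R2).
Local Notation tp := (2 * pi : R).
Local Notation ip2 := (ip mu2 D).

Let tp0 : 0 < tp. Proof. by rewrite mulr_gt0// pi_gt0. Qed.

Lemma cos_sin_int_2pi (n : int) : cos (n%:~R * tp) = 1 /\ sin (n%:~R * tp) = 0.
Proof.
have nat_case (m : nat) : cos (m%:R * tp) = 1 /\ sin (m%:R * tp) = 0.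
  elim: m => [|m [c s]]; first by rewrite mul0r cos0 sin0.
  have -> : m.+1%:R * tp = m%:R * tp + pi *+ 2 by rewrite -natr1 mulr2n; ring.
  by rewrite cosD2pi sinD2pi.
case: n => m; first exact: nat_case.
have [c s] := nat_case m.+1.
by rewrite NegzE mulrNz mulNr cosN sinN c s oppr0.
Qed.

Lemma integral_cos_int (n : int) :
  \int[mu]_(x in `[0, tp]) cos (n%:~R * x) = (n == 0)%:R * tp.
Proof.
have [->|n0] := eqVneq n 0.
  under eq_Rintegral do rewrite mul0r cos0.
  by rewrite Rintegral_cst//= lebesgue_torus_side.
rewrite mul0r; set a : R := n%:~R; have a0 : a != 0 by rewrite intr_eq0.
have dF (x : R) : is_derive x (1 : R) (fun x => a^-1 * sin (a * x)) (cos (a * x)).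
  have h1 : is_derive x (1 : R) (fun x => a * x) a.
    have := is_deriveZ a (is_derive_id x (1 : R)); rewrite /GRing.scale /= mulr1.
    by [].
  have h2 := is_deriveZ a^-1 (is_derive1_comp (is_derive_sin (a * x)) h1).
  by apply: (is_derive_eq h2); rewrite /GRing.scale /=; field.
rewrite /Rintegral (@continuous_FTC2 R _ (fun x => a^-1 * sin (a * x)))//.
- by rewrite mulr0 sin0 (cos_sin_int_2pi n).2 mulr0 subee.
- apply: continuous_subspaceT => x; apply: continuous_comp; last exact: continuous_cos.
  by apply: cvgM; [exact: cvg_cst|exact: cvg_id].
- have cF : continuous (fun x => a^-1 * sin (a * x)).
    move=> x; apply/differentiable_continuous/derivable1_diffP.
    exact: (@ex_derive _ _ _ _ _ _ _ (dF x)).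
  split; first by move=> x _; exact: (@ex_derive _ _ _ _ _ _ _ (dF x)).
  + exact/cvg_at_right_filter/cF.
  + exact/cvg_at_left_filter/cF.
- by move=> x _; rewrite derive1E; exact: (@derive_val _ _ _ _ _ _ _ (dF x)).
Qed.

Lemma integral_sin_int (n : int) : \int[mu]_(x in `[0, tp]) sin (n%:~R * x) = 0.
Proof.
have [->|n0] := eqVneq n 0.
  under eq_Rintegral do rewrite mul0r sin0.
  by rewrite Rintegral_cst//= mul0r.
set a : R := n%:~R; have a0 : a != 0 by rewrite intr_eq0.
have dF (x : R) : is_derive x (1 : R) (fun x => - a^-1 * cos (a * x)) (sin (a * x)).
  have h1 : is_derive x (1 : R) (fun x => a * x) a.
    have := is_deriveZ a (is_derive_id x (1 : R)); rewrite /GRing.scale /= mulr1.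
    by [].
  have h2 := is_deriveZ (- a^-1) (is_derive1_comp (is_derive_cos (a * x)) h1).
  by apply: (is_derive_eq h2); rewrite /GRing.scale /=; field.
rewrite /Rintegral (@continuous_FTC2 R _ (fun x => - a^-1 * cos (a * x)))//.
- by rewrite mulr0 cos0 (cos_sin_int_2pi n).1 subee.
- apply: continuous_subspaceT => x; apply: continuous_comp; last exact: continuous_sin.
  by apply: cvgM; [exact: cvg_cst|exact: cvg_id].
- have cF : continuous (fun x => - a^-1 * cos (a * x)).
    move=> x; apply/differentiable_continuous/derivable1_diffP.
    exact: (@ex_derive _ _ _ _ _ _ _ (dF x)).
  split; first by move=> x _; exact: (@ex_derive _ _ _ _ _ _ _ (dF x)).
  + exact/cvg_at_right_filter/cF.
  + exact/cvg_at_left_filter/cF.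
- by move=> x _; rewrite derive1E; exact: (@derive_val _ _ _ _ _ _ _ (dF x)).
Qed.

Lemma sqint_torus_bounded (f : R2 -> R) M : measurable_fun [set: R2] f ->
  (forall x, `|f x| <= M) -> sqint mu2 D f.
Proof.
move=> mf fM; apply: (sqint_bounded measurable_torus measure_torus_fin (M := M)) => //.
exact: measurable_funTS.
Qed.

Lemma torus_int_prod (f g : R -> R) (M N : R) :
  measurable_fun [set: R] f -> measurable_fun [set: R] g ->
  (forall x, `|f x| <= M) -> (forall x, `|g x| <= N) ->
  torus_int (fun x => f x.1 * g x.2) =
  (\int[mu]_(x in `[0, tp]) f x) * \int[mu]_(x in `[0, tp]) g x.
Proof.
move=> mf mg fM gN.
have M0 : 0 <= M by exact: le_trans (fM 0).
have N0 : 0 <= N by exact: le_trans (gN 0).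
have mI : measurable (`[0, tp]%classic : set (measurableTypeR R)) by exact: measurable_itv.
have i1 (h : R -> R) K : measurable_fun [set: R] h -> (forall x, `|h x| <= K) ->
    mu.-integrable `[0, tp] (EFin \o h).
  move=> mh hK; apply: (@sqint_Int _ (measurableTypeR R) R mu `[0, tp]%classic mI) => //.
    by rewrite [X in (X < _)%E]lebesgue_torus_side ltry.
  apply: (sqint_bounded mI _ (M := K)) => //.
    by rewrite [X in (X < _)%E]lebesgue_torus_side ltry.
  exact: measurable_funTS.
have if_ := i1 f M mf fM; have ig := i1 g N mg gN.
pose F (z : R2) : R := f z.1 * g z.2.
have mF : measurable_fun [set: R2] F.
  by apply: measurable_funM; apply: measurableT_comp.
have iF : mu2.-integrable D (EFin \o F).
  apply: (sqint_Int measurable_torus measure_torus_fin).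
  apply: (@sqint_torus_bounded _ (M * N)) => // z.
  by rewrite normrM ler_pM.
pose J := fine (\int[mu]_(x in `[0%R, tp]) (g x)%:E)%E.
have gJ : (\int[mu]_(x in `[0%R, tp]) (g x)%:E = J%:E)%E.
  by rewrite /J fineK//; exact: (integrable_fin_num mI ig).
rewrite /torus_int /Rintegral integral_mkcond.
rewrite -(@integral12_prod_meas1 _ _ _ _ R mu mu ((EFin \o F) \_ D)); last first.
  by apply/(integrable_mkcond _ measurable_torus).
have -> : fubini_F mu ((EFin \o F) \_ D) = (fun x => ((EFin \o f) \_ `[0%R, tp]) x * J%:E)%E.
  apply/funext => x; rewrite /fubini_F.
  rewrite [in RHS]patchE; case: ifPn => xI.
    rewrite -gJ -integralZl// [in RHS]integral_mkcond; apply: eq_integral => y _.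
    rewrite !patchE; case: ifPn => [|h].
      rewrite inE => -[_ /= yI]; rewrite mem_set//= EFinM.
    by rewrite ifF//; apply/negbTE; move: h; apply: contra; rewrite !inE => yI; split => //=; exact: set_mem.
  rewrite mul0e; apply: integral0_eq => y _; rewrite patchE ifF//.
  by apply/negbTE; move: xI; apply: contra; rewrite !inE => -[].
have if' : mu.-integrable setT ((EFin \o f) \_ `[0%R, tp]%classic).
  by apply/(integrable_mkcond _ mI).
rewrite integralZr// -integral_mkcond gJ fineM//.
exact: (integrable_fin_num mI if_).
Qed.

Let mcos (a : R) : measurable_fun [set: R] (fun x => cos (a * x)).
Proof.
apply: measurableT_comp; last exact: measurable_funM.
by apply: continuous_measurable_fun; exact: continuous_cos.
Qed.

Let msin (a : R) : measurable_fun [set: R] (fun x => sin (a * x)).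
Proof.
apply: measurableT_comp; last exact: measurable_funM.
by apply: continuous_measurable_fun; exact: continuous_sin.
Qed.

Let trigprod_Int (f g : R -> R) (M N : R) :
  measurable_fun [set: R] f -> measurable_fun [set: R] g ->
  (forall x, `|f x| <= M) -> (forall x, `|g x| <= N) ->
  mu2.-integrable D (EFin \o (fun z : R2 => f z.1 * g z.2)).
Proof.
move=> mf mg fM gN.
have M0 : 0 <= M by exact: le_trans (fM 0).
have N0 : 0 <= N by exact: le_trans (gN 0).
apply: (sqint_Int measurable_torus measure_torus_fin).
apply: (@sqint_torus_bounded _ (M * N)) => [|z].
  by apply: measurable_funM; apply: measurableT_comp.
by rewrite normrM ler_pM.
Qed.

Lemma torus_int_cos k : torus_int (tcos k) = (k == (0, 0))%:R * tp ^+ 2.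
Proof.
have -> : tcos k = (fun x : R * R => cos (k.1%:~R * x.1) * cos (k.2%:~R * x.2)
   - sin (k.1%:~R * x.1) * sin (k.2%:~R * x.2)).
  by apply: funext => x; rewrite /tcos /phase cosD.
have icc := trigprod_Int (mcos k.1%:~R) (mcos k.2%:~R) (fun x => cos_max _) (fun x => cos_max _).
have iss := trigprod_Int (msin k.1%:~R) (msin k.2%:~R) (fun x => sin_max _) (fun x => sin_max _).
rewrite /torus_int RintegralB//; last exact: measurable_torus.
have := torus_int_prod (mcos k.1%:~R) (mcos k.2%:~R) (fun x => cos_max _) (fun x => cos_max _).
rewrite /torus_int => ->.
have := torus_int_prod (msin k.1%:~R) (msin k.2%:~R) (fun x => sin_max _) (fun x => sin_max _).
rewrite /torus_int => ->.
rewrite !integral_cos_int !integral_sin_int mulr0 subr0.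
case: k {icc iss} => a b; rewrite -[(a, b) == _]/((a == 0) && (b == 0)) /=.
by case: (a == 0); case: (b == 0) => /=; ring.
Qed.

Lemma torus_int_sin k : torus_int (@tsin R k) = 0.
Proof.
have -> : tsin k = (fun x : R * R => sin (k.1%:~R * x.1) * cos (k.2%:~R * x.2)
   + cos (k.1%:~R * x.1) * sin (k.2%:~R * x.2)).
  by apply/funext => x; rewrite /tsin /phase sinD.
have isc := trigprod_Int (msin k.1%:~R) (mcos k.2%:~R) (fun x => sin_max _) (fun x => cos_max _).
have ics := trigprod_Int (mcos k.1%:~R) (msin k.2%:~R) (fun x => cos_max _) (fun x => sin_max _).
rewrite /torus_int RintegralD//; last exact: measurable_torus.
have := torus_int_prod (msin k.1%:~R) (mcos k.2%:~R) (fun x => sin_max _) (fun x => cos_max _).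
rewrite /torus_int => ->.
have := torus_int_prod (mcos k.1%:~R) (msin k.2%:~R) (fun x => cos_max _) (fun x => sin_max _).
rewrite /torus_int => ->.
by rewrite !integral_sin_int mulr0 mul0r addr0.
Qed.

Lemma sqint_tcos k : sqint mu2 D (tcos k).
Proof.
apply: (@sqint_torus_bounded _ 1); last by move=> x; exact: cos_max.
exact: (trigpol_measurable (trigpol_cos k)).
Qed.

Lemma sqint_tsin k : sqint mu2 D (tsin k).
Proof.
apply: (@sqint_torus_bounded _ 1); last by move=> x; exact: sin_max.
exact: (trigpol_measurable (trigpol_sin k)).
Qed.

Lemma sqint_trigpol p : trigpol p -> sqint mu2 D p.
Proof.
move=> tp'; have [M pM] := trigpol_bounded tp'.
by apply: (@sqint_torus_bounded _ M) => //; exact: trigpol_measurable.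
Qed.

Let mT := @measurable_torus R.
Let fT := @measure_torus_fin R.

Let intZD (f g h : R * R -> R) (a b : R) : (forall x, h x = a * f x + b * g x) ->
  sqint mu2 D f -> sqint mu2 D g -> torus_int h = a * torus_int f + b * torus_int g.
Proof.
move=> hE f2 g2; rewrite /torus_int (_ : h = (fun x => a * f x + b * g x)); last by apply/funext => x; exact: hE.
have iZ c u : sqint mu2 D u -> mu2.-integrable D (EFin \o (fun x => c * u x)).
  by move=> u2; apply: (sqint_Int mT fT); exact: sqintZ.
rewrite RintegralD//; [|exact: iZ|exact: iZ].
rewrite !RintegralZl//; exact: (sqint_Int mT fT).
Qed.

Let eqk_opp (k l : int * int) : (addk k (oppk l) == (0, 0)) = (k == l).
Proof.
by case: k l => [a b] [c e]; rewrite /addk /oppk /= !xpair_eqE !subr_eq0.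
Qed.

(** The modes of frequencies [k] and [- k] coincide up to sign, hence the second
    term. *)
Lemma ip_cos_cos k l : ip2 (tcos k) (tcos l) =
  2^-1 * ((k == l)%:R + (k == oppk l)%:R) * tp ^+ 2.
Proof.
rewrite -[ip2 _ _]/(torus_int (fun x => tcos k x * tcos l x)).
rewrite (@intZD (tcos (addk k l)) (tcos (addk k (oppk l))) _ 2^-1 2^-1); last 2 first.
- exact: sqint_tcos.
- exact: sqint_tcos.
- rewrite !torus_int_cos eqk_opp.
  have -> : (addk k l == (0, 0)) = (k == oppk l).
    by rewrite -(eqk_opp k (oppk l)) /oppk /= !opprK; case: l.
  ring.
- by move=> x; rewrite /tcos !phaseD phaseN cosD cosB; field.
Qed.

Lemma ip_sin_sin k l : ip2 (tsin k) (tsin l) =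
  2^-1 * ((k == l)%:R - (k == oppk l)%:R) * tp ^+ 2.
Proof.
rewrite -[ip2 _ _]/(torus_int (fun x => tsin k x * tsin l x)).
rewrite (@intZD (tcos (addk k (oppk l))) (tcos (addk k l)) _ 2^-1 (- 2^-1)); last 2 first.
- exact: sqint_tcos.
- exact: sqint_tcos.
- rewrite !torus_int_cos eqk_opp.
  have -> : (addk k l == (0, 0)) = (k == oppk l).
    by rewrite -(eqk_opp k (oppk l)) /oppk /= !opprK; case: l.
  ring.
- by move=> x; rewrite /tcos /tsin !phaseD phaseN cosB cosD; field.
Qed.

Lemma ip_sin_cos k l : ip2 (tsin k) (tcos l) = 0.
Proof.
rewrite -[ip2 _ _]/(torus_int (fun x => tsin k x * tcos l x)).
rewrite (@intZD (tsin (addk k (oppk l))) (tsin (addk k l)) _ 2^-1 2^-1); last 2 first.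
- exact: sqint_tsin.
- exact: sqint_tsin.
- by rewrite !torus_int_sin !mulr0 addr0.
- by move=> x; rewrite /tcos /tsin !phaseD phaseN sinB sinD; field.
Qed.

End trig_orthogonality.

Section parseval.
Context {R : realType}.
Local Notation R2 := (measurableTypeR R * measurableTypeR R)%type.
Local Notation mu2 := (@lebesgue_measure R \x @lebesgue_measure R)%E.
Local Notation D := (torus : set R2).
Local Notation tp := (2 * pi : R).
Local Notation ip2 := (ip mu2 D).
Local Notation sq2 := (sqint mu2 D).

Let tp0 : 0 < tp. Proof. by rewrite mulr_gt0// pi_gt0. Qed.
Let tpN : tp != 0. Proof. by rewrite gt_eqF. Qed.
Let mT := @measurable_torus R.
Let fT := @measure_torus_fin R.

Let ipC2 (u v : R * R -> R) : ip2 u v = ip2 v u. Proof. exact: ipC. Qed.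

Lemma fourier_coef_sqr (f : R * R -> R) k : sq2 f ->
  complex.Re (fourier_coef f k) ^+ 2 + complex.Im (fourier_coef f k) ^+ 2 =
  tp ^- 4 * (ip2 f (tcos k) ^+ 2 + ip2 f (tsin k) ^+ 2).
Proof.
move=> f2.
have -> : fourier_coef f k = (tp ^- 2 * ip2 f (tcos k)) +i* (- (tp ^- 2 * ip2 f (tsin k))).
  rewrite /fourier_coef /pairingC /=.
  have -> : pairing f (fun x => - sin (k.1%:~R * x.1 + k.2%:~R * x.2)) = - ip2 f (tsin k).
    rewrite -mulN1r -(ipZr mT (-1) (sqint_tsin k) f2) /ip.
    rewrite -[pairing _ _]/(ip2 f _) /ip; congr Rintegral; apply: funext => x.
    by rewrite mulN1r.
  rewrite -[pairing _ _]/(ip2 f (tcos k)).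
  by apply/eqP; rewrite eq_complex /=; apply/andP; split; apply/eqP; ring.
rewrite /=; move: (ip2 f (tcos k)) (ip2 f (tsin k)) (tpN) => X Y.
by move: (2 * pi) => p pN; field.
Qed.

Lemma sqint_sum (I : eqType) (s : seq I) (G : I -> R * R -> R) :
  (forall i, sq2 (G i)) -> sq2 (fun x => \sum_(i <- s) G i x).
Proof.
move=> G2; elim: s => [|i s IH].
  by under eq_fun do rewrite big_nil; exact: (sqint_cst mT fT).
by under eq_fun do rewrite big_cons; exact: (sqintD mT).
Qed.

Lemma ip_sum (I : eqType) (s : seq I) (G : I -> R * R -> R) h :
  (forall i, sq2 (G i)) -> sq2 h ->
  ip2 (fun x => \sum_(i <- s) G i x) h = \sum_(i <- s) ip2 (G i) h.
Proof.
move=> G2 h2; elim: s => [|i s IH].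
  rewrite big_nil; under eq_fun do rewrite big_nil.
  rewrite /ip; under eq_Rintegral do rewrite mul0r.
  by rewrite Rintegral_cst ?mul0r//; exact: mT.
rewrite big_cons -IH; under [X in ip _ _ X]eq_fun do rewrite big_cons.
by rewrite (ipDl mT)//; exact: sqint_sum.
Qed.

(** A trigonometric polynomial is a combination of finitely many modes, in dual
    form: what is orthogonal to these modes is orthogonal to it. *)
Lemma trigpol_modes p : trigpol p -> exists K : seq (int * int), forall F, sq2 F ->
  (forall k, k \in K -> ip2 F (tcos k) = 0 /\ ip2 F (tsin k) = 0) -> ip2 F p = 0.
Proof.
elim=> [k|k|q r tq [K hK] tr [L hL]|c q tq [K hK]].
- by exists [:: k] => F F2 h; have [] := h k (mem_head _ _).
- by exists [:: k] => F F2 h; have [] := h k (mem_head _ _).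
- exists (K ++ L) => F F2 h.
  rewrite (ipDr mT)//; try exact: sqint_trigpol.
  rewrite hK ?hL ?addr0// => k kK; apply: h; rewrite mem_cat kK ?orbT//.
- exists K => F F2 h; rewrite (ipZr mT)//; last exact: sqint_trigpol.
  by rewrite hK ?mulr0.
Qed.

Let sum_delta (K : seq (int * int)) (a : int * int -> R) l : uniq K -> l \in K ->
  \sum_(k <- K) a k * (k == l)%:R = a l.
Proof.
move=> uK lK; rewrite (bigD1_seq l)//= eqxx mulr1 big1 ?addr0//.
by move=> k /negbTE ->; rewrite mulr0.
Qed.

Lemma oppkK k : oppk (oppk k) = k.
Proof. by case: k => a b; rewrite /oppk /= !opprK. Qed.

(** Up to [e], the squared norm of [f] is the one of its projection on finitely many
    modes. *)
Lemma bessel_approx (f : R * R -> R) (e : R) : sq2 f -> 0 < e ->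
  exists2 K : seq (int * int), uniq K &
  ip2 f f <= e + tp ^- 2 * \sum_(k <- K) (ip2 f (tcos k) ^+ 2 + ip2 f (tsin k) ^+ 2).
Proof.
move=> f2 e0; have [q tq hq] := trigpol_dense f2 e0.
have q2 := sqint_trigpol tq; have [K0 hK0] := trigpol_modes tq.
pose K := undup (K0 ++ map oppk K0).
have uK : uniq K by exact: undup_uniq.
(* [K] is symmetric, and each mode occurs twice in the projection [Pf] below: for
   [k] and for [- k]. This is why the coefficients carry no factor two. *)
have symK l : l \in K -> oppk l \in K.
  rewrite !mem_undup !mem_cat => /orP[lK|/mapP[k kK ->]].
    by rewrite map_f ?orbT.
  by rewrite oppkK kK.
pose c := tp ^- 2.
pose a k := c * ip2 f (tcos k); pose b k := c * ip2 f (tsin k).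
pose G k x := a k * tcos k x + b k * tsin k x.
pose Pf x := \sum_(k <- K) G k x.
have G2 k : sq2 (G k).
  apply: (sqintD mT); apply: (sqintZ mT); [exact: sqint_tcos|exact: sqint_tsin].
have P2 : sq2 Pf by exact: sqint_sum.
have GE k h : sq2 h -> ip2 (G k) h = a k * ip2 (tcos k) h + b k * ip2 (tsin k) h.
  move=> h2; have c2 := @sqint_tcos R k; have s2 := @sqint_tsin R k.
  have ca2 : sq2 (fun x => a k * tcos k x) by exact: (sqintZ mT (a k) c2).
  have sb2 : sq2 (fun x => b k * tsin k x) by exact: (sqintZ mT (b k) s2).
  apply: (etrans (ipDl mT ca2 sb2 h2)).
  by rewrite (ipZl mT (a k) c2 h2) (ipZl mT (b k) s2 h2).
have cosN l : tcos (oppk l) = tcos l :> (R * R -> R).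
  by apply: funext => x; rewrite /tcos phaseN cosN.
have sinNE l : ip2 f (tsin (oppk l)) = - ip2 f (tsin l).
  rewrite -mulN1r -(ipZr mT (-1) (sqint_tsin l) f2); congr ip; apply: funext => x.
  by rewrite /tsin phaseN sinN mulN1r.
have eqo k l : (k == oppk l) = (k == oppk l) by [].
have Pcos l : l \in K -> ip2 Pf (tcos l) = ip2 f (tcos l).
  move=> lK; rewrite (ip_sum _ G2 (sqint_tcos l)).
  under eq_bigr => k _ do rewrite (GE _ _ (sqint_tcos l)) ip_cos_cos ip_sin_cos mulr0 addr0.
  have -> : \sum_(k <- K) a k * (2^-1 * ((k == l)%:R + (k == oppk l)%:R) * tp ^+ 2) =
    2^-1 * tp ^+ 2 * (\sum_(k <- K) a k * (k == l)%:R + \sum_(k <- K) a k * (k == oppk l)%:R).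
    by rewrite -big_split /= mulr_sumr; apply: eq_bigr => k _; ring.
  rewrite !sum_delta//; last exact: symK.
  rewrite /a cosN /c; move: (ip2 f _) (tpN) => X.
  by move: (2 * pi) => p pN; field.
have Psin l : l \in K -> ip2 Pf (tsin l) = ip2 f (tsin l).
  move=> lK; rewrite (ip_sum _ G2 (sqint_tsin l)).
  under eq_bigr => k _ do rewrite (GE _ _ (sqint_tsin l)) ip_sin_sin (ipC2 (tcos k) (tsin l)) ip_sin_cos mulr0 add0r.
  have -> : \sum_(k <- K) b k * (2^-1 * ((k == l)%:R - (k == oppk l)%:R) * tp ^+ 2) =
    2^-1 * tp ^+ 2 * (\sum_(k <- K) b k * (k == l)%:R - \sum_(k <- K) b k * (k == oppk l)%:R).
    by rewrite -sumrB mulr_sumr; apply: eq_bigr => k _; ring.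
  rewrite !sum_delta//; last exact: symK.
  rewrite /b sinNE /c; move: (ip2 f _) (tpN) => X.
  by move: (2 * pi) => p pN; field.
pose F x := f x - Pf x.
have F2 : sq2 F by exact: (sqintB mT).
have Forth l : l \in K -> ip2 F (tcos l) = 0 /\ ip2 F (tsin l) = 0.
  move=> lK; rewrite (ipBl mT f2 P2 (sqint_tcos l)) (ipBl mT f2 P2 (sqint_tsin l)).
  by rewrite Pcos// Psin// !subrr.
have Fq : ip2 F q = 0.
  by apply: hK0 => // k kK; apply: Forth; rewrite mem_undup mem_cat kK.
have FP : ip2 F Pf = 0.
  rewrite ipC2 (ip_sum _ G2 F2) big_seq big1// => k kK.
  have [h1 h2] := Forth k kK.
  by rewrite (GE _ _ F2) (ipC2 (tcos k) F) (ipC2 (tsin k) F) h1 h2 !mulr0 addr0.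
have FFe : ip2 F F < e.
  apply: le_lt_trans hq.
  have Pq2 := sqintB mT P2 q2.
  have -> : (fun x => f x - q x) = (fun x => F x + (Pf x - q x)).
    by apply: funext => x; rewrite /F; ring.
  rewrite (ip_pythagoras mT F2 Pq2); first by rewrite lerDl; exact: ip_ge0.
  by rewrite (ipBr mT P2 q2 F2) FP Fq subrr.
have PP : ip2 Pf Pf = c * \sum_(k <- K) (ip2 f (tcos k) ^+ 2 + ip2 f (tsin k) ^+ 2).
  have -> : ip2 Pf Pf = ip2 Pf f.
    have : ip2 Pf F = 0 by rewrite ipC2.
    by rewrite (ipBr mT f2 P2 P2) => /eqP; rewrite subr_eq0 => /eqP.
  rewrite (ip_sum _ G2 f2) mulr_sumr; apply: eq_bigr => k _.
  by rewrite (GE _ _ f2) (ipC2 (tcos k) f) (ipC2 (tsin k) f) /a /b; ring.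
exists K => //; rewrite -/c -PP.
have fE : f = (fun x => F x + Pf x) by apply: funext => x; rewrite /F subrK.
rewrite fE (ip_pythagoras mT F2 P2 FP) lerD2r; exact: ltW.
Qed.

(** The nontrivial half of Parseval's identity. *)
Lemma parseval_le (f : R * R -> R) : sq2 f ->
  ((ip2 f f)%:E <= (tp ^+ 2)%:E * \esum_(k in [set: int * int])
     (complex.Re (fourier_coef f k) ^+ 2 + complex.Im (fourier_coef f k) ^+ 2)%:E)%E.
Proof.
move=> f2; set S := esum _ _.
apply/lee_addgt0Pr => e e0.
have [K uK hK] := bessel_approx f2 e0.
have h : ((tp ^- 4 * \sum_(k <- K) (ip2 f (tcos k) ^+ 2 + ip2 f (tsin k) ^+ 2))%:E <= S)%E.
  apply: esum_ge; exists [set` K].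
    by split => //; exact: finite_seq.
  rewrite -(fsbig_seq _ _ uK) mulr_sumr -sumEFin le_eqVlt; apply/orP; left; apply/eqP.
  by apply: eq_bigr => k _; rewrite fourier_coef_sqr.
apply: (@le_trans _ _ ((e + tp ^- 2 * \sum_(k <- K) (ip2 f (tcos k) ^+ 2 + ip2 f (tsin k) ^+ 2))%:E)).
  by rewrite lee_fin.
rewrite EFinD addeC leeD2r//.
have -> : (tp ^- 2 * \sum_(k <- K) (ip2 f (tcos k) ^+ 2 + ip2 f (tsin k) ^+ 2))%:E =
   ((tp ^+ 2)%:E * (tp ^- 4 * \sum_(k <- K) (ip2 f (tcos k) ^+ 2 + ip2 f (tsin k) ^+ 2))%:E)%E.
  rewrite -EFinM; congr EFin; move: (tpN); move: (\sum_(k <- K) _) => X.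
  by move: (2 * pi) => p pN; field.
by apply: lee_wpmul2l => //; rewrite lee_fin sqr_ge0.
Qed.

End parseval.

(** * Modes as test functions *)

Section modes_are_test_functions.
Context {R : realType}.
Local Notation tp := (2 * pi : R).

(** Directional derivatives are derivatives along the line. *)
Lemma is_derive_line (f : R * R -> R) (x v : R * R) (l : R) :
  is_derive (0 : R) (1 : R) (fun h : R => f (h *: v + x)) l -> is_derive x v f l.
Proof.
move=> [dG vG].
have E : (fun h : R => h^-1 *: ((f \o shift x) (h *: v) - f x)) =
  (fun h : R => h^-1 *: (((fun h : R => f (h *: v + x)) \o shift 0) (h *: (1 : R)) -
     (fun h : R => f (h *: v + x)) 0)).
  apply/funext => h; congr (_ *: (_ - _)) => /=.
    by rewrite addr0 /shift /= -[h *: 1 in RHS]/(h * 1) mulr1.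
  by rewrite scale0r add0r.
by split; [rewrite /derivable E; exact: dG|rewrite /derive E; exact: vG].
Qed.

(** The real span of the two modes of frequency [k]. *)
Definition mode (k : int * int) (a b : R) (x : R * R) : R := a * tcos k x + b * tsin k x.

(** The coordinate of the frequency [k] along [basis_dir i]. *)
Definition freq (i : bool) (k : int * int) : R := (if i then k.2 else k.1)%:~R.

Lemma phase_line k i (h : R) (x : R * R) :
  phase k (h *: basis_dir i + x) = freq i k * h + phase k x.
Proof.
have E1 : (h *: basis_dir i + x).1 = h * (basis_dir i).1 + x.1 by [].
have E2 : (h *: basis_dir i + x).2 = h * (basis_dir i).2 + x.2 by [].
by rewrite /phase E1 E2; case: i {E1 E2}; rewrite /freq /=; ring.
Qed.

Lemma is_derive_mode k a b i x :
  is_derive x (basis_dir i) (mode k a b) (mode k (freq i k * b) (- (freq i k * a)) x).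
Proof.
apply: is_derive_line.
have -> : (fun h : R => mode k a b (h *: basis_dir i + x)) =
    (fun h : R => a * cos (freq i k * h + phase k x) + b * sin (freq i k * h + phase k x)).
  by apply/funext => h; rewrite /mode /tcos /tsin phase_line.
set c := freq i k; set p := phase k x.
have h1 : is_derive (0 : R) (1 : R) (fun h : R => c * h + p) c.
  have := is_deriveD (is_deriveZ c (is_derive_id (0 : R) (1 : R))) (is_derive_cst p (0 : R) (1 : R)).
  by rewrite /GRing.scale /= mulr1 addr0.
pose g (h : R) : R := c * h + p.
have hc := is_deriveZ a (@is_derive1_comp _ cos g 0 _ _ (is_derive_cos (g 0)) h1).
have hs := is_deriveZ b (@is_derive1_comp _ sin g 0 _ _ (is_derive_sin (g 0)) h1).
apply: (is_derive_eq (is_deriveD hc hs)).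
by rewrite /g mulr0 add0r /GRing.scale /= /mode /tcos /tsin -/p; ring.
Qed.

Lemma partial_mode k a b i :
  partial i (mode k a b) = mode k (freq i k * b) (- (freq i k * a)).
Proof.
by apply/funext => x; rewrite /partial; exact: (@derive_val _ _ _ _ _ _ _ (is_derive_mode k a b i x)).
Qed.

Lemma continuous_mode k a b : continuous (mode k a b).
Proof.
have cp : continuous (phase k : R * R -> R).
  by move=> x; apply: cvgD; apply: cvgM; (exact: cvg_cst || exact: cvg_fst || exact: cvg_snd).
move=> x; apply: cvgD; apply: cvgM; try exact: cvg_cst.
- by apply: continuous_comp; [exact: cp|exact: continuous_cos].
- by apply: continuous_comp; [exact: cp|exact: continuous_sin].
Qed.

Lemma test_fun_mode k a b : test_fun (mode k a b).
Proof.
split.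
  have c1 (n : int) x y : cos (n%:~R * (x + tp) + y) = cos (n%:~R * x + y) /\
      sin (n%:~R * (x + tp) + y) = sin (n%:~R * x + y).
    have [hc hs] := @cos_sin_int_2pi R n.
    have -> : n%:~R * (x + tp) + y = (n%:~R * x + y) + n%:~R * tp by ring.
    move: (n%:~R * x + y) => z.
    by rewrite (cosD z) (sinD z) hc hs !mulr1 !mulr0 subr0 addr0.
  move=> x1 x2; rewrite /mode /tcos /tsin /phase /=; split.
    by have [-> ->] := c1 k.1 x1 (k.2%:~R * x2).
  rewrite [k.1%:~R * x1 + _]addrC; have [-> ->] := c1 k.2 x2 (k.1%:~R * x1).
  by rewrite [k.2%:~R * x2 + _]addrC.
move=> l /=.
have [a' [b' ->]] : exists a' b', foldr partial (mode k a b) l = mode k a' b'.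
  elim: l => [|i l [a' [b' IH]]]; first by exists a, b.
  by do 2!eexists; rewrite /= IH partial_mode.
split; first exact: continuous_mode.
by move=> i x; exact: (@ex_derive _ _ _ _ _ _ _ (is_derive_mode k a' b' i x)).
Qed.

Lemma modeC k : mode k 1 0 = tcos k.
Proof. by apply/funext => x; rewrite /mode mul1r mul0r addr0. Qed.

Lemma modeS k : mode k 0 1 = tsin k.
Proof. by apply/funext => x; rewrite /mode mul1r mul0r add0r. Qed.

Lemma test_fun_tcos k : test_fun (@tcos R k).
Proof. by rewrite -modeC; exact: test_fun_mode. Qed.

Lemma test_fun_tsin k : test_fun (@tsin R k).
Proof. by rewrite -modeS; exact: test_fun_mode. Qed.

Lemma partial_tcos k i : partial i (tcos k) = (fun x => - freq i k * tsin k x).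
Proof.
rewrite -modeC partial_mode; apply/funext => x.
by rewrite /mode mulr0 mul0r add0r mulr1.
Qed.

Lemma partial_tsin k i : partial i (tsin k) = (fun x => freq i k * tcos k x).
Proof.
rewrite -modeS partial_mode; apply/funext => x.
by rewrite /mode mulr0 oppr0 mul0r addr0 mulr1.
Qed.

End modes_are_test_functions.

(** * Sobolev norms and the Biot--Savart law *)

Section sobolev_bounds.
Context {R : realType}.
Local Notation R2 := (measurableTypeR R * measurableTypeR R)%type.
Local Notation mu2 := (@lebesgue_measure R \x @lebesgue_measure R)%E.
Local Notation D := (torus : set R2).
Local Notation tp := (2 * pi : R).
Local Notation ip2 := (ip mu2 D).
Local Notation sq2 := (sqint mu2 D).

Let tp0 : 0 < tp. Proof. by rewrite mulr_gt0// pi_gt0. Qed.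
Let mT := @measurable_torus R.
Let fT := @measure_torus_fin R.
Let ipC2 (u v : R * R -> R) : ip2 u v = ip2 v u. Proof. exact: ipC. Qed.

Lemma torusL2_sqint (f : R * R -> R) : torusL2 f -> sq2 f.
Proof. by case. Qed.

(** Squared modulus of the Fourier coefficient of frequency [k]. *)
Definition fsqr (f : R * R -> R) (k : int * int) : R :=
  complex.Re (fourier_coef f k) ^+ 2 + complex.Im (fourier_coef f k) ^+ 2.

Lemma fsqr_ge0 f k : 0 <= fsqr f k.
Proof. by rewrite addr_ge0 ?sqr_ge0. Qed.

Lemma esum_fsqr_le_Bnorm (f : R * R -> R) (b c : R) : 0 <= b -> 0 <= c ->
  (Bnorm b f <= c%:E)%E ->
  (\esum_(k in [set: int * int]) (fsqr f k)%:E <= (c ^+ 2)%:E)%E.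
Proof.
move=> b0 c0; rewrite /Bnorm /sobolev_norm; set S := esum _ _ => Sc.
have S0 : (0 <= S)%E.
  by apply: esum_ge0 => k _; rewrite lee_fin mulr_ge0 ?powR_ge0 ?fsqr_ge0.
apply: (@le_trans _ _ S).
  apply: le_esum => k _; rewrite lee_fin ler_peMl ?fsqr_ge0//.
  set q := 1 + _ + _; have q1 : 1 <= q by rewrite /q -addrA lerDl addr_ge0 ?sqr_ge0.
  by rewrite -[leLHS](powRr0 q) ler_powR// mulr_ge0.
have -> : S = ((S `^ 2^-1) `^ 2)%E by rewrite -poweRrM mulVf// poweRe1.
have -> : (c ^+ 2)%:E = (c%:E `^ 2)%E by rewrite poweR_EFin powR_mulrn.
by apply: gt0_ler_poweR => //; rewrite in_itv /= ?leey ?andbT ?lee_fin// poweR_ge0.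
Qed.

(** The Sobolev norms of nonnegative index dominate the L^2 norm. *)
Lemma L2_le_Bnorm (f : R * R -> R) (b c : R) : sq2 f -> 0 <= b -> 0 <= c ->
  (Bnorm b f <= c%:E)%E -> ip2 f f <= (tp * c) ^+ 2.
Proof.
move=> f2 b0 c0 fc; rewrite -lee_fin exprMn EFinM.
apply: (le_trans (parseval_le f2)); apply: lee_wpmul2l.
  by rewrite lee_fin sqr_ge0.
exact: esum_fsqr_le_Bnorm fc.
Qed.

(** For [k <> 0] the divergence equation makes the coefficient of [v] orthogonal to
    [k], and the curl equation gives its component along the orthogonal of [k], so
    that [|k| ^+ 2 * |v_k| ^+ 2 = |w_k| ^+ 2]; for [k = 0] the mean of [v] vanishes. *)
Lemma ip_biot_savart (w : R * R -> R) v k : sq2 w -> biot_savart w v ->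
  [/\ ip2 (fun x => (v x).1) (tcos k) ^+ 2 + ip2 (fun x => (v x).2) (tcos k) ^+ 2
        <= ip2 w (tsin k) ^+ 2 &
      ip2 (fun x => (v x).1) (tsin k) ^+ 2 + ip2 (fun x => (v x).2) (tsin k) ^+ 2
        <= ip2 w (tcos k) ^+ 2].
Proof.
move=> w2 [[/torusL2_sqint v1 /torusL2_sqint v2] [m1 m2] hdiv hcurl].
pose u1 (x : R * R) := (v x).1; pose u2 (x : R * R) := (v x).2.
have lin (m : R * R -> R) (p q : R) : sq2 m ->
   torus_int (fun x => u1 x * (p * m x) + u2 x * (q * m x)) = p * ip2 u1 m + q * ip2 u2 m.
  move=> m2'.
  have i1 c (u : R * R -> R) : sq2 u -> mu2.-integrable D (EFin \o (fun x => u x * (c * m x))).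
    by move=> u2'; apply: (sqint_mul mT u2'); exact: (sqintZ mT c m2').
  rewrite /torus_int (RintegralD mT (i1 p u1 v1) (i1 q u2 v2)).
  by congr (_ + _); [exact: (ipZr mT p m2' v1)|exact: (ipZr mT q m2' v2)].
have linB (m : R * R -> R) (p q : R) : sq2 m ->
   torus_int (fun x => u1 x * (p * m x) - u2 x * (q * m x)) = p * ip2 u1 m - q * ip2 u2 m.
  move=> m2'; rewrite -mulNr -lin//; congr torus_int; apply/funext => x.
  by rewrite mulNr mulrN.
have sc := @sqint_tcos R k; have ss := @sqint_tsin R k.
have D1c : d1 (tcos k) = (fun x => - k.1%:~R * tsin k x) :> (R * R -> R) by exact: partial_tcos.
have D2c : d2 (tcos k) = (fun x => - k.2%:~R * tsin k x) :> (R * R -> R) by exact: partial_tcos.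
have D1s : d1 (tsin k) = (fun x => k.1%:~R * tcos k x) :> (R * R -> R) by exact: partial_tsin.
have D2s : d2 (tsin k) = (fun x => k.2%:~R * tcos k x) :> (R * R -> R) by exact: partial_tsin.
have := hdiv _ (test_fun_tcos k); rewrite D1c D2c lin// => e1.
have := hdiv _ (test_fun_tsin k); rewrite D1s D2s lin// => e2.
have := hcurl _ (test_fun_tcos k); rewrite D1c D2c linB// -[pairing _ _]/(ip2 w (tcos k)) => e3.
have := hcurl _ (test_fun_tsin k); rewrite D1s D2s linB// -[pairing _ _]/(ip2 w (tsin k)) => e4.
rewrite -/u1 -/u2.
have [k0|k0] := eqVneq k (0, 0).
  have c0 : tcos k = cst 1 :> (R * R -> R).
    by apply/funext => x; rewrite k0 /tcos phase0 cos0.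
  have s0 : tsin k = cst 0 :> (R * R -> R).
    by apply/funext => x; rewrite k0 /tsin phase0 sin0.
  have ip0 u : ip2 u (cst 0) = 0.
    rewrite /ip; under eq_Rintegral do rewrite /= mulr0.
    by rewrite Rintegral_cst ?mul0r//; exact: mT.
  have ip1 (u : R * R -> R) : ip2 u (cst 1) = torus_int u.
    by rewrite /ip /torus_int; under eq_Rintegral do rewrite /= mulr1.
  by rewrite c0 s0 !ip0 !ip1 m1 m2 !expr0n /= addr0 lexx sqr_ge0.
have key : 1 <= (k.1%:~R : R) ^+ 2 + k.2%:~R ^+ 2.
  have int_sqr (n : int) : n != 0 -> 1 <= (n%:~R : R) ^+ 2.
    move=> n0; rewrite -rmorphXn /= -[1]/(1%:~R) ler_int.
    by rewrite -gtz0_ge1 lt_def sqrf_eq0 n0 sqr_ge0.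
  move: k0; case: (k) => p q /=; rewrite xpair_eqE negb_and => /orP[/int_sqr h|/int_sqr h].
    by rewrite (le_trans h)// lerDl sqr_ge0.
  by rewrite (le_trans h)// lerDr sqr_ge0.
rewrite -e3 -e4.
have alg (p q X Y : R) : 1 <= p ^+ 2 + q ^+ 2 -> p * X + q * Y = 0 ->
   X ^+ 2 + Y ^+ 2 <= (q * X - p * Y) ^+ 2.
  move=> h e; have -> : (q * X - p * Y) ^+ 2 =
     (p ^+ 2 + q ^+ 2) * (X ^+ 2 + Y ^+ 2) - (p * X + q * Y) ^+ 2 by ring.
  by rewrite e expr0n subr0 ler_peMl// addr_ge0 ?sqr_ge0.
split; first exact: alg.
apply: (alg (- k.1%:~R) (- k.2%:~R)); last exact: e1.
by rewrite !sqrrN.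
Qed.

(** Biot--Savart is bounded on L^2: each velocity component is dominated,
    coefficient by coefficient, by the vorticity. *)
Lemma biot_savart_L2 (w : R * R -> R) v b c : sq2 w -> biot_savart w v ->
  0 <= b -> 0 <= c -> (Bnorm b w <= c%:E)%E ->
  ip2 (fun x => (v x).1) (fun x => (v x).1) <= (tp * c) ^+ 2 /\
  ip2 (fun x => (v x).2) (fun x => (v x).2) <= (tp * c) ^+ 2.
Proof.
move=> w2 bs b0 c0 wc.
have := bs => -[[/torusL2_sqint v1 /torusL2_sqint v2] _ _ _].
have fin (u : R * R -> R) : sq2 u -> (forall k, fsqr u k <= fsqr w k) -> ip2 u u <= (tp * c) ^+ 2.
  move=> u2 uw; rewrite -lee_fin exprMn EFinM.
  apply: (le_trans (parseval_le u2)); apply: lee_wpmul2l.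
    by rewrite lee_fin sqr_ge0.
  apply: le_trans (esum_fsqr_le_Bnorm b0 c0 wc).
  by apply: le_esum => k _; rewrite lee_fin; exact: uw.
have tp4 : 0 <= tp ^- 4 by rewrite invr_ge0 exprn_ge0// ltW.
split; apply: fin => // k; have [h1 h2] := ip_biot_savart k w2 bs.
- rewrite /fsqr (fourier_coef_sqr _ v1) (fourier_coef_sqr _ w2) ler_wpM2l//.
  rewrite [leLHS]addrC lerD//; first by rewrite (le_trans _ h2)// lerDl sqr_ge0.
  by rewrite (le_trans _ h1)// lerDl sqr_ge0.
- rewrite /fsqr (fourier_coef_sqr _ v2) (fourier_coef_sqr _ w2) ler_wpM2l//.
  rewrite [leLHS]addrC lerD//; first by rewrite (le_trans _ h2)// lerDr sqr_ge0.
  by rewrite (le_trans _ h1)// lerDr sqr_ge0.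
Qed.

End sobolev_bounds.

(** * Continuous functions on the torus *)

Section continuous_on_torus.
Context {R : realType}.
Local Notation R2 := (measurableTypeR R * measurableTypeR R)%type.
Local Notation mu2 := (@lebesgue_measure R \x @lebesgue_measure R)%E.
Local Notation D := (torus : set R2).
Local Notation sq2 := (sqint mu2 D).

(** Open sets of the plane are countable unions of rational squares, hence
    measurable for the product sigma-algebra. *)
Lemma open_measurable2 (U : set (R * R)) : open U -> measurable (U : set R2).
Proof.
move=> oU.
pose B (i : rat * rat * nat) : set R2 :=
  (ball (ratr i.1.1 : R) i.2.+1%:R^-1) `*` (ball (ratr i.1.2 : R) i.2.+1%:R^-1).
pose F i := if `[< B i `<=` U >] then B i else set0.
have -> : U = \bigcup_i F i.
  apply/seteqP; split => [x Ux|x [i _]]; last first.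
    by rewrite /F; case: asboolP => // h; exact: h.
  have : nbhs x U by exact: open_nbhs_nbhs.
  move=> /nbhs_ballP[e /= e0 xeU].
  pose n := Num.truncn (2 / e).
  have ne : (n.+1%:R^-1 : R) < e / 2.
    rewrite -[ltRHS]invrK ltf_pV2 ?posrE ?invr_gt0 ?divr_gt0// invf_div.
    exact: truncnS_gt.
  have near_rat (y : R) : exists q : rat, `|ratr q - y| < n.+1%:R^-1.
    have : y < y + n.+1%:R^-1 by rewrite ltrDl invr_gt0.
    move=> /rat_in_itvoo[q]; rewrite in_itv /= => /andP[h1 h2].
    by exists q; rewrite ger0_norm ?subr_ge0 ?(ltW h1)// ltrBlDl.
  have [p hp] := near_rat x.1; have [q hq] := near_rat x.2.
  exists (p, q, n) => //; rewrite /F asboolT /B /=; first by split; rewrite /= /ball /=.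
  move=> y [/= y1 y2]; apply: xeU; split; rewrite /ball /=.
  - rewrite -(subrK (ratr p) x.1) -addrA (le_lt_trans (ler_normD _ _))//.
    by rewrite (splitr e) ltrD// (lt_trans _ ne)// distrC.
  - rewrite -(subrK (ratr q) x.2) -addrA (le_lt_trans (ler_normD _ _))//.
    by rewrite (splitr e) ltrD// (lt_trans _ ne)// distrC.
apply: countable_bigcupT_measurable => // i; rewrite /F; case: ifP => // _.
by apply: measurableX; apply: open_measurable; exact: ball_open.
Qed.

Lemma continuous_measurable2 (f : R * R -> R) : continuous f ->
  measurable_fun [set: R2] (f : R2 -> R).
Proof.
move=> /continuousP cf; apply: (measurability _ (RGenOpens.measurableE R)).
move=> _ [_ [a [b ->] <-]]; rewrite setTI; apply: open_measurable2.
exact/cf/interval_open.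
Qed.

Lemma continuous_torus_bounded (f : R * R -> R) : continuous f ->
  exists2 M : R, 0 <= M & forall x, torus x -> `|f x| <= M.
Proof.
move=> cf.
have cT : compact (torus : set (R * R)) by apply: compact_setX; exact: segment_compact.
have : compact (f @` torus : set R^o).
  by apply: continuous_compact => //; exact: continuous_subspaceT.
move=> /compact_bounded[M [_ hM]].
exists (`|M| + 1); first by rewrite addr_ge0.
move=> x xT; apply: (hM (`|M| + 1)); last by exists x.
by rewrite (le_lt_trans (ler_norm M))// ltrDl.
Qed.

Lemma sqint_continuous (f : R * R -> R) : continuous f -> sq2 f.
Proof.
move=> cf; have [M M0 fM] := continuous_torus_bounded cf.
apply: (sqint_bounded measurable_torus measure_torus_fin (M := M)) => //.
by apply: measurable_funTS; exact: continuous_measurable2.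
Qed.

Lemma sqint_mul_continuous (u f : R * R -> R) : sq2 u -> continuous f ->
  sq2 (fun x => u x * f x).
Proof.
move=> u2 cf; have [M M0 fM] := continuous_torus_bounded cf.
apply: (sqint_mulb measurable_torus u2 _ fM).
by apply: measurable_funTS; exact: continuous_measurable2.
Qed.

End continuous_on_torus.

(** * Regularity in time of solutions *)

Section vorticity_path.
Context {R : realType}.
Local Notation R2 := (measurableTypeR R * measurableTypeR R)%type.
Local Notation mu2 := (@lebesgue_measure R \x @lebesgue_measure R)%E.
Local Notation D := (torus : set R2).
Local Notation tp := (2 * pi : R).
Local Notation ip2 := (ip mu2 D).
Local Notation sq2 := (sqint mu2 D).

Let tp0 : 0 < tp. Proof. by rewrite mulr_gt0// pi_gt0. Qed.
Let mT := @measurable_torus R.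
Let fT := @measure_torus_fin R.

Lemma torus_intB (f g : R * R -> R) : sq2 f -> sq2 g ->
  torus_int (fun x => f x - g x) = torus_int f - torus_int g.
Proof.
by move=> f2 g2; apply: (RintegralB mT (sqint_Int mT fT f2) (sqint_Int mT fT g2)).
Qed.

Lemma torusL2B (f g : R * R -> R) : torusL2 f -> torusL2 g ->
  torusL2 (fun x => f x - g x).
Proof.
move=> f2 g2; have [m i] := sqintB mT (torusL2_sqint f2) (torusL2_sqint g2).
have [pf _ _] := f2; have [pg _ _] := g2.
split; [|exact: m|exact: i].
move=> x1 x2; have [f1 f2'] := pf x1 x2; have [g1 g2'] := pg x1 x2.
by rewrite f1 f2' g1 g2'.
Qed.

Lemma test_fun_continuous (psi : R * R -> R) : test_fun psi ->
  [/\ continuous psi, continuous (d1 psi), continuous (d2 psi) & continuous (laplacian psi)].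
Proof.
move=> [_ sm]; split.
- exact: (sm [::]).1.
- exact: (sm [:: false]).1.
- exact: (sm [:: true]).1.
- move=> x; apply: cvgD; first exact: (sm [:: false; false]).1.
  exact: (sm [:: true; true]).1.
Qed.

(** The Biot--Savart law is linear. *)
Lemma biot_savartB (w w' : R * R -> R) v v' : torusL2 w -> torusL2 w' ->
  biot_savart w v -> biot_savart w' v' ->
  biot_savart (fun x => w x - w' x) (fun x => ((v x).1 - (v' x).1, (v x).2 - (v' x).2)).
Proof.
move=> w2 w2' [[a1 a2] [m1 m2] hd hc] [[b1 b2] [n1 n2] hd' hc'].
have s1 := torusL2_sqint a1; have s2 := torusL2_sqint a2.
have r1 := torusL2_sqint b1; have r2 := torusL2_sqint b2.
have sw := torusL2_sqint w2; have sw' := torusL2_sqint w2'.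
split => /=.
- by split; apply: torusL2B.
- by rewrite !torus_intB// m1 m2 n1 n2 subrr.
- move=> psi tpsi; have [cp c1 c2 _] := test_fun_continuous tpsi.
  rewrite -[RHS](subrr 0) -{1}(hd psi tpsi) -(hd' psi tpsi) -torus_intB.
  + by congr torus_int; apply/funext => x; ring.
  + by apply: (sqintD mT); exact: sqint_mul_continuous.
  + by apply: (sqintD mT); exact: sqint_mul_continuous.
- move=> psi tpsi; have [cp c1 c2 _] := test_fun_continuous tpsi.
  have -> : pairing (fun x => w x - w' x) psi = pairing w psi - pairing w' psi.
    exact: (ipBl mT sw sw' (sqint_continuous cp)).
  rewrite -(hc psi tpsi) -(hc' psi tpsi) -torus_intB.
  + by congr torus_int; apply/funext => x; ring.
  + by apply: (sqintB mT); exact: sqint_mul_continuous.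
  + by apply: (sqintB mT); exact: sqint_mul_continuous.
Qed.

Lemma ip_add_le_sqr (f g : R * R -> R) (A B : R) : 0 <= A -> 0 <= B -> sq2 f -> sq2 g ->
  ip2 f f <= A ^+ 2 -> ip2 g g <= B ^+ 2 ->
  ip2 (fun x => f x + g x) (fun x => f x + g x) <= (2 * (A + B)) ^+ 2.
Proof.
move=> A0 B0 f2 g2 fA gB; apply: (le_trans (ip_add_le mT f2 g2)).
apply: (@le_trans _ _ (2 * A ^+ 2 + 2 * B ^+ 2)).
  by rewrite lerD// ler_wpM2l.
rewrite -subr_ge0 (_ : _ - _ = 2 * A ^+ 2 + 2 * B ^+ 2 + 8 * (A * B)); last by ring.
by rewrite !addr_ge0// !mulr_ge0// sqr_ge0.
Qed.

Variables (t gamma b C : R) (w : R -> R * R -> R) (u : R -> R * R -> R * R).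
Hypotheses (t0 : 0 < t) (g0 : 0 < gamma) (b0 : 0 <= b).
Hypothesis wB : forall s : R, s \in `[0, t] -> inB b (w s).
Hypothesis wC : forall r s : R, r \in `[0, t] -> s \in `[0, t] ->
  (Bnorm b (w r \- w s)%R <= (C * `|r - s| `^ gamma)%R%:E)%E.
Hypothesis wu : forall s : R, s \in `[0, t] -> biot_savart (w s) (u s).

Let K := tp * `|C|.
Let K0 : 0 <= K. Proof. by rewrite mulr_ge0// ltW. Qed.

Let tI : (0 : R) \in `[0, t]. Proof. by rewrite in_itv /= lexx ltW. Qed.
Let wL (s : R) : s \in `[0, t] -> torusL2 (w s). Proof. by move=> /wB[]. Qed.
Let wS (s : R) : s \in `[0, t] -> sq2 (w s). Proof. by move=> /wL/torusL2_sqint. Qed.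
Let u1S (s : R) : s \in `[0, t] -> sq2 (fun x => (u s x).1).
Proof. by move=> /wu[[/torusL2_sqint]]. Qed.
Let u2S (s : R) : s \in `[0, t] -> sq2 (fun x => (u s x).2).
Proof. by move=> /wu[[_ /torusL2_sqint]]. Qed.

Let rhs (r s : R) : (C * `|r - s| `^ gamma <= `|C| * `|r - s| `^ gamma)%R.
Proof. by rewrite ler_wpM2r ?powR_ge0// ler_norm. Qed.

Let w_incr (r s : R) : r \in `[0, t] -> s \in `[0, t] ->
  ip2 (fun x => w r x - w s x) (fun x => w r x - w s x) <= (K * `|r - s| `^ gamma) ^+ 2.
Proof.
move=> rI sI; rewrite -mulrA.
apply: (L2_le_Bnorm (sqintB mT (wS rI) (wS sI)) b0); first by rewrite mulr_ge0 ?powR_ge0.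
by apply: (le_trans (wC rI sI)); rewrite lee_fin rhs.
Qed.

Let u_incr (r s : R) : r \in `[0, t] -> s \in `[0, t] ->
  ip2 (fun x => (u r x).1 - (u s x).1) (fun x => (u r x).1 - (u s x).1)
    <= (K * `|r - s| `^ gamma) ^+ 2 /\
  ip2 (fun x => (u r x).2 - (u s x).2) (fun x => (u r x).2 - (u s x).2)
    <= (K * `|r - s| `^ gamma) ^+ 2.
Proof.
move=> rI sI; rewrite -mulrA.
have bs := biot_savartB (wL rI) (wL sI) (wu rI) (wu sI).
apply: (biot_savart_L2 (sqintB mT (wS rI) (wS sI)) bs b0); first by rewrite mulr_ge0 ?powR_ge0.
by apply: (le_trans (wC rI sI)); rewrite lee_fin rhs.
Qed.

Let incr0 (s : R) : s \in `[0, t] -> K * `|s - 0| `^ gamma <= K * t `^ gamma.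
Proof.
rewrite in_itv /= => /andP[s0 st]; rewrite ler_wpM2l// subr0 ger0_norm//.
by apply: ge0_ler_powR => //; rewrite ?nnegrE// ltW.
Qed.

Let bnd0 : exists2 M, 0 <= M &
  [/\ ip2 (w 0) (w 0) <= M ^+ 2, ip2 (fun x => (u 0 x).1) (fun x => (u 0 x).1) <= M ^+ 2 &
      ip2 (fun x => (u 0 x).2) (fun x => (u 0 x).2) <= M ^+ 2].
Proof.
have [_ fin] := wB tI; pose c := fine (Bnorm b (w 0)).
have B0 : (0 <= Bnorm b (w 0))%E by exact: poweR_ge0.
have c0 : 0 <= c by rewrite fine_ge0.
have Bc : (Bnorm b (w 0) <= c%:E)%E by rewrite fineK// ge0_fin_numE.
exists (tp * c); first by rewrite mulr_ge0// ltW.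
have [h1 h2] := biot_savart_L2 (wS tI) (wu tI) b0 c0 Bc.
by split => //; exact: (L2_le_Bnorm (wS tI) b0 c0 Bc).
Qed.

(** The vorticity and the velocity are bounded in [L^2], uniformly in time. *)
Lemma path_L2_bound : exists2 M, 0 <= M & forall s : R, s \in `[0, t] ->
  [/\ ip2 (w s) (w s) <= M ^+ 2, ip2 (fun x => (u s x).1) (fun x => (u s x).1) <= M ^+ 2 &
      ip2 (fun x => (u s x).2) (fun x => (u s x).2) <= M ^+ 2].
Proof.
have [M M0 [w0 u10 u20]] := bnd0.
have L0 : 0 <= K * t `^ gamma by rewrite mulr_ge0 ?powR_ge0.
exists (2 * (M + K * t `^ gamma)); first by rewrite mulr_ge0// addr_ge0.
move=> s sI.
have up (f f0 : R * R -> R) : sq2 f -> sq2 f0 -> ip2 f0 f0 <= M ^+ 2 ->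
    ip2 (fun x => f x - f0 x) (fun x => f x - f0 x) <= (K * `|s - 0| `^ gamma) ^+ 2 ->
    ip2 f f <= (2 * (M + K * t `^ gamma)) ^+ 2.
  move=> f2 f02 h0 h1.
  have := @ip_add_le_sqr f0 (fun x => f x - f0 x) M (K * t `^ gamma) M0 L0 f02 (sqintB mT f2 f02) h0.
  have -> : (fun x => f0 x + (f x - f0 x)) = f by apply/funext => x; ring.
  apply; apply: (le_trans h1).
  by rewrite ler_pXn2r ?nnegrE ?incr0// mulr_ge0 ?powR_ge0.
have [v1 v2] := u_incr sI tI.
split.
- exact: (up _ _ (wS sI) (wS tI) w0 (w_incr sI tI)).
- exact: (up _ _ (u1S sI) (u1S tI) u10 v1).
- exact: (up _ _ (u2S sI) (u2S tI) u20 v2).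
Qed.

Let norm_bound (f : R * R -> R) : exists2 N, 0 <= N & ip2 f f <= N ^+ 2.
Proof.
exists (1 + ip2 f f); first by rewrite addr_ge0 ?ip_ge0.
by have := ip_ge0 mu2 D f; move: (ip2 f f) => X X0; nra.
Qed.

Lemma pairing_holder (G : R * R -> R) : continuous G ->
  exists2 A, 0 <= A & forall r s : R, r \in `[0, t] -> s \in `[0, t] ->
   `|pairing (w r) G - pairing (w s) G| <= A * `|r - s| `^ gamma.
Proof.
move=> cG; have G2 := sqint_continuous cG; have [N N0 GN] := norm_bound G.
exists (K * N); first by rewrite mulr_ge0.
move=> r s rI sI; rewrite -[pairing (w r) G]/(ip2 (w r) G) -[pairing (w s) G]/(ip2 (w s) G).
rewrite -(ipBl mT (wS rI) (wS sI) G2) mulrAC.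
apply: (ip_cauchy_schwarz_le mT _ N0 (sqintB mT (wS rI) (wS sI)) G2 (w_incr rI sI) GN).
by rewrite mulr_ge0 ?powR_ge0.
Qed.

(** The drift of the weak equation tested against [psi] is Hoelder continuous
    in time: it is quadratic in the vorticity, and both factors are bounded and
    Hoelder continuous with values in L^2. *)
Lemma drift_holder (psi : R * R -> R) : test_fun psi ->
  exists2 A, 0 <= A & forall r s : R, r \in `[0, t] -> s \in `[0, t] ->
   `|pairing (w r) (advect (u r) psi \+ laplacian psi)
     - pairing (w s) (advect (u s) psi \+ laplacian psi)| <= A * `|r - s| `^ gamma.
Proof.
move=> tpsi; have [_ c1 c2 cL] := test_fun_continuous tpsi.
have [AL AL0 hL] := pairing_holder cL.
have [M M0 hM] := path_L2_bound.
have [N1 N10 hN1] := continuous_torus_bounded c1.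
have [N2 N20 hN2] := continuous_torus_bounded c2.
pose a s := advect (u s) psi.
have aS s : s \in `[0, t] -> sq2 (a s).
  move=> sI; apply: (sqintD mT).
    exact: (sqint_mul_continuous (u1S sI) c1).
  exact: (sqint_mul_continuous (u2S sI) c2).
have adv (f g : R * R -> R) (X : R) : 0 <= X -> sq2 f -> sq2 g ->
    ip2 f f <= X ^+ 2 -> ip2 g g <= X ^+ 2 ->
    ip2 (fun x => f x * d1 psi x + g x * d2 psi x) (fun x => f x * d1 psi x + g x * d2 psi x)
      <= (2 * (N1 + N2) * X) ^+ 2.
  move=> X0 f2 g2 fX gX.
  rewrite (_ : 2 * (N1 + N2) * X = 2 * (N1 * X + N2 * X)); last by ring.
  apply: ip_add_le_sqr; rewrite ?mulr_ge0//.
  - exact: sqint_mul_continuous.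
  - exact: sqint_mul_continuous.
  - rewrite exprMn (le_trans (nsq_mul_le mT f2 _ hN1))//.
      by apply: measurable_funTS; exact: continuous_measurable2.
    by rewrite ler_wpM2l ?sqr_ge0.
  - rewrite exprMn (le_trans (nsq_mul_le mT g2 _ hN2))//.
      by apply: measurable_funTS; exact: continuous_measurable2.
    by rewrite ler_wpM2l ?sqr_ge0.
pose N := 2 * (N1 + N2).
have NN : 0 <= N by rewrite mulr_ge0 ?addr_ge0.
exists (K * (N * M) + M * (N * K) + AL).
  by rewrite addr_ge0 ?addr_ge0 ?(mulr_ge0 K0) ?(mulr_ge0 M0) ?(mulr_ge0 NN).
move=> r s rI sI.
have L2 := sqint_continuous cL.
have split_ q : q \in `[0, t] -> pairing (w q) (advect (u q) psi \+ laplacian psi) =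
    ip2 (w q) (a q) + ip2 (w q) (laplacian psi).
  by move=> qI; apply: (ipDr mT (aS q qI) L2 (wS qI)).
rewrite !split_//.
have wrs := sqintB mT (wS rI) (wS sI); have ars := sqintB mT (aS r rI) (aS s sI).
set Z := `|r - s| `^ gamma.
have Z0 : 0 <= Z by exact: powR_ge0.
have KZ0 : 0 <= K * Z by rewrite mulr_ge0.
have -> : ip2 (w r) (a r) + ip2 (w r) (laplacian psi) - (ip2 (w s) (a s) + ip2 (w s) (laplacian psi))
  = ip2 (fun x => w r x - w s x) (a r) + ip2 (w s) (fun x => a r x - a s x) +
    (ip2 (w r) (laplacian psi) - ip2 (w s) (laplacian psi)).
  rewrite (ipBl mT (wS rI) (wS sI) (aS r rI)) (ipBr mT (aS r rI) (aS s sI) (wS sI)); ring.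
have [hr1 hr2 hr3] := hM _ rI; have [hs1 hs2 hs3] := hM _ sI.
rewrite !mulrDl (le_trans (ler_normD _ _))// lerD//; last exact: hL.
rewrite (le_trans (ler_normD _ _))// lerD//.
- have -> : K * (N * M) * Z = (K * Z) * (N * M) by ring.
  apply: (ip_cauchy_schwarz_le mT KZ0 _ wrs (aS r rI) (w_incr rI sI)).
    by rewrite mulr_ge0.
  exact: (adv _ _ M M0 (u1S rI) (u2S rI) hr2 hr3).
- have -> : M * (N * K) * Z = M * (N * (K * Z)) by ring.
  apply: (ip_cauchy_schwarz_le mT M0 _ (wS sI) ars hs1).
    by rewrite mulr_ge0.
  have [v1 v2] := u_incr rI sI.
  have := adv _ _ _ KZ0 (sqintB mT (u1S rI) (u1S sI)) (sqintB mT (u2S rI) (u2S sI)) v1 v2.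
  rewrite (_ : (fun x => ((u r x).1 - (u s x).1) * _ + _) = (fun x => a r x - a s x))//.
  by apply/funext => x; rewrite /a /advect; ring.
Qed.

End vorticity_path.

(** * Quadratic variation of tested solutions *)

Section young_paths.
Context {R : realType}.
Local Notation mu := (@lebesgue_measure R).

(** On [0, t] the path [f] is the Young integral of the [gamma]-Hoelder
    integrand [g] against [w], up to a constant and a Lipschitz drift. *)
Definition young_path (t gamma : R) (w f g : R -> R) : Prop :=
  exists C D I CD, [/\ 0 <= C,
    forall r s : R, r \in `[0, t] -> s \in `[0, t] -> `|g r - g s| <= C * `|r - s| `^ gamma,
    forall r : R, r \in `[0, t] -> is_young_integral g w 0 r (I r),
    forall r s : R, r \in `[0, t] -> s \in `[0, t] -> `|D r - D s| <= CD * `|r - s| &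
    forall r : R, r \in `[0, t] -> f r = f 0 + D r + I r].

Lemma young_path_variation (H gamma t : R) (w f g : R -> R) :
  2^-1 < H -> H < 1 -> 2^-1 < gamma -> 0 < t ->
  (forall m i : nat, dyadic_var H w (m + k) (i * 2 ^ k) (2 ^ k) @[k --> \oo] -->
    (1 / 2 ^+ m : R)) ->
  young_path t gamma w f g ->
  (1 / 2 ^+ k) `^ (1 - 2 * H) *
    \sum_(j < dyadic_count t k) (f (dyadic k j.+1) - f (dyadic k j)) ^+ 2 @[k --> \oo] -->
  time_int 0 t (fun s => g s ^+ 2).
Proof.
move=> H1 H2 g1 t0 hQ [C [D [I [CD [C0 hg hI hD hf]]]]].
exact: (path_quadratic_variation H1 H2 g1 t0 C0 hQ hg hI hD hf).
Qed.

Lemma is_young_integralD (g h w : R -> R) (a b I J : R) :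
  is_young_integral g w a b I -> is_young_integral h w a b J ->
  is_young_integral (fun s => g s + h s) w a b (I + J).
Proof.
move=> gI hJ e e0; have e20 : 0 < e / 2 by rewrite divr_gt0.
have [d1 d10 h1] := gI _ e20; have [d2 d20 h2] := hJ _ e20.
exists (Num.min d1 d2); first by rewrite lt_min d10 d20.
move=> s sp p hp.
have hp1 i : (i < size s)%N -> p i.+1 - p i < d1.
  by move=> si; move: (hp i si); rewrite lt_min => /andP[].
have hp2 i : (i < size s)%N -> p i.+1 - p i < d2.
  by move=> si; move: (hp i si); rewrite lt_min => /andP[].
have {}h1 := h1 s sp hp1; have {}h2 := h2 s sp hp2.
rewrite (splitr e); apply: le_lt_trans (ltrD h1 h2).
apply: le_trans (ler_normD _ _); rewrite le_eqVlt; apply/orP; left; apply/eqP; congr `|_|.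
rewrite addrACA -opprD -big_split /=; congr (_ - _).
by apply: eq_bigr => i _; rewrite mulrDl.
Qed.

Lemma young_pathD (t gamma : R) (w f g f' g' : R -> R) :
  young_path t gamma w f g -> young_path t gamma w f' g' ->
  young_path t gamma w (fun s => f s + f' s) (fun s => g s + g' s).
Proof.
move=> [C [D [I [CD [C0 hg hI hD hf]]]]] [C' [D' [I' [CD' [C0' hg' hI' hD' hf']]]]].
exists (C + C'), (fun s => D s + D' s), (fun s => I s + I' s), (CD + CD').
split; first exact: addr_ge0.
- move=> r s rI sI; rewrite opprD addrACA mulrDl (le_trans (ler_normD _ _))//.
  by rewrite lerD ?hg ?hg'.
- by move=> r rI; exact: is_young_integralD (hI _ rI) (hI' _ rI).
- move=> r s rI sI; rewrite opprD addrACA mulrDl (le_trans (ler_normD _ _))//.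
  by rewrite lerD ?hD ?hD'.
- by move=> r rI; rewrite (hf _ rI) (hf' _ rI); ring.
Qed.

Lemma young_path_integrand_continuous (t gamma : R) (w f g : R -> R) : 0 < gamma ->
  young_path t gamma w f g -> {within `[0, t], continuous g}.
Proof.
move=> g0 [C [_ [_ [_ [_ hg _ _ _]]]]].
exact: (holder_within_continuous g0 hg).
Qed.

Lemma time_int_lipschitz (h : R -> R) (t gamma A : R) : 0 < t -> 0 < gamma -> 0 <= A ->
  (forall r s : R, r \in `[0, t] -> s \in `[0, t] -> `|h r - h s| <= A * `|r - s| `^ gamma) ->
  exists L, forall r s : R, r \in `[0, t] -> s \in `[0, t] ->
    `|time_int 0 r h - time_int 0 s h| <= L * `|r - s|.
Proof.
move=> t0 g0 A0 hh.
have ch : {within `[0, t], continuous h} by exact: (holder_within_continuous g0 hh).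
have tI : (0 : R) \in `[0, t] by rewrite in_itv /= lexx ltW.
pose L := `|h 0| + A * t `^ gamma.
have hL s : s \in `[0, t] -> `|h s| <= L.
  move=> sI; rewrite -(subrK (h 0) (h s)) addrC (le_trans (ler_normD _ _))// lerD2l.
  apply: (le_trans (hh _ _ sI tI)); rewrite ler_wpM2l// subr0.
  move: sI; rewrite in_itv /= => /andP[s0 st]; rewrite ger0_norm//.
  by apply: ge0_ler_powR => //; rewrite ?nnegrE// ltW.
exists L.
have main (r s : R) : r \in `[0, t] -> s \in `[0, t] -> r <= s ->
    `|time_int 0 s h - time_int 0 r h| <= L * (s - r).
  rewrite !in_itv /= => /andP[r0 rt] /andP[s0 st] rs.
  rewrite time_intB//; last exact: (within_continuous_integrable ch).
  apply: time_int_bound => //; first exact: (within_continuous_integrable ch).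
  move=> x; rewrite in_itv /= => /andP[rx xs]; apply: hL.
  by rewrite in_itv /= (le_trans r0 rx) (le_trans xs st).
move=> r s rI sI; have [rs|/ltW sr] := leP r s.
  by rewrite distrC (distrC r) (ger0_norm (_ : 0 <= s - r)) ?subr_ge0//; exact: main.
by rewrite (ger0_norm (_ : 0 <= r - s)) ?subr_ge0//; exact: main.
Qed.

(** Tested against [psi], a solution of the weak equation is the Young integral
    of [(w_s, xi . grad psi)], up to a Lipschitz drift. *)
Lemma weak_equation_young_path (t gamma b : R) (xi : R * R -> R * R) (W : R -> R)
    (w : R -> R * R -> R) (u : R -> R * R -> R * R) (psi : R * R -> R) :
  0 < t -> 0 < gamma -> 0 <= b -> smooth_divfree xi -> holder_path gamma b t w ->
  (forall s, s \in `[0, t] -> biot_savart (w s) (u s)) ->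
  weak_equation t xi W w u -> test_fun psi ->
  young_path t gamma W (fun s => pairing (w s) psi)
    (fun s => pairing (w s) (advect xi psi)).
Proof.
move=> t0 g0 b0 [x1 x2 _] [wB [C wC]] wu we tpsi.
have [_ c1 c2 cL] := test_fun_continuous tpsi.
have [cx1 _ _ _] := test_fun_continuous x1; have [cx2 _ _ _] := test_fun_continuous x2.
have cG : continuous (advect xi psi).
  by move=> x; apply: cvgD; apply: cvgM; [exact: cx1|exact: c1|exact: cx2|exact: c2].
have [A A0 hA] := pairing_holder b0 wB wC cG.
have [B B0 hB] := drift_holder t0 g0 b0 wB wC wu tpsi.
have [L hL] := time_int_lipschitz t0 g0 B0 hB.
pose h s := pairing (w s) (advect (u s) psi \+ laplacian psi).
exists A, (fun r => time_int 0 r h),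
  (fun r => pairing (w r) psi - pairing (w 0) psi - time_int 0 r h), L.
split => //.
- move=> r rI; have [I hI e] := we psi tpsi r rI.
  rewrite e (_ : _ - _ - _ = I)//; rewrite /h; ring.
- by move=> r rI; ring.
Qed.

End young_paths.

Section complex_limit.
Context {R : realType}.

Lemma cvg_complex (a b : nat -> R) (x y : R) :
  a k @[k --> \oo] --> x -> b k @[k --> \oo] --> y ->
  (fun k => a k +i* b k : R[i]^o) @ \oo --> (x +i* y : R[i]^o).
Proof.
move=> ax bY; apply/cvgrPdist_lt => -[e e'] e0.
have e'0 : e' = 0 by move: e0; rewrite ltcE /= => /andP[/eqP].
have {}e0 : 0 < e by move: e0; rewrite ltcE /= => /andP[].
have e20 : 0 < e / 2 by rewrite divr_gt0.
near=> k.
have h1 : `|x - a k| < e / 2 by near: k; move/cvgrPdist_lt : ax; apply.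
have h2 : `|y - b k| < e / 2 by near: k; move/cvgrPdist_lt : bY; apply.
rewrite -[X in `|X|]/((x - a k) +i* (y - b k)) normc_def /= e'0 ltcR.
apply: (@le_lt_trans _ _ (`|x - a k| + `|y - b k|)); last by rewrite (splitr e) ltrD.
rewrite -(@ler_pXn2r _ 2) ?nnegrE ?sqrtr_ge0 ?addr_ge0// sqr_sqrtr ?addr_ge0 ?sqr_ge0//.
rewrite [leRHS]sqrrD !real_normK ?num_real// lerD2r lerDl.
by rewrite mulrn_wge0 ?mulr_ge0.
Unshelve. all: by end_near. Qed.

End complex_limit.
Section square_parts.
Context {R : realType}.
Local Notation mu := (@lebesgue_measure R).

Lemma complex_sqr (a b : R) :
  (a +i* b) ^+ 2 = (a ^+ 2 - b ^+ 2) +i* ((a + b) ^+ 2 - a ^+ 2 - b ^+ 2).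
Proof.
rewrite expr2; apply/eqP; rewrite eq_complex /=; apply/andP; split; apply/eqP; ring.
Qed.

Lemma complex_sum (n : nat) (a b : nat -> R) :
  \sum_(j < n) (a j +i* b j) = (\sum_(j < n) a j) +i* (\sum_(j < n) b j).
Proof.
elim: n => [|n IH]; first by rewrite !big_ord0.
by rewrite !big_ord_recr /= IH.
Qed.

Lemma time_intC_sqr (t : R) (g h : R -> R) : 0 < t ->
  {within `[0, t], continuous g} -> {within `[0, t], continuous h} ->
  time_intC 0 t (fun s => (g s +i* h s) ^+ 2) =
  (time_int 0 t (fun s => g s ^+ 2) - time_int 0 t (fun s => h s ^+ 2)) +i*
  (time_int 0 t (fun s => (g s + h s) ^+ 2) - time_int 0 t (fun s => g s ^+ 2)
    - time_int 0 t (fun s => h s ^+ 2)).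
Proof.
move=> t0 cg ch.
have ig (f : R -> R) : {within `[0, t], continuous f} -> mu.-integrable `[0, t] (EFin \o f).
  by move=> cf; apply: (within_continuous_integrable cf).
have c2 (f : R -> R) : {within `[0, t], continuous f} ->
    {within `[0, t], continuous (fun s => f s ^+ 2)}.
  by move=> cf x; have h2 := cvgM (cf x) (cf x); exact: h2.
have cD : {within `[0, t], continuous (fun s => g s + h s)}.
  by move=> x; apply: (cvgD (cg x) (ch x)).
have i1 := ig _ (c2 _ cg); have i2 := ig _ (c2 _ ch); have i3 := ig _ (c2 _ cD).
have i31 : mu.-integrable `[0, t] (EFin \o (fun s => (g s + h s) ^+ 2 - g s ^+ 2)).
  by apply: eq_integrable (integrableB _ i3 i1).
rewrite /time_intC /time_int -!RintegralB//.
by congr (_ +i* _); apply: eq_Rintegral => s _; rewrite complex_sqr.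
Qed.

End square_parts.

Theorem corollary19 (R : realType) (d : measure_display) (T : measurableType d)
    (P : probability T R) (H gamma alpha t : R)
    (W : R -> {RV P >-> R}) (xi : R * R -> R * R)
    (omega : R -> T -> R * R -> R) (phi : R * R -> R[i]) :
  2^-1 < H < 1 -> 2^-1 < gamma < H -> 1 < alpha -> 0 < t ->
  fBm H W ->
  smooth_divfree xi ->
  weak_solution t alpha gamma xi W omega ->
  test_funC phi ->
  {ae P, forall x : T,
    (fun k : nat =>
       ((1 / 2 ^+ k) `^ (1 - 2 * H))%:C *
       \sum_(j \in dyadic_index t k)
         (pairingC (omega (dyadic k j.+1) x) phi -
          pairingC (omega (dyadic k j) x) phi) ^+ 2 : R[i]^o) @ \oo
    --> (time_intC 0 t
           (fun s => (pairingC (omega s x) (advectC xi phi)) ^+ 2) : R[i]^o)}.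
Proof.
move=> /andP[H1 H2] /andP[g1 gH] a1 t0 fW xiS [_ sol] [t1 t2].
have g0 : 0 < gamma by lra.
have b0 : 0 <= alpha - gamma by lra.
apply: filterS2 (fBm_dyadic_var H1 H2 fW) sol => x hQ [_ hh [u hu we]].
have y1 := weak_equation_young_path t0 g0 b0 xiS hh hu we t1.
have y2 := weak_equation_young_path t0 g0 b0 xiS hh hu we t2.
have v1 := young_path_variation H1 H2 g1 t0 hQ y1.
have v2 := young_path_variation H1 H2 g1 t0 hQ y2.
have v3 := young_path_variation H1 H2 g1 t0 hQ (young_pathD y1 y2).
rewrite (time_intC_sqr t0 (young_path_integrand_continuous g0 y1)
  (young_path_integrand_continuous g0 y2)).
apply: cvg_trans (cvg_complex (cvgB v1 v2) (cvgB (cvgB v3 v1) v2)).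
apply: near_eq_cvg; apply: nearW => k.
rewrite dyadic_index_sum//.
pose f1 s := pairing (omega s x) (fun y => complex.Re (phi y)).
pose f2 s := pairing (omega s x) (fun y => complex.Im (phi y)).
pose a j := f1 (dyadic k j.+1) - f1 (dyadic k j).
pose b j := f2 (dyadic k j.+1) - f2 (dyadic k j).
have E (j : nat) : (pairingC (omega (dyadic k j.+1) x) phi -
    pairingC (omega (dyadic k j) x) phi) ^+ 2 =
    (a j ^+ 2 - b j ^+ 2) +i* ((a j + b j) ^+ 2 - a j ^+ 2 - b j ^+ 2).
  by rewrite -complex_sqr.
rewrite (eq_bigr _ (fun (j : 'I_(dyadic_count t k)) _ => E j)).
rewrite (complex_sum _ (fun j => a j ^+ 2 - b j ^+ 2)
  (fun j => (a j + b j) ^+ 2 - a j ^+ 2 - b j ^+ 2)) !sumrB.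
apply/eqP; rewrite eq_complex /=; apply/andP; split; apply/eqP.
  by rewrite mul0r subr0 mulrBr.
rewrite mul0r addr0 !mulrBr; congr (_ * _ - _ - _).
by apply: eq_bigr => j _; rewrite /a /b /f1 /f2 /=; congr (_ ^+ 2); ring.
Qed.
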